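(* Let $M\cong\mathbb{Z}^n$ be a lattice, $P\subset M_{\mathbb{R}}$ a full-dimensional lattice polytope, $\varphi:M_{\mathbb{R}}\to\mathbb{C}$ a homogeneous polynomial, and $Q'$ a fixed non-empty face of $P$. Let $f=\{f_{Q,Q'}\}_{Q}$ be the weight function on the non-empty faces $Q\preceq P$ given by $f_{Q,Q'}(y)=g_{Q^\circ}(-y)$ for $Q\preceq Q'$ and $f_{Q,Q'}(y)=0$ otherwise. Then for every $\ell\in\mathbb{Z}$ $$E^\varphi_{P,f}(-\ell,y)=(-y)^{\dim(Q')+\deg(\varphi)}\cdot E^\varphi_{P,f}(\ell,1/y),$$ and $$\widetilde{E}^\varphi_{P,f}(-\ell,y)=(-y)^{\dim(Q')}\cdot(-1)^{\deg(\varphi)}\cdot\widetilde{E}^\varphi_{P,f}(\ell,1/y).$$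
   Context: For a weight function $f=\{f_Q(y)\in\mathbb{Z}[y^{\pm1}]\}$ indexed by non-empty faces and $\ell\in\mathbb{Z}_{>0}$, $$\widetilde{E}^\varphi_{P,f}(\ell,y):=\sum_{\emptyset\neq Q\preceq P} f_Q(y)(1+y)^{\dim(Q)}\sum_{m\in \mathrm{Relint}(\ell Q)\cap M}\varphi(m),\qquad E^\varphi_{P,f}(\ell,y):=(1+y)^{\deg(\varphi)}\widetilde{E}^\varphi_{P,f}(\ell,y),$$ with $\mathrm{Relint}$ the relative interior. These are values of polynomials in $\ell$ with coefficients in $\mathbb{C}[y^{\pm1}]$, through which they are defined for all $\ell\in\mathbb{Z}$. Polar polytope: choose $k\in\mathbb{Z}_{>0}$ and $m\in M$ such that $P'=kQ'-m$ contains $0$ in its relative interior; $P'$ is a full-dimensional lattice polytope in $\mathrm{Span}(P')$ relative to the lattice $\mathrm{Span}(P')\cap M$. Its polar polytope in the dual space is $P'^\circ=\{v:\langle w,v\rangle\ge-1\text{ for all }w\in P'\}$. There is an order-reversing bijection between faces of $P'$ (equivalently of $Q'$) and faces of $P'^\circ$ (empty face and whole polytope included), $Q\mapsto Q^\circ$, with $\dim Q+\dim Q^\circ=\dim Q'-1$ (and $\dim\emptyset=-1$), so $Q'^\circ=\emptyset$. Stanley's $g$-polynomials: $g_\emptyset(t)=1$, and for a non-empty polytope $\Pi$ of dimension $d$ (a face of $P'^\circ$) $h_\Pi(t)=\sum_{\emptyset\preceq F\prec\Pi}g_F(t)(t-1)^{d-\dim F-1}=\sum_{i=0}^dh_it^i$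 (sum over proper faces including $\emptyset$), and $g_\Pi(t)=h_0+\sum_{1\le i\le\lfloor d/2\rfloor}(h_i-h_{i-1})t^i$. The polynomials $g_{Q^\circ}$ do not depend on the choice of $k,m$. *)

(* Defs.v *)
From HB Require Import structures.
From mathcomp Require Import all_boot all_order all_algebra.
From mathcomp Require Import boolp classical_sets fsbigop reals.
From mathcomp Require Import complex freeg mpoly.
Set Implicit Arguments.
Unset Strict Implicit.
Unset Printing Implicit Defensive.
Import Order.TTheory GRing.Theory Num.Theory.
Local Open Scope classical_set_scope.
Local Open Scope ring_scope.

Section VectorSpace.
Variables (R : realType) (E : vectType R).
Implicit Types (S F : set E) (U : {vspace E}).

Definition is_span S U : Prop :=
  (forall x, S x -> x \in U) /\
  (forall W : {vspace E}, (forall x, S x -> x \in W) -> (U <= W)%VS).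

Lemma is_span_unique S U W : is_span S U -> is_span S W -> U = W.
Proof.
move=> [SU minU] [SW minW]; apply/eqP.
by rewrite eqEsubv minU // minW.
Qed.

Lemma is_span_exists S : exists U, is_span S U.
Proof.
pose p d := `[< exists2 s : seq E, (forall x, x \in s -> S x) & \dim <<s>> = d >].
have exd : exists d, p d.
  by exists 0%N; apply/asboolP; exists [::] => //; rewrite span_nil dimv0.
have led d : p d -> (d <= \dim (fullv : {vspace E}))%N.
  by move=> /asboolP[s _ <-]; rewrite dimvS // subvf.
have [d /asboolP[s Ss ds] dmax] := ex_maxnP exd led.
exists <<s>>%VS; split=> [x Sx|W SW]; last first.
  by apply/span_subvP => x xs; apply: SW; apply: Ss.
have le1 : (<<s>> <= <<x :: s>>)%VS by rewrite span_cons addvSr.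
have le2 : (\dim <<x :: s>> <= \dim <<s>>)%N.
  rewrite ds; apply: dmax; apply/asboolP; exists (x :: s) => // z.
  by rewrite inE => /predU1P[->|/Ss].
have /eqP -> : (<<s>> == <<x :: s>>)%VS by rewrite eqEdim le1.
by rewrite memv_span ?mem_head.
Qed.

(* The linear span of an arbitrary (possibly infinite) subset of E. *)
Definition span_set S : {vspace E} := xget 0%VS [set U | is_span S U].

Lemma span_setP S : is_span S (span_set S).
Proof. by rewrite /span_set; case: xgetP => // /(_ _) H; have [U /H] := is_span_exists S. Qed.

(* Dimension of the affine hull, with the convention [affdim set0 = -1]. *)
Definition affdim S : int :=
  if `[< S = set0 >] then -1
  else (\dim (span_set [set x - y | x in S & y in S]))%:Z.

(* [u = 0] gives the empty face (c = 1) and S itself (c = 0). *)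
Definition face S F : Prop :=
  exists (u : 'Hom(E, R^o)) (c : R),
    (forall x, S x -> u x <= c) /\ F = [set x | S x /\ u x = c].

(* [fuel] bounds the recursion on the dimension.  Proper faces have smaller
   dimension, so every [fuel >= affdim S + 1] gives the same polynomial. *)
Fixpoint stanley_g_rec (fuel : nat) S : {poly int} :=
  if fuel is fuel'.+1 then
    if `[< S = set0 >] then 1 else
    let h := \sum_(F \in [set F | face S F /\ F <> S])
               stanley_g_rec fuel' F * ('X - 1) ^ (affdim S - affdim F - 1) in
    \poly_(i < (absz (affdim S))./2.+1) (if i is j.+1 then h`_i - h`_j else h`_0)
  else 1.

Definition stanley_g S : {poly int} := stanley_g_rec (absz (affdim S + 1)) S.

Definition polar S : set 'Hom(E, R^o) :=
  [set v | forall w, S w -> -1 <= v w].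

(* The face of [polar S] dual to the face F of S; the faces [set0] and S have
   as duals [polar S] and (when 0 lies in S) [set0]. *)
Definition polar_face S F : set 'Hom(E, R^o) :=
  [set v | polar S v /\ forall w, F w -> v w = -1].

End VectorSpace.

Section LatticePolytope.
Variables (R : realType) (n : nat).
Notation MR := 'rV[R]_n.
Notation M := 'rV[int]_n.
Implicit Types (P Q S F : set MR).

Definition lattice_point (m : M) : MR := map_mx intr m.

Definition conv_hull S : set MR :=
  [set z | exists (k : nat) (x : 'I_k -> MR) (c : 'I_k -> R),
    [/\ forall i, S (x i), forall i, 0 <= c i, \sum_i c i = 1
      & z = \sum_i c i *: x i]].

Definition aff_hull S : set MR :=
  [set z | exists (k : nat) (x : 'I_k -> MR) (c : 'I_k -> R),
    [/\ forall i, S (x i), \sum_i c i = 1 & z = \sum_i c i *: x i]].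

Definition relint S : set MR :=
  [set x | S x /\ exists2 e : R, 0 < e &
    forall z, aff_hull S z -> (forall i, `|z 0 i - x 0 i| < e) -> S z].

Definition lattice_polytope P : Prop :=
  exists V : seq M, P = conv_hull [set lattice_point v | v in [set` V]].

Definition dilate (a : R) S : set MR := [set a *: x | x in S].

Definition dilate_shift (k : nat) (m : M) S : set MR :=
  [set k%:R *: x - lattice_point m | x in S].

(* A subset of Span(S') seen in the vector space Span(S'). *)
Definition in_span S' S : set (subvs_of (span_set S')) :=
  [set w | S (vsval w)].
Arguments in_span : clear implicits.

(* The face dual to Q of the polar of P' = k Q' - m; that polar lies in the
   dual of Span(P'). *)
Definition dual_face (k : nat) (m : M) Q' Q :=
  let P' := dilate_shift k m Q' in
  polar_face (in_span P' P') (in_span P' (dilate_shift k m Q)).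

End LatticePolytope.

Arguments dual_face {R n} k m Q' Q.

(* Z[y, 1/y], as finitely supported coefficients indexed by the exponent: only
   the additive structure and the evaluation at units are needed. *)
Definition laurentZ := {freeg int / int}.

Definition laurent_of_poly (p : {poly int}) : laurentZ :=
  \sum_(i < size p) << p`_i *g i%:Z >>.

Definition laurent_eval (K : fieldType) (p : laurentZ) (y : K) : K :=
  \sum_(i <- dom p) (coeff i p)%:~R * y ^ i.

Section WeightedEhrhart.
Variables (R : realType) (n : nat).
Notation MR := 'rV[R]_n.
Notation M := 'rV[int]_n.
Notation C := R[i].

(* C(y), which contains C[y, 1/y]. *)
Notation K := {fraction {poly C}}.

Definition ratvar : K := tofrac 'X.
Definition is_laurent (x : K) : Prop :=
  exists (p : {poly C}) (k : nat), x = tofrac p / ratvar ^+ k.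

Implicit Types (P Q : set MR) (f : set MR -> laurentZ) (phi : {mpoly C[n]}).

Definition lattice_sum phi (S : set MR) : C :=
  \sum_(m \in [set m : M | relint S (lattice_point R m)])
    phi.@[fun i => (m ord0 i)%:~R].

(* The value at l > 0 of the function with y evaluated at an element of C(y),
   so that [y := ratvar] and [y := ratvar^-1] give the two sides of the
   duality y <-> 1/y. *)
Definition ehrhart_value P f phi (l : nat) (y : K) : K :=
  \sum_(Q \in [set Q | face P Q /\ Q !=set0])
    laurent_eval (f Q) y * (1 + y) ^ (affdim Q)
      * tofrac (lattice_sum phi (dilate l%:R Q))%:P.

Definition is_ehrhart_poly P f phi (y : K) (p : {poly K}) : Prop :=
  (forall i, is_laurent p`_i) /\
  (forall l : nat, (0 < l)%N -> p.[l%:R] = ehrhart_value P f phi l y).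

(* At most one polynomial satisfies [is_ehrhart_poly], because K has
   characteristic 0; the default value 0 is only reached when none does. *)
Definition ehrhart_poly P f phi (y : K) : {poly K} :=
  xget 0 [set p | is_ehrhart_poly P f phi y p].

Definition Etilde P f phi (l : int) (y : K) : K :=
  (ehrhart_poly P f phi y).[l%:~R].

(* [msize] is 1 + the total degree. *)
Definition pdeg phi : nat := (msize phi).-1.

Definition Ephi P f phi (l : int) (y : K) : K :=
  (1 + y) ^+ pdeg phi * Etilde P f phi l y.

Definition g_weight (k : nat) (m : M) (Q' Q : set MR) : laurentZ :=
  if `[< face Q' Q >]
  then laurent_of_poly (stanley_g (dual_face k m Q' Q) \Po (- 'X))
  else 0.

End WeightedEhrhart.

(* Main.v *)
(* By Ehrhart reciprocity, [e_Q(-l) = (-1)^(dim Q + deg phi) Sum_(F <= Q) e_F(l)],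
   where [e_F(l)] is the sum of [phi] over the lattice points of the relative
   interior of [l F] and [F] ranges over the non-empty faces of [Q].  With
   [t = -y], comparing the coefficients of [e_F(l)] on both sides reduces the
   theorem to
     [Sum_(F <= Q <= Q') g_(Q°)(t) (t-1)^(dim Q - dim F)
        = t^(dim Q' - dim F) g_(F°)(1/t)],
   which is Stanley's palindromicity of the [h]-polynomial of [F°]; it only needs
   the face lattice above a non-empty face to be Eulerian.

   Reciprocity is obtained from a regular triangulation with generic heights of
   the cone over [Q], made half-open by an infinitesimal displacement along a
   generic interior direction: displacing inwards gives a disjoint decomposition
   of the cone, displacing outwards one of its relative interior, and the two
   displacements exchange complementary half-open simplicial cones.

   The Euler relation needs no topology: applying reciprocity twice to a weight
   that isolates a single lattice point yields it for lattice polytopes. *)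

Require Import Defs.
From HB Require Import structures.
From mathcomp Require Import all_boot all_order all_algebra.
From mathcomp Require Import boolp classical_sets fsbigop reals.
From mathcomp Require Import complex mpoly.
From mathcomp Require Import freeg zify ring lra.
Set Implicit Arguments.
Unset Strict Implicit.
Unset Printing Implicit Defensive.
Import Order.TTheory GRing.Theory Num.Theory.
Local Open Scope classical_set_scope.
Local Open Scope ring_scope.

(** * Stanley polynomials over an Eulerian poset *)

(** A face is represented by the set of indices of the generators that lie on it. Sums over faces
    then run over a finite type, and one index set denotes a face of [Q'], the corresponding face of
    [P'] and its dual face, although these live in different vector spaces. This matters because the
    Euler relation is proved for lattice polytopes, whereas the polar polytope is in general not
    one: the relation is established for [Q'] and transported along index sets, duality merely
    reversing inclusion. Points are homogenized, so that a lattice point of the [l]-th dilate is a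
    vector of height [l] and relative interiors are described by positive coefficients on all
    generators of a face. Wherever an argument moves a point a little, the step is an explicit
    inverse [(1 + sum of ratios)^-1] over finitely many constraints. Statements at [- l] are
    identities of polynomials, checked at positive integers, where the values are lattice sums. *)

Definition polyrev (A : nzRingType) (r : nat) (p : {poly A}) : {poly A} :=
  \poly_(i < r.+1) p`_(r - i).

Section Reverse.
Variable A : comNzRingType.
Implicit Types p q : {poly A}.

Lemma coef_polyrev r p i : (polyrev r p)`_i = if (i <= r)%N then p`_(r - i) else 0.
Proof. by rewrite coef_poly ltnS. Qed.

Fact polyrev_is_linear r : linear (@polyrev A r).
Proof.
move=> a p q; apply/polyP => i.
rewrite !(coef_polyrev, coefD, coefZ); case: ifP => _ //.
by rewrite mulr0 addr0.
Qed.
HB.instance Definition _ r :=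
  GRing.isLinear.Build A {poly A} {poly A} _ (@polyrev A r) (polyrev_is_linear r).

Lemma polyrevXn r k : (k <= r)%N -> polyrev r 'X^k = 'X^(r - k) :> {poly A}.
Proof.
move=> kr; apply/polyP => i; rewrite coef_polyrev !coefXn.
case: ifP => ir; first by congr (_%:R); lia.
by rewrite (_ : _ == _ = false) //; lia.
Qed.

Lemma polyrevM r s p q : (size p <= r.+1)%N -> (size q <= s.+1)%N ->
  polyrev (r + s) (p * q) = polyrev r p * polyrev s q.
Proof.
move=> sp sq.
have E (u : {poly A}) t : (size u <= t.+1)%N -> u = \sum_(i < t.+1) u`_i *: 'X^i :> {poly A}.
  move=> su; rewrite -poly_def; apply/polyP => i; rewrite coef_poly.
  by case: ifP => // it; rewrite nth_default // (leq_trans su) // leqNgt it.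
rewrite [in LHS](E p r) // [in LHS](E q s) // [in RHS](E p r) // [in RHS](E q s) //.
rewrite !linear_sum !mulr_suml linear_sum; apply: eq_bigr => i _ /=.
rewrite !mulr_sumr linear_sum; apply: eq_bigr => j _ /=.
have := ltn_ord i; have := ltn_ord j; rewrite !ltnS => js ir.
rewrite -!scalerAl -!scalerAr -exprD !linearZ /=.
rewrite !polyrevXn ?leq_add // -scalerAl -scalerAr -exprD.
by congr (_ *: (_ *: 'X^_)); lia.
Qed.

Lemma polyrev_Xsub1 k : polyrev k (('X - 1) ^+ k) = (1 - 'X) ^+ k :> {poly A}.
Proof.
elim: k => [|k IH]; first by rewrite !expr0 -(expr0 'X) polyrevXn // subnn.
rewrite !exprSr -addn1 polyrevM ?IH ?(size_exp_XsubC _ 1) ?size_XsubC //.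
congr (_ * _).
by rewrite linearB /= -{1}(expr1 'X) -(expr0 'X) !polyrevXn //= expr0 expr1.
Qed.

End Reverse.

(* In the application [le] is inclusion of faces of a polytope and [c F] is one
   more than the dimension of the face dual to [F]. *)
Section StanleyPalindromic.
Variables (T : finType) (le : rel T) (c : T -> nat) (gam : T -> {poly int}).
Let h G := \sum_(F | le G F && (F != G)) gam F * ('X - 1) ^+ (c G - c F - 1).

(** Induction on [c G]. The product [('X - 1) * h G] is antisymmetric under reversal in degree
    [c G], and [gam G] is the lower half of its negative. Adding [gam G] cancels the lower half and
    leaves the upper one, which is the reversal of [gam G]. *)
Lemma stanley_palindromic :
  (forall F, le F F) -> (forall F G H, le F G -> le G H -> le F H) ->
  (forall F G, le F G -> le G F -> F = G) ->
  (forall F G, le F G -> F != G -> (c G < c F)%N) ->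
  (forall G H, le G H -> G != H ->
     \sum_(F | le G F && le F H) (-1) ^+ c F = 0 :> int) ->
  (forall G, c G = 0%N -> gam G = 1) ->
  (forall G d, c G = d.+1 -> gam G =
     \poly_(i < d./2.+1) (if i is j.+1 then (h G)`_i - (h G)`_j else (h G)`_0)) ->
  forall G, \sum_(F | le G F) gam F * ('X - 1) ^+ (c G - c F)
            = polyrev (c G) (gam G).
Proof.
move=> lexx letr leanti ltc eul gam0 gamS G.
have szg F : (size (gam F) <= (c F).-1./2.+1)%N.
  case E: (c F) => [|d]; first by rewrite gam0 // size_poly1.
  by rewrite (gamS _ _ E) size_poly.
have lec F H : le F H -> (c H <= c F)%N.
  by move=> FH; have [->//|ne] := eqVneq F H; apply/ltnW/ltc.
have [n cn] := ubnP (c G); elim: n G cn => // n IH G; rewrite ltnS => cn.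
rewrite (bigD1 G) //= subnn expr0 mulr1.
case E: (c G) => [|d].
  rewrite big1 ?addr0 => [|F /andP[GF FG]]; last first.
    by have := ltc _ _ GF; rewrite eq_sym E => /(_ FG).
  by rewrite gam0 // -(expr0 'X) polyrevXn.
have fE : \sum_(F | le G F && (F != G)) gam F * ('X - 1) ^+ (d.+1 - c F)
        = ('X - 1) * h G.
  rewrite mulr_sumr; apply: eq_bigr => F /andP[GF FG].
  rewrite mulrCA -exprS; congr (_ * _ ^+ _).
  by have := ltc _ _ GF; rewrite eq_sym E => /(_ FG); lia.
have szX k : size (('X - 1 : {poly int}) ^+ k) = k.+1.
  by rewrite (size_exp_XsubC k (1 : int)).
have szX1 : size ('X - 1 : {poly int}) = 2%N by rewrite -(szX 1%N) expr1.
have szh : (size (h G) <= d.+1)%N.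
  apply: (leq_trans (size_sum _ _ _)); apply/bigmax_leqP => F /andP[GF FG].
  have := ltc _ _ GF; rewrite eq_sym E => /(_ FG) cF.
  apply: leq_trans (size_polyMleq _ _) _; rewrite szX; have := szg F; lia.
(* The induction hypothesis expands each reversed [gam F] into a sum over the [H] above [F]. After
   exchanging the sums, [H] carries the signs of all [F] with [G < F <= H]; by the Euler relation
   they add up to minus the sign of the missing term [F = G]. *)
have palM : polyrev d.+1 (('X - 1) * h G) = - (('X - 1) * h G).
  rewrite -{1}fE linear_sum /=.
  have -> : \sum_(F | le G F && (F != G)) polyrev d.+1 (gam F * ('X - 1) ^+ (d.+1 - c F))
    = \sum_(F | le G F && (F != G)) \sum_(H | le F H)
        gam H * ('X - 1) ^+ (d.+1 - c H) * ((-1) ^+ (d.+1 - c F))%:P.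
    apply: eq_bigr => F /andP[GF FG].
    have := ltc _ _ GF; rewrite eq_sym E => /(_ FG) cF.
    have dE : d.+1 = (c F + (d.+1 - c F))%N by lia.
    rewrite [X in polyrev X _]dE polyrevM ?szX //; last by apply: leq_trans (szg F) _; lia.
    rewrite polyrev_Xsub1 -IH; last by lia.
    rewrite mulr_suml; apply: eq_bigr => H FH.
    have := lec _ _ FH => cH.
    rewrite -[1 - 'X]opprB [(- ('X - 1)) ^+ _]exprNn polyC_exp polyCN -!mulrA; congr (_ * _).
    rewrite mulrCA -exprD mulrC; congr (_ ^+ _ * _); lia.
  rewrite (exchange_big_dep (fun H => le G H && (H != G))) /=; last first.
    move=> F H /andP[GF FG] FH; rewrite (letr _ _ _ GF FH) /=.
    by apply: contra_neq FG => HG; rewrite HG in FH; apply: leanti.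
  rewrite -fE -sumrN; apply: eq_bigr => H /andP[GH HG].
  rewrite -mulr_sumr -[RHS]mulrN1; congr (_ * _).
  rewrite -(rmorphN1 (@polyC int)) -(rmorph_sum (@polyC int)); congr (_%:P).
  have GH' : G != H by rewrite eq_sym.
  have := eul _ _ GH GH'; rewrite (bigD1 G) ?lexx //= E => /eqP.
  rewrite addr_eq0 => /eqP eqG.
  have -> : \sum_(F | le G F && (F != G) && le F H) (-1) ^+ (d.+1 - c F)
     = (-1) ^+ d.+1 * \sum_(F | le G F && le F H && (F != G)) (-1) ^+ c F :> int.
    rewrite mulr_sumr; apply: eq_big => [F|F /andP[/andP[GF FG] FH]].
      by rewrite -!andbA [(F != G) && _]andbC.
    have := lec _ _ GF; rewrite E => cF.
    by rewrite -[in RHS](subnK cF) exprD -mulrA -exprMn mulrNN mulr1 expr1n mulr1.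
  rewrite -[\sum_(_ | _) _]opprK -eqG mulrN -exprMn mulrNN mulr1 expr1n //.
have szM : (size (('X - 1) * h G)%R <= d.+2)%N.
  by apply: leq_trans (size_polyMleq _ _) _; rewrite szX1.
rewrite fE.
have cM i : (('X - 1) * h G)`_i = - (if i is j.+1 then (h G)`_i - (h G)`_j else (h G)`_0).
  by rewrite mulrBl mul1r coefB coefXM; case: i => [|i] /=; rewrite ?sub0r ?opprB.
have cP i : (i <= d.+1)%N -> (('X - 1) * h G)`_(d.+1 - i) = - (('X - 1) * h G)`_i.
  move=> id; have := congr1 (fun p : {poly int} => p`_i) palM.
  by rewrite coef_polyrev id coefN.
have cg i : (gam G)`_i = if (i < d./2.+1)%N then - (('X - 1) * h G)`_i else 0.
  rewrite (gamS _ _ E) coef_poly; case: ifP => // _.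
  by rewrite cM opprK.
have cM2 i : (d.+2 <= i)%N -> (('X - 1) * h G)`_i = 0.
  by move=> di; rewrite nth_default // (leq_trans szM).
apply/polyP => i; rewrite coefD coef_polyrev !cg.
have [id|id] := leqP i d.+1; last first.
  by rewrite cM2 // oppr0; case: ifP; rewrite addr0.
rewrite cP // opprK.
case: ifP => i1; case: ifP => i2.
- lia.
- by rewrite addNr.
- by rewrite add0r.
rewrite add0r.
(* Only the middle coefficient is left, for odd [d]; it is its own mirror image and vanishes by
   antisymmetry. *)
have iE : (d.+1 - i)%N = i by lia.
have := cP i id; rewrite iE; move: (('X - 1) * h G)`_i => a; lia.
Qed.

End StanleyPalindromic.

(** * Polynomial sums over dilated simplices *)

Lemma sum_bin_col k a : (\sum_(i < k.+1) 'C(i, a) = 'C(k.+1, a.+1))%N.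
Proof.
elim: k => [|k IH]; last by rewrite big_ord_recr IH /= [in RHS]binS.
by rewrite big_ord1; case: a => [|a]; rewrite ?bin0n ?bin1 // !bin_small.
Qed.

(** Counts the subsets of [{0, ..., k}] of size [a + b + 1] by their element [i] of rank [a + 1]. *)
Lemma sum_bin_bin k a b :
  (\sum_(i < k.+1) 'C(i, a) * 'C(k - i, b) = 'C(k.+1, (a + b).+1))%N.
Proof.
elim: b k => [|b IHb] k.
  by rewrite addn0 -sum_bin_col; apply: eq_bigr => i _; rewrite bin0 muln1.
elim: k => [|k IHk].
  by rewrite big_ord1 subnn muln0 bin_small // addnS.
rewrite big_ord_recr /= subnn muln0 addn0.
transitivity (\sum_(i < k.+1) ('C(i, a) * 'C(k - i, b.+1) + 'C(i, a) * 'C(k - i, b)))%N.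
  by apply: eq_bigr => i _; rewrite subSn ?binS ?mulnDr // -ltnS.
by rewrite big_split /= IHk IHb addnS [in RHS]binS.
Qed.

Lemma sum_bin_shift k a : (\sum_(i < k.+1) 'C(i + a, a) = 'C(k + a.+1, a.+1))%N.
Proof.
elim: k => [|k IH]; first by rewrite big_ord1 !add0n !binn.
by rewrite big_ord_recr IH /= [in RHS]addSn [in RHS]binS addSnnS.
Qed.

(** ['C(i + a, a)] is the coefficient of [t^i] in [(1 - t)^-(a+1)]; this compares coefficients in a
    product of two such series. *)
Lemma sum_bin_bin_shift k a b :
  (\sum_(i < k.+1) 'C(i + a, a) * 'C(k - i + b, b)
   = 'C(k + (a + b).+1, (a + b).+1))%N.
Proof.
elim: b k => [|b IHb] k.
  by rewrite addn0 -sum_bin_shift; apply: eq_bigr => i _; rewrite bin0 muln1.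
elim: k => [|k IHk]; first by rewrite big_ord1 !add0n !binn.
transitivity (\sum_(i < k.+2) ('C(i + a, a) * 'C(k.+1 - i + b, b.+1)
                            + 'C(i + a, a) * 'C(k.+1 - i + b, b)))%N.
  by apply: eq_bigr => i _; rewrite addnS binS mulnDr.
rewrite big_split /= IHb big_ord_recr /= subnn add0n (bin_small (ltnSn b)) muln0 addn0.
transitivity (\sum_(i < k.+1) 'C(i + a, a) * 'C(k - i + b.+1, b.+1)
                + 'C(k.+1 + (a + b).+1, (a + b).+1))%N.
  congr (_ + _)%N; apply: eq_bigr => i _; rewrite subSn ?addSnnS // -ltnS //.
rewrite IHk [in RHS]addSn [in RHS]binS; congr (_ + 'C(_, _))%N; lia.
Qed.

Section Binomials.
Variable F : numFieldType.

Definition binpoly a : {poly F} := (a`!%:R)^-1 *: \prod_(i < a) ('X - i%:R%:P).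

Lemma horner_binpoly a (x : F) : (binpoly a).[x] = (a`!%:R)^-1 * \prod_(i < a) (x - i%:R).
Proof. by rewrite hornerZ horner_prod; congr (_ * _); apply: eq_bigr => i _; rewrite hornerXsubC. Qed.

Lemma factr_neq0 a : a`!%:R != 0 :> F.
Proof. by rewrite pnatr_eq0 -lt0n fact_gt0. Qed.

Lemma binpoly_nat a n : (binpoly a).[n%:R] = 'C(n, a)%:R.
Proof.
rewrite horner_binpoly; apply: (mulfI (factr_neq0 a)).
rewrite mulVKf ?factr_neq0 // -natrM mulnC bin_ffact.
elim: a => [|a IH]; first by rewrite big_ord0.
rewrite big_ord_recr IH /= ffactnSr.
have [na|an] := ltnP n a; first by rewrite ffact_small // !mul0r mul0n.
by rewrite natrM natrB.
Qed.

(** Negation of the upper index: the source of the sign and of the shift by one in reciprocity for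
    simplices. *)
Lemma binpoly_neg a n : (binpoly a).[-1 - n%:R] = (-1) ^+ a * 'C(n + a, a)%:R.
Proof.
rewrite horner_binpoly; apply: (mulfI (factr_neq0 a)).
rewrite mulVKf ?factr_neq0 // mulrCA -natrM [(a`! * _)%N]mulnC bin_ffact.
elim: a => [|a IH]; first by rewrite big_ord0 mulr1.
rewrite big_ord_recr IH /= [in RHS]addnS ffactSS natrM exprSr -[(n + a).+1]addn1 !natrD.
by ring.
Qed.

Lemma mulx_binpoly a (x : F) :
  x * (binpoly a).[x] = a.+1%:R * (binpoly a.+1).[x] + a%:R * (binpoly a).[x].
Proof.
rewrite !horner_binpoly big_ord_recr /= factS natrM invfM.
have := factr_neq0 a; have : a.+1%:R != 0 :> F by rewrite pnatr_eq0.
by move: (a.+1%:R) (a`!%:R) => u v u0 v0; field; rewrite v0 u0.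
Qed.

Variable J : finType.

(* In the binomial basis, summing a polynomial over the lattice points of a
   dilated standard simplex is a Vandermonde convolution. *)
Definition binspan (psi : (J -> F) -> F) :=
  exists l : seq (F * {ffun J -> nat}),
    forall x, psi x = \sum_(t <- l) t.1 * \prod_j (binpoly (t.2 j)).[x j].

Lemma binspan_const c : binspan (fun=> c).
Proof.
exists [:: (c, [ffun=> 0%N])] => x; rewrite big_seq1 big1 ?mulr1 // => j _.
by rewrite ffunE horner_binpoly big_ord0 fact0 invr1 mulr1.
Qed.

Lemma binspanD f g : binspan f -> binspan g -> binspan (fun x => f x + g x).
Proof. by move=> [l fl] [l' gl]; exists (l ++ l') => x; rewrite big_cat fl gl. Qed.

Lemma binspanZ c f : binspan f -> binspan (fun x => c * f x).
Proof.
move=> [l fl]; exists [seq (c * t.1, t.2) | t <- l] => x.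
by rewrite big_map fl mulr_sumr; apply: eq_bigr => t _; rewrite mulrA.
Qed.

Lemma binspan_sum I (s : seq I) (f : I -> (J -> F) -> F) :
  (forall i, binspan (f i)) -> binspan (fun x => \sum_(i <- s) f i x).
Proof.
move=> fB; elim: s => [|i s IH].
  by exists [::] => x; rewrite !big_nil.
by have [l fl] := binspanD (fB i) IH; exists l => x; rewrite big_cons fl.
Qed.

Lemma binspan_ext f g : f =1 g -> binspan f -> binspan g.
Proof. by move=> fg [l fl]; exists l => x; rewrite -fg fl. Qed.

Lemma binspan_coord j0 f : binspan f -> binspan (fun x => x j0 * f x).
Proof.
move=> [l fl].
pose up (t : F * {ffun J -> nat}) (x : J -> F) :=
  x j0 * (t.1 * \prod_j (binpoly (t.2 j)).[x j]).
apply: (@binspan_ext (fun x => \sum_(t <- l) up t x)).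
  by move=> x; rewrite fl mulr_sumr.
apply: binspan_sum => t.
exists [:: (t.1 * (t.2 j0).+1%:R, [ffun j => if j == j0 then (t.2 j).+1 else t.2 j]);
           (t.1 * (t.2 j0)%:R, t.2)] => x.
rewrite /up big_cons big_seq1 (bigD1 j0) //= [in RHS](bigD1 j0) //= ffunE eqxx.
rewrite mulrCA [x j0 * (_ * _)]mulrA mulx_binpoly.
under [in RHS]eq_bigr => j /negbTE jj do rewrite ffunE jj.
by ring.
Qed.

(** [K] makes the index type finite; for [k <= K] it excludes no family of naturals with sum [k]. *)
Lemma sum_prod_coef K k (f : J -> nat -> F) :
  \sum_(n : {ffun J -> 'I_K.+1} | (\sum_j n j == k)%N) \prod_j f j (n j)
   = (\prod_j \poly_(i < K.+1) f j i)`_k.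
Proof.
under [in RHS]eq_bigr do rewrite poly_def.
rewrite bigA_distr_bigA coef_sum [LHS]big_mkcond; apply: eq_bigr => n _ /=.
rewrite scaler_prod prodrXr coefZ coefXn eq_sym.
by case: eqP; rewrite ?mulr1 ?mulr0.
Qed.

Lemma coef_conv (f g : nat -> F) K (p : {poly F}) k : (k <= K)%N ->
  (forall i, (i <= k)%N -> p`_i = g i) ->
  ((\poly_(i < K.+1) f i) * p)`_k = \sum_(i < k.+1) f i * g (k - i)%N.
Proof.
move=> kK pg; rewrite coefM; apply: eq_bigr => i _.
rewrite coef_poly pg ?leq_subr // (_ : (i < K.+1)%N) //.
by rewrite (leq_trans (ltn_ord i)).
Qed.

Lemma coef_prod_bin K (a : J -> nat) j s k : (k <= K)%N ->
  (\prod_(i <- j :: s) \poly_(u < K.+1) ('C(u, a i)%:R : F))`_k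
   = 'C(k + size s, \sum_(i <- j :: s) a i + size s)%:R.
Proof.
elim: s j k => [|i s IH] j k kK.
  by rewrite !big_seq1 coef_poly ltnS kK !addn0.
rewrite big_cons (@coef_conv _ (fun u => 'C(u + size s, \sum_(i <- i :: s) a i + size s)%:R)) //.
  rewrite [in RHS]big_cons /= !addnS -addnA -addSn.
  transitivity (\sum_(u < k.+1 + size s) ('C(u, a j) *
     'C(k + size s - u, \sum_(i <- i :: s) a i + size s))%:R : F).
    rewrite big_split_ord /= [X in _ = _ + X]big1 ?addr0.
      apply: eq_bigr => u _; rewrite -natrM; congr ((_ * 'C(_, _))%:R).
      have := ltn_ord u; lia.
    move=> u _; rewrite (@bin_small (_ - _)) ?muln0 //; have := ltn_ord u; lia.
  by rewrite -natr_sum addSn sum_bin_bin.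
by move=> u uk; rewrite IH //; lia.
Qed.

Lemma coef_prod_bin_shift K (a : J -> nat) j s k : (k <= K)%N ->
  (\prod_(i <- j :: s) \poly_(u < K.+1) ('C(u + a i, a i)%:R : F))`_k
   = 'C(k + (\sum_(i <- j :: s) a i + size s), \sum_(i <- j :: s) a i + size s)%:R.
Proof.
elim: s j k => [|i s IH] j k kK.
  by rewrite !big_seq1 coef_poly ltnS kK !addn0.
rewrite big_cons (@coef_conv _ (fun u => 'C(u + (\sum_(i <- i :: s) a i + size s), \sum_(i <- i :: s) a i + size s)%:R)) //.
  rewrite [in RHS]big_cons /= addnS -addnA -sum_bin_bin_shift natr_sum.
  by apply: eq_bigr => u _; rewrite natrM.
by move=> u uk; rewrite IH //; lia.
Qed.

(** With [r = #|J| - 1], each product of binomials sums to a single binomial with upper index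
    [k + r]. Its lower index is at least [r], whence the zeros at [-1, ..., -r]: those dilates of
    the simplex have no interior lattice point. The vectors with entries [-1 - n j] are the
    negatives of the interior points of the dilate by [k + #|J|]. *)
Lemma simplex_reciprocity psi : (0 < #|J|)%N -> binspan psi ->
  exists p : {poly F}, [/\
    forall k K, (k <= K)%N ->
      \sum_(n : {ffun J -> 'I_K.+1} | (\sum_j n j == k)%N)
        psi (fun j => (n j)%:R) = p.[k%:R],
    forall k, (0 < k < #|J|)%N -> p.[- k%:R] = 0
  & forall k K, (k <= K)%N -> (-1) ^+ #|J|.-1 *
      \sum_(n : {ffun J -> 'I_K.+1} | (\sum_j n j == k)%N)
        psi (fun j => -1 - (n j)%:R) = p.[- (k + #|J|)%:R]].
Proof.
move=> J0 [l psiE]; pose r := #|J|.-1.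
have rE : #|J| = r.+1 by rewrite prednK.
have [j0 [s sE]] : exists j0 s, enum J = j0 :: s.
  by move: J0; rewrite cardE; case: (enum J) => // j0 s _; exists j0, s.
have ss : size s = r by move: rE; rewrite cardE sE => -[].
pose A (t : F * {ffun J -> nat}) := (\sum_j t.2 j + r)%N.
exists (\sum_(t <- l) t.1 *: (binpoly (A t) \Po ('X + r%:R%:P))).
have pE x : (\sum_(t <- l) t.1 *: (binpoly (A t) \Po ('X + r%:R%:P))).[x]
    = \sum_(t <- l) t.1 * (binpoly (A t)).[x + r%:R].
  rewrite horner_sum; apply: eq_bigr => t _.
  by rewrite hornerZ horner_comp hornerD hornerX hornerC.
split=> [k K kK|k kr|k K kK].
- rewrite pE; under eq_bigr do rewrite psiE.
  rewrite exchange_big; apply: eq_bigr => t _ /=; rewrite -mulr_sumr; congr (_ * _).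
  rewrite -natrD binpoly_nat /=.
  under eq_bigr do under eq_bigr do rewrite binpoly_nat.
  rewrite (sum_prod_coef K k (fun j u => 'C(u, t.2 j)%:R)) -(big_enum _ _ _ _) /= sE.
  by rewrite coef_prod_bin // ss -sE big_enum.
- rewrite pE big1 // => t _.
  have -> : - k%:R + r%:R = (r - k)%:R :> F by rewrite natrB; [exact: addrC | lia].
  by rewrite binpoly_nat bin_small ?mulr0 // /A; lia.
- rewrite pE; under eq_bigr do rewrite psiE.
  rewrite exchange_big mulr_sumr; apply: eq_bigr => t _ /=.
  rewrite -mulr_sumr mulrCA; congr (_ * _).
  under eq_bigr do under eq_bigr do rewrite binpoly_neg.
  under eq_bigr do rewrite big_split prodrXr /=.
  rewrite -mulr_sumr (sum_prod_coef K k (fun j u => 'C(u + t.2 j, t.2 j)%:R)).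
  rewrite -(big_enum _ _ _ (fun i => \poly_(_ < _) _)) /= sE coef_prod_bin_shift //.
  rewrite ss -sE big_enum /= mulrA -exprD addnC.
  have -> : - (k + #|J|)%:R + r%:R = -1 - k%:R :> F.
    by rewrite rE natrD -[r.+1]addn1 natrD; ring.
  by rewrite binpoly_neg.
Qed.

End Binomials.

Lemma poly_eq_natr (A : idomainType) (p p' : {poly A}) :
  injective (fun i : nat => i%:R : A) ->
  (forall l, (0 < l)%N -> p.[l%:R] = p'.[l%:R]) -> p = p'.
Proof.
move=> natr_inj pp; apply/eqP; rewrite -subr_eq0; apply: contrapT => /negP d0.
pose rs := [seq (i.+1)%:R | i <- iota 0 (size (p - p'))] : seq A.
have : (size rs < size (p - p')%R)%N.
  apply: max_poly_roots => //.
    by apply/allP => z /mapP[j _ ->]; rewrite /root hornerD hornerN pp // subrr.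
  by rewrite map_inj_uniq ?iota_uniq // => i j /natr_inj[].
by rewrite size_map size_iota ltnn.
Qed.

(** * Half-open triangulations of cones *)

Lemma exists_nonroot (R : realFieldType) (K : finType) (p : K -> {poly R}) :
  (forall k, p k != 0) -> exists2 s : R, 0 < s & forall k, (p k).[s] != 0.
Proof.
move=> p0; pose P := \prod_k p k.
have P0 : P != 0 by apply/prodf_neq0 => k _.
pose rs := [seq (i.+1)%:R | i <- iota 0 (size P)] : seq R.
have : ~~ all (root P) rs.
  apply/negP => /(max_poly_roots P0).
  rewrite map_inj_uniq ?iota_uniq => [/(_ isT)|i j /eqP].
    by rewrite size_map size_iota ltnn.
  by rewrite eqr_nat => /eqP[].
case/allPn => s /mapP[i _ ->] ns; exists i.+1%:R; first by rewrite ltr0n.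
move=> k; apply: contraNneq ns => pk; rewrite /root horner_prod.
by apply/prodf_eq0; exists k => //; rewrite pk.
Qed.

Section Configuration.
Import mathcomp.boot.fintype mathcomp.boot.finset.
Variables (R : realFieldType) (E : lmodType R) (I : finType) (w : I -> E).
Implicit Types (c d h : {ffun I -> R^o}) (J A : {set I}) (x : E).

Definition comb c : E := \sum_i c i *: w i.

Fact comb_is_linear : linear comb.
Proof.
move=> a c d; rewrite /comb scaler_sumr -big_split; apply: eq_bigr => i _ /=.
by rewrite !ffunE scalerDl scalerA.
Qed.
HB.instance Definition _ :=
  GRing.isLinear.Build R {ffun I -> R^o} E _ comb comb_is_linear.

Definition supp c : {set I} := [set i | c i != 0].

Lemma supp_subP c J : reflect (forall i, i \notin J -> c i = 0) (supp c \subset J).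
Proof.
apply: (iffP subsetP) => [s i iJ|s i].
  by apply/eqP; apply: contraNT iJ => ci; apply: s; rewrite inE.
by rewrite inE; apply: contraNT => iJ; rewrite s.
Qed.

Lemma supp_lin a c d J : supp c \subset J -> supp d \subset J -> supp (a *: c + d) \subset J.
Proof.
move=> /supp_subP sc /supp_subP sd; apply/supp_subP => i iJ.
by rewrite !ffunE sc // sd // scaler0 addr0.
Qed.

Definition indep J := forall c, supp c \subset J -> comb c = 0 -> c = 0.
Definition affbasis J :=
  indep J /\ forall i, exists2 c : {ffun I -> R^o}, supp c \subset J & comb c = w i.

Definition cone x := exists2 c : {ffun I -> R^o}, forall i, 0 <= c i & comb c = x.
(** Positivity at all generators, extreme or not, describes the relative interior of the cone. *)
Definition rcone x := exists2 c : {ffun I -> R^o}, forall i, 0 < c i & comb c = x.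
Definition spanned x := exists c : {ffun I -> R^o}, comb c = x.

(** The simplicial cone on [J] without the facets opposite to the generators in [A]. *)
Definition half_open J A x := exists2 c : {ffun I -> R^o}, supp c \subset J /\ comb c = x &
  forall j, j \in J -> if j \in A then 0 < c j else 0 <= c j.

Lemma indep_inj J c d : indep J -> supp c \subset J -> supp d \subset J ->
  comb c = comb d -> c = d.
Proof.
move=> iJ sc sd cd; apply/eqP; rewrite -subr_eq0; apply/eqP/iJ.
  by rewrite -scaleN1r addrC supp_lin.
by rewrite linearB /= cd subrr.
Qed.

Lemma basis_exists J0 : indep J0 -> exists2 J, affbasis J & J0 \subset J.
Proof.
move=> i0; pose P J := `[< indep J >]; have P0 : P J0 by apply/asboolP.
have [J /maxsetP[/asboolP iJ maxJ] sJ] := maxset_exists P0.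
exists J => //; split=> // i.
have [iJ'|iJ'] := boolP (i \in J).
  exists [ffun j => (j == i)%:R].
    apply/supp_subP => j jJ; rewrite ffunE; case: eqP => // ji.
    by rewrite ji iJ' in jJ.
  rewrite /comb (bigD1 i) //= ffunE eqxx scale1r big1 ?addr0 // => j /negbTE ji.
  by rewrite ffunE ji scale0r.
have : ~ indep (i |: J).
  move=> iiJ; have := maxJ (i |: J); rewrite subsetUr => /(_ _ isT) H.
  by move: iJ'; rewrite -H ?setU11 //; apply/asboolP.
move=> /existsNP[c] /not_implyP[sc] /not_implyP[c0 cn0].
have ci : c i != 0.
  apply/negP => /eqP ci; apply: cn0; apply: iJ => //; apply/supp_subP => j jJ.
  have [->//|ji] := eqVneq j i; move/supp_subP: sc; apply.
  by rewrite !inE (negbTE ji).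
exists [ffun j => if j == i then 0 else - (c i)^-1 * c j].
  apply/supp_subP => j jJ; rewrite ffunE; case: eqVneq => // ji.
  by move/supp_subP: sc => /(_ j) ->; rewrite ?mulr0 // in_setU1 (negbTE ji).
move: c0; rewrite /comb (bigD1 i) //= => c0.
rewrite (bigD1 i) //= ffunE eqxx scale0r add0r.
have -> : \sum_(j | j != i) [ffun j => if j == i then 0 else - (c i)^-1 * c j] j *: w j
   = - (c i)^-1 *: \sum_(j | j != i) c j *: w j.
  rewrite scaler_sumr; apply: eq_bigr => j /negbTE ji.
  by rewrite ffunE ji scalerA.
move/eqP: c0; rewrite addrC addr_eq0 => /eqP ->.
by rewrite scalerN scaleNr opprK scalerA mulVf ?scale1r.
Qed.

Definition coo J x : {ffun I -> R^o} :=
  xget 0 [set c | supp c \subset J /\ comb c = x]%classic.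

Lemma basis_span J x : affbasis J -> spanned x -> exists2 c, supp c \subset J & comb c = x.
Proof.
move=> [_ sJ] [c <-]; have /choice[a aP] i : exists a, supp a \subset J /\ comb a = w i.
  by have [a] := sJ i; exists a.
exists (\sum_i c i *: a i).
  apply: (big_ind (fun u : {ffun I -> R^o} => supp u \subset J)) => [|u v su sv|i _].
  - by apply/supp_subP => i _; rewrite ffunE.
  - by rewrite -[u]scale1r supp_lin.
  rewrite -[_ *: _]addr0 supp_lin ?(aP i).1 //.
  by apply/supp_subP => j _; rewrite ffunE.
by rewrite linear_sum; apply: eq_bigr => i _; rewrite linearZ /= (aP i).2.
Qed.

Lemma cooP J x : affbasis J -> spanned x -> supp (coo J x) \subset J /\ comb (coo J x) = x.
Proof.
move=> bJ sx; rewrite /coo; case: xgetP => [c -> //|].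
by have [c c1 c2] := basis_span bJ sx => /(_ c) /= [].
Qed.

Lemma coo_comb J c : affbasis J -> supp c \subset J -> coo J (comb c) = c.
Proof.
move=> bJ sc; have [|s1 s2] := @cooP J (comb c) bJ; first by exists c.
exact: (indep_inj bJ.1).
Qed.

Lemma spanned_lin a x y : spanned x -> spanned y -> spanned (a *: x + y).
Proof. by move=> [c <-] [d <-]; exists (a *: c + d); rewrite linearP. Qed.

Lemma coo_lin J a x y : affbasis J -> spanned x -> spanned y ->
  coo J (a *: x + y) = a *: coo J x + coo J y.
Proof.
move=> bJ sx sy; have [sx1 sx2] := cooP bJ sx; have [sy1 sy2] := cooP bJ sy.
by rewrite -{1}sx2 -{1}sy2 -linearP coo_comb // supp_lin.
Qed.

Lemma spanned_w i : spanned (w i).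
Proof.
exists [ffun j => (j == i)%:R].
rewrite /comb (bigD1 i) //= ffunE eqxx scale1r big1 ?addr0 // => j /negbTE ji.
by rewrite ffunE ji scale0r.
Qed.

Lemma coo_w J j : affbasis J -> j \in J -> coo J (w j) = [ffun i => (i == j)%:R].
Proof.
move=> bJ jJ; rewrite -[RHS](coo_comb bJ); last first.
  apply/supp_subP => i iJ; rewrite ffunE; case: eqP => // ij.
  by rewrite ij jJ in iJ.
congr (coo J _); rewrite /comb (bigD1 j) //= ffunE eqxx scale1r big1 ?addr0 //.
by move=> i /negbTE ij; rewrite ffunE ij scale0r.
Qed.

Lemma coo_sum J c : affbasis J -> coo J (comb c) = \sum_i c i *: coo J (w i).
Proof.
move=> bJ; rewrite -[RHS](coo_comb bJ); last first.
  apply: (big_ind (fun u : {ffun I -> R^o} => supp u \subset J)) => [|u v su sv|i _].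
  - by apply/supp_subP => i _; rewrite ffunE.
  - by rewrite -[u]scale1r supp_lin.
  rewrite -[_ *: _]addr0 supp_lin ?(cooP bJ (spanned_w i)).1 //.
  by apply/supp_subP => j _; rewrite ffunE.
congr (coo J _); rewrite linear_sum; apply: eq_bigr => i _.
by rewrite linearZ /= (cooP bJ (spanned_w i)).2.
Qed.

(** The height of the lifted combination. Minimizing it over the nonnegative representations of a
    point is a linear program; for a generic point its optimal basis is a cell of the regular
    triangulation. *)
Definition cost h c : R := \sum_i (c i : R) * (h i : R).

Lemma costD h a c d : cost h (a *: c + d) = a * cost h c + cost h d.
Proof.
rewrite /cost mulr_sumr -big_split; apply: eq_bigr => i _ /=.
by rewrite !ffunE mulrDl mulrA.
Qed.

(** Caratheodory's argument: a multiple of a linear relation among the generators in use is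
    subtracted until a coefficient vanishes. Orienting the relation to have nonnegative cost keeps
    the cost from growing. *)
Lemma reduce_support h c : (forall i, 0 < h i) -> (forall i, 0 <= c i) ->
  exists c', [/\ forall i, 0 <= c' i, indep (supp c'), comb c' = comb c
               & cost h c' <= cost h c].
Proof.
move=> h0; have [n cn] := ubnP #|supp c|; elim: n c cn => // n IH c; rewrite ltnS => cn c0.
case: (pselect (indep (supp c))) => [ic|]; first by exists c.
move=> /existsNP[d0] /not_implyP[sd0] /not_implyP[cd0 dn0].
(* One of [d0] and [- d0] qualifies: as [h] is positive, a relation of positive cost has a positive
   entry. *)
have [d [sd cd d0c [i1 di1]]] : exists d, [/\ supp d \subset supp c, comb d = 0,
    0 <= cost h d & exists i, 0 < d i].
  have [i di] : exists i, d0 i != 0.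
    apply: contrapT => H; apply: dn0; apply/ffunP => i; rewrite ffunE.
    by apply/eqP/negPn/negP => di; apply: H; exists i.
  have sN : supp (- d0) \subset supp c.
    by apply/subsetP => j; rewrite inE ffunE oppr_eq0 => dj; apply: (subsetP sd0); rewrite inE.
  have cN : comb (- d0) = 0 by rewrite linearN /= cd0 oppr0.
  have costN : cost h (- d0) = - cost h d0.
    by rewrite /cost -sumrN; apply: eq_bigr => j _; rewrite ffunE mulNr.
  have neg d : (forall i, d i <= 0) -> cost h d <= 0.
    move=> dn; apply: sumr_le0 => j _; rewrite mulr_le0_ge0 //; exact: ltW.
  have npos d : ~ (exists i, 0 < d i) -> forall i, d i <= 0.
    by move=> H j; rewrite leNgt; apply/negP => dj; apply: H; exists j.
  have [c1|c1] := lerP 0 (cost h d0).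
    case: (pselect (exists i, 0 < d0 i)) => [p|/npos p]; first by exists d0.
    exists (- d0); split=> //.
      by rewrite costN oppr_ge0; apply: neg.
    by exists i; rewrite ffunE oppr_gt0 lt_neqAle di p.
  exists (- d0); split=> //; first by rewrite costN oppr_ge0 ltW.
  apply: contrapT => /npos/neg; rewrite costN; lra.
(* The ratio test of the simplex method: the largest step that keeps all coefficients nonnegative
   annihilates the one at [i0]. *)
pose i0 := [arg min_(i < i1 | 0 < d i) (c i / d i)]%O.
have [i0p i0m] : 0 < d i0 /\ forall j, 0 < d j -> c i0 / d i0 <= c j / d j.
  by rewrite /i0; case: Order.TotalTheory.arg_minP.
pose t := c i0 / d i0; have t0 : 0 <= t by rewrite divr_ge0 // ltW.
pose c' := (- t) *: d + c.
have c'E i : c' i = c i - t * d i by rewrite /c' !ffunE [LHS]addrC -[in RHS]mulNr.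
have c'0 i : 0 <= c' i.
  rewrite c'E subr_ge0; have [di|di] := ltP 0 (d i).
    by rewrite -ler_pdivlMr //; apply: i0m.
  by apply: le_trans (c0 i); rewrite mulr_ge0_le0.
have sc' : supp c' \proper supp c.
  apply/properP; split; first by rewrite supp_lin.
  exists i0; first by apply: (subsetP sd); rewrite inE gt_eqF.
  by rewrite inE negbK c'E /t divfK ?subrr ?(gt_eqF i0p).
have [||c2 [c20 ic2 cc2 cost2]] := IH c'.
- exact: leq_trans (proper_card sc') cn.
- exact: c'0.
exists c2; split=> //; first by rewrite cc2 linearP /= cd scaler0 add0r.
by apply: le_trans cost2 _; rewrite costD gerDr mulNr oppr_le0 mulr_ge0.
Qed.

Definition generic x := spanned x /\
  forall J, affbasis J -> forall j, j \in J -> coo J x j != 0.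

Section Heights.
Variable h : {ffun I -> R^o}.
Hypothesis h0 : forall i, 0 < h i.
Hypothesis hgen : forall J, affbasis J -> forall i, i \notin J ->
  cost h (coo J (w i)) != h i.

(** The lifts of the generators outside [J] lie strictly above the hyperplane through the lifts of
    [J]; in the language of linear programming, all reduced costs are positive. *)
Definition cell J := affbasis J /\
  forall i, i \notin J -> cost h (coo J (w i)) < h i.

Lemma generic_supp x c J : generic x -> affbasis J -> supp c \subset J ->
  comb c = x -> supp c = J.
Proof.
move=> [_ gx] bJ sc cx; apply/eqP; rewrite eqEsubset sc; apply/subsetP => j jJ.
by rewrite inE -(coo_comb bJ sc) cx gx.
Qed.

(** A representation of least cost among the nonnegative ones with independent support yields the
    cell: a generator lifted below the hyperplane would allow a pivot that lowers the cost. *)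
Lemma cell_cover x : generic x -> cone x ->
  exists2 J, cell J & exists c, [/\ supp c = J, forall i, 0 <= c i & comb c = x].
Proof.
move=> gx [c0 c00 c0x].
pose isrep J c := [/\ supp c = J, indep J, forall i, 0 <= c i & comb c = x].
pose P J := `[< exists c, isrep J c >].
have [c1 [c10 ic1 cc1 _]] := reduce_support h0 c00.
have P1 : P (supp c1) by apply/asboolP; exists c1; split=> //; rewrite cc1.
pose r J := xget 0 [set c | isrep J c]%classic.
have rP J : P J -> isrep J (r J).
  by move=> /asboolP[c cJ]; rewrite /r; case: xgetP => [? -> //|/(_ c)].
case: (@Order.TotalTheory.arg_minP _ _ _ (supp c1) P (fun J => cost h (r J)) P1) => J PJ Jmin.
have [sJ iJ rJ0 rJx] := rP _ PJ.
have [J' bJ' JJ'] := basis_exists iJ.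
(* No coordinate of a generic point in a basis vanishes, so the independent support is already a
   basis. *)
have JE : J = J' by rewrite -sJ; apply: (generic_supp gx bJ'); rewrite ?sJ.
rewrite -{J' JJ'}JE in bJ'.
exists J; last by exists (r J).
split=> // i iJ'; rewrite lt_neqAle hgen //= leNgt; apply/negP => lt.
have [sa ca] := cooP bJ' (spanned_w i); set a := coo J (w i) in lt sa ca.
pose e := [ffun j => (j == i)%:R] - a : {ffun I -> R^o}.
have ce : comb e = 0.
  rewrite linearB /= ca /comb (bigD1 i) //= ffunE eqxx scale1r big1 ?addr0 ?subrr // => j /negbTE ji.
  by rewrite ffunE ji scale0r.
have coste : cost h e = h i - cost h a.
  rewrite /cost -sumrN (bigD1 i) //= [X in _ = _ + X](bigD1 i) //= addrA; congr (_ + _).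
    by rewrite /e !ffunE eqxx [LHS]mulrBl mul1r.
  by apply: eq_bigr => j /negbTE ji; rewrite /e !ffunE ji [LHS]mulrBl mul0r add0r.
have Jne : forall j, j \in J -> 0 < r J j.
  by move=> j; rewrite -{1}sJ inE lt_neqAle rJ0 andbT eq_sym.
(* Small enough for the coefficients on [J] to stay nonnegative when moving along the relation
   [e]. *)
pose t := (1 + \sum_(j in J) `|a j| / r J j)^-1.
have s0 : 0 <= \sum_(j in J) `|a j| / r J j.
  by apply: sumr_ge0 => j jJ; rewrite divr_ge0 // ltW // Jne.
have t0 : 0 < t by rewrite invr_gt0 ltr_pwDl.
pose c2 := t *: e + r J.
have c20 j : 0 <= c2 j.
  rewrite !ffunE; have [->|ji] := eqVneq j i.
    have /supp_subP -> := sa => //; rewrite oppr0 addr0.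
    by rewrite addr_ge0 // mulr_ge0 // ltW.
  rewrite add0r; have [jJ|jJ] := boolP (j \in J); last first.
    by have /supp_subP -> := sa => //; rewrite oppr0 scaler0 add0r.
  rewrite scalerN addrC subr_ge0; apply: (@le_trans _ _ (t * `|a j|)).
    exact: (ler_wpM2l (ltW t0) (ler_norm (a j : R))).
  rewrite /t mulrC ler_pdivrMr ?ltr_pwDl // mulrDr mulr1.
  apply: ler_wpDl => //; rewrite (bigD1 j) //= mulrDr mulrCA divff ?gt_eqF ?Jne // mulr1.
  rewrite lerDl mulr_ge0 // sumr_ge0 // => l /andP[lJ _].
  by rewrite divr_ge0 // ltW // Jne.
have [c3 [c30 ic3 cc3 cost3]] := reduce_support h0 c20.
have c3x : comb c3 = x by rewrite cc3 linearP /= ce scaler0 add0r.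
have P3 : P (supp c3) by apply/asboolP; exists c3.
have [s3 _ _ r3x] := rP _ P3.
have E3 : r (supp c3) = c3 by apply: (indep_inj ic3); rewrite ?s3 // r3x.
have := Jmin _ P3; rewrite E3 => le3; have := le_trans le3 cost3.
rewrite costD coste; apply/negP; rewrite -ltNge gtrDr pmulr_rlt0 //.
by rewrite subr_lt0.
Qed.

(** Weak duality: the linear function lifting the cell [J] is at most [h] at every generator, with
    equality on [J] only. *)
Lemma cell_cost J J' c c' : cell J -> affbasis J' -> supp c \subset J -> supp c' \subset J' ->
  (forall i, 0 <= c' i) -> comb c = comb c' ->
  cost h c <= cost h c' /\ (cost h c = cost h c' -> supp c' \subset J).
Proof.
move=> [bJ lJ] bJ' sc sc' c'0 cc.
have cE : c = \sum_i c' i *: coo J (w i) by rewrite -coo_sum // -cc coo_comb.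
have costE : cost h c = \sum_i c' i * cost h (coo J (w i)).
  rewrite {1}cE; under [RHS]eq_bigr do rewrite mulr_sumr.
  rewrite exchange_big; apply: eq_bigr => j _; rewrite sum_ffunE mulr_suml.
  by apply: eq_bigr => i _; rewrite ffunE mulrA.
have lei i : cost h (coo J (w i)) <= h i.
  have [iJ|iJ] := boolP (i \in J); last by rewrite ltW // lJ.
  rewrite coo_w // /cost (bigD1 i) //= ffunE eqxx mul1r big1 ?addr0 // => j /negbTE ji.
  by rewrite ffunE ji mul0r.
split.
  by rewrite costE; apply: ler_sum => i _; rewrite ler_wpM2l.
rewrite costE => /eqP; rewrite eq_sym -subr_eq0 -sumrB psumr_eq0; last first.
  by move=> i _; rewrite -mulrBr mulr_ge0 // subr_ge0.
move=> /allP H; apply/subsetP => i; rewrite inE => ci.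
have := H i; rewrite mem_index_enum => /(_ isT) /=.
rewrite -mulrBr mulf_eq0 (negbTE ci) /= subr_eq0 => /eqP hi.
by apply: contraTT isT => /lJ; rewrite -hi ltxx.
Qed.

Lemma cell_unique x J J' c c' : generic x -> cell J -> cell J' ->
  supp c \subset J -> supp c' \subset J' -> (forall i, 0 <= c i) -> (forall i, 0 <= c' i) ->
  comb c = x -> comb c' = x -> J = J'.
Proof.
move=> gx cJ cJ' sc sc' c0 c'0 cx c'x.
have cc : comb c = comb c' by rewrite cx.
have [le1 s1] := cell_cost cJ cJ'.1 sc sc' c'0 cc.
have [le2 s2] := cell_cost cJ' cJ.1 sc' sc c0 (esym cc).
have eqc : cost h c = cost h c' by apply/eqP; rewrite eq_le le1.
apply/eqP; rewrite eqEsubset.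
have := s1 eqc; rewrite (generic_supp gx cJ'.1 sc' c'x) => ->.
by have := s2 (esym eqc); rewrite (generic_supp gx cJ.1 sc cx) => ->.
Qed.

End Heights.

(** With heights [s ^+ k i] and distinct exponents, each condition says that [s] is not a root of
    some nonzero polynomial, and there are finitely many. As [h] is positive, [comb h] is an
    interior direction, so the heights serve a second time as the coefficients of the
    displacement. *)
Lemma generic_heights : exists h, [/\ forall i, 0 < h i,
  forall J, affbasis J -> forall i, i \notin J -> cost h (coo J (w i)) != h i
  & generic (comb h)].
Proof.
pose k (i : I) := (enum_rank i).+1.
have kinj i j : (k i == k j) = (i == j).
  by rewrite /k eqSS; apply/eqP/eqP => [/val_inj/enum_rank_inj|->].
pose p (Ji : {set I} * I) : {poly R} :=
  if `[< affbasis Ji.1 >] then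
    if Ji.2 \in Ji.1 then \sum_l coo Ji.1 (w l) Ji.2 *: 'X^(k l)
    else 'X^(k Ji.2) - \sum_l coo Ji.1 (w Ji.2) l *: 'X^(k l)
  else 1.
have p0 Ji : p Ji != 0.
  case: Ji => J i; rewrite /p /=; case: asboolP => [bJ|_]; last exact: oner_neq0.
  (* The coefficient of ['X^(k i)] is 1 in both cases. *)
  case: ifP => iJ; apply/eqP => /(congr1 (fun q : {poly R} => q`_(k i))).
    rewrite coef0 coef_sum (bigD1 i) //= coefZ coefXn eqxx coo_w // ffunE eqxx mulr1.
    rewrite big1 ?addr0 => [/eqP|l li]; first by rewrite oner_eq0.
    by rewrite coefZ coefXn kinj eq_sym (negbTE li) mulr0.
  rewrite coef0 coefB coefXn eqxx coef_sum big1 ?subr0 => [/eqP|l _]; first by rewrite oner_eq0.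
  rewrite coefZ coefXn kinj; case: eqVneq; rewrite ?mulr0 // => <-.
  by have /supp_subP -> := (cooP bJ (spanned_w i)).1; rewrite ?mul0r ?iJ.
have [s s0 sP] := exists_nonroot p0.
pose h : {ffun I -> R^o} := [ffun i => s ^+ k i].
have hE l : h l = s ^+ k l by rewrite ffunE.
exists h; split=> [i|J bJ i iJ|].
- by rewrite ffunE exprn_gt0.
- have := sP (J, i); rewrite /p /= (introT (asboolP _) bJ) (negbTE iJ).
  rewrite hornerD hornerN hornerXn horner_sum subr_eq0 eq_sym hE.
  rewrite (eq_bigr (fun l => (coo J (w i) l : R) * (h l : R))) // => l _.
  by rewrite hornerZ hornerXn hE.
- split; first by exists h.
  move=> J bJ i iJ; have := sP (J, i); rewrite /p /= (introT (asboolP _) bJ) iJ.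
  rewrite horner_sum coo_sum // sum_ffunE.
  rewrite (eq_bigr (fun l => (h l *: coo J (w l)) i : R)) // => l _.
  by rewrite hornerZ hornerXn ffunE hE mulrC.
Qed.

(* Each point [x +- e xi], with [xi] generic and [e] infinitesimal, lies in one
   cell of the regular triangulation; moving inwards decides membership of [x]
   in the closed cone, moving outwards membership in its relative interior. *)
Theorem half_open_decomposition :
  exists (T : {set {set I}}) (A : {set I} -> {set I}),
  [/\ forall J, J \in T -> affbasis J /\ A J \subset J,
      forall x, (\sum_(J in T) `[< half_open J (A J) x >] = `[< cone x >] :> nat)%N
    & forall x, (\sum_(J in T) `[< half_open J (J :\: A J) x >] = `[< rcone x >] :> nat)%N].
Proof.
have [h [h0 hgen gxi]] := generic_heights; set xi := comb h in gxi.
pose T := [set J | `[< cell h J >]].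
(* A coordinate vanishing at [x] takes the sign of that of [xi] after an inward move, so the facets
   to remove are those where the coordinate of [xi] is negative. *)
pose A J := [set j in J | coo J xi j < 0].
have TP J : J \in T -> cell h J by rewrite inE => /asboolP.
have sign (a b : R) e : 0 < e -> (a != 0 -> e * `|b| < `|a|) -> b != 0 ->
    (0 < a + e * b) = (if b < 0 then 0 < a else 0 <= a) /\ a + e * b != 0.
  move=> e0 ab b0; have [a0|an0] := eqVneq a 0.
    rewrite a0 add0r pmulr_rgt0 // ltxx lexx mulf_eq0 (gt_eqF e0) b0.
    by case: ltgtP b0.
  have := ab an0; rewrite -{1}(gtr0_norm e0) -normrM => lt.
  have := lt; rewrite ltr_norml => /andP[l1 l2].
  have [ap|an|a0] := ltgtP 0 a; last by rewrite -a0 eqxx in an0.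
  - rewrite gtr0_norm // in l1 l2; split; last by rewrite gt_eqF //; lra.
    by rewrite if_same; apply/idP; lra.
  - rewrite ltr0_norm // in l1 l2; split; last by rewrite lt_eqF //; lra.
    by rewrite if_same; apply/negbTE; rewrite -leNgt; lra.
have small (K : finType) (a b : K -> R) : exists2 e, 0 < e &
    forall e', 0 < e' -> e' <= e -> forall k, a k != 0 -> e' * `|b k| < `|a k|.
  exists (1 + \sum_k `|b k| / `|a k|)^-1.
    by rewrite invr_gt0 ltr_pwDl // sumr_ge0 // => k _; rewrite divr_ge0.
  move=> e' e'0 e'e k ak; have ak0 : 0 < `|a k| by rewrite normr_gt0.
  apply: le_lt_trans (_ : (1 + \sum_k `|b k| / `|a k|)^-1 * `|b k| < _).
    by rewrite ler_wpM2r.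
  rewrite mulrC ltr_pdivrMr; last first.
    by rewrite ltr_pwDl // sumr_ge0 // => l _; rewrite divr_ge0.
  rewrite (bigD1 k) //= mulrDr mulr1 mulrDr [X in _ + (X + _)]mulrCA divff ?gt_eqF // mulr1.
  rewrite addrCA ltrDl ltr_pwDl // mulr_ge0 // sumr_ge0 // => l _.
  by rewrite divr_ge0.
(* The boolean [s] selects the direction of the displacement: inwards for [false], outwards for
   [true]. *)
have coosgn x e : spanned x -> 0 < e ->
    (forall J j, coo J x j != 0 -> e * `|coo J xi j| < `|coo J x j|) ->
    forall (s : bool) J, affbasis J -> forall j, j \in J ->
    (0 < coo J (((-1) ^+ s * e) *: xi + x) j) =
      (if (-1) ^+ s * coo J xi j < 0 then 0 < coo J x j else 0 <= coo J x j)
    /\ coo J (((-1) ^+ s * e) *: xi + x) j != 0.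
  move=> sx e0 ne s J bJ j jJ; rewrite coo_lin //; last by exists h.
  rewrite !ffunE [X in 0 < X]addrC [X in X != _]addrC.
  have := @sign (coo J x j) ((-1) ^+ s * coo J xi j) e e0.
  rewrite normrM normrX normrN normr1 expr1n mul1r mulrCA mulrA => H.
  by apply: H; [exact: ne | rewrite mulf_neq0 ?signr_eq0 ?gxi.2].
have half x (s : bool) e J : spanned x -> 0 < e ->
    (forall J j, coo J x j != 0 -> e * `|coo J xi j| < `|coo J x j|) -> affbasis J ->
    half_open J (if s then J :\: A J else A J) x <->
    forall j, 0 <= coo J (((-1) ^+ s * e) *: xi + x) j.
  move=> sx e0 ne bJ; have [sc cx] := cooP bJ sx.
  have sxe : spanned (((-1) ^+ s * e) *: xi + x) by apply: spanned_lin => //; exists h.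
  have cs := coosgn x e sx e0 ne s J bJ.
  have jA j : j \in J -> (j \in (if s then J :\: A J else A J)) = ((-1) ^+ s * coo J xi j < 0).
    move=> jJ; case: (s); rewrite ?expr1 ?expr0 ?mulN1r ?mul1r !inE jJ //= andbT.
    by rewrite oppr_lt0 -leNgt le_eqVlt eq_sym (negbTE (gxi.2 _ bJ _ jJ)).
  split=> [[c [sc' cx'] cP] j|H].
    have cE : c = coo J x by apply: (indep_inj bJ.1) => //; rewrite cx.
    have [jJ|jJ] := boolP (j \in J); last first.
      by have /supp_subP -> := (cooP bJ sxe).1.
    by rewrite ltW // (cs _ jJ).1 -jA // -cE; apply: cP.
  exists (coo J x) => // j jJ; rewrite jA //.
  by have [<- ne0] := cs _ jJ; rewrite lt_neqAle eq_sym ne0 H.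
have pickE x : exists2 e, 0 < e & forall e', 0 < e' -> e' <= e ->
    forall J j, coo J x j != 0 -> e' * `|coo J xi j| < `|coo J x j|.
  have [e e0 eP] := small ({set I} * I)%type
    (fun Jj => coo Jj.1 x Jj.2) (fun Jj => coo Jj.1 xi Jj.2).
  by exists e => // e' e'0 e'e J j; apply: (eP e' e'0 e'e (J, j)).
have gen x (s : bool) e : spanned x -> 0 < e ->
    (forall J j, coo J x j != 0 -> e * `|coo J xi j| < `|coo J x j|) ->
    generic (((-1) ^+ s * e) *: xi + x).
  move=> sx e0 ne; split; first by apply: spanned_lin => //; exists h.
  by move=> J bJ j jJ; have [] := coosgn x e sx e0 ne s J bJ j jJ.
have count x (s : bool) e : spanned x -> 0 < e ->
    (forall J j, coo J x j != 0 -> e * `|coo J xi j| < `|coo J x j|) ->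
    (\sum_(J in T) `[< half_open J (if s then J :\: A J else A J) x >]
       = `[< cone (((-1) ^+ s * e) *: xi + x) >] :> nat)%N.
  move=> sx e0 ne; set x' := _ *: _ + x.
  have gx : generic x' by apply: gen.
  have only J J' : J \in T -> J' \in T -> half_open J (if s then J :\: A J else A J) x ->
      half_open J' (if s then J' :\: A J' else A J') x -> J = J'.
    move=> /TP cJ /TP cJ' /(half _ _ _ _ sx e0 ne cJ.1) p1 /(half _ _ _ _ sx e0 ne cJ'.1) p2.
    have [s1 x1] := cooP cJ.1 gx.1; have [s2 x2] := cooP cJ'.1 gx.1.
    exact: (cell_unique gx cJ cJ' s1 s2).
  case: asboolP => [cx|ncx].
    have [J cJ [c [sc c0 cx']]] := cell_cover h0 hgen gx cx.
    have JT : J \in T by rewrite inE; apply/asboolP.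
    have hJ : half_open J (if s then J :\: A J else A J) x.
      apply/(half _ _ _ _ sx e0 ne cJ.1) => j; rewrite -/x' -cx' coo_comb ?sc //; exact: cJ.1.
    rewrite (bigD1 J) //= (introT (asboolP _) hJ) big1 // => J' /andP[J'T J'J].
    by case: asboolP => // h'; rewrite (only _ _ J'T JT h' hJ) eqxx in J'J.
  rewrite big1 // => J /TP cJ; case: asboolP => // hJ; case: ncx.
  have [s1 x1] := cooP cJ.1 gx.1.
  by exists (coo J x') => //; apply/(half _ _ _ _ sx e0 ne cJ.1).
have nspan x : ~ spanned x -> forall J, J \in T -> forall B, `[< half_open J B x >] = false.
  by move=> nx J _ B; apply/asboolPn => -[c [_ cx] _]; apply: nx; exists c.
exists T, A; split.
- move=> J /TP cJ; split; first exact: cJ.1.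
  by apply/subsetP => j; rewrite inE => /andP[].
- move=> x; case: (pselect (spanned x)) => [sx|nx]; last first.
    rewrite big1 => [|J JT]; last by rewrite nspan.
    by case: asboolP => // -[c _ cx]; case: nx; exists c.
  have [e e0 /(_ e e0 (lexx e)) eP] := pickE x.
  rewrite (count x false e) // expr0 mul1r; congr (nat_of_bool _).
  apply/asboolP/asboolP => [cx|[c c0 cx]]; last first.
    exists (e *: h + c); last by rewrite linearP /= cx.
    by move=> i; rewrite !ffunE addr_ge0 // mulr_ge0 // ltW.
  have gx := gen x false e sx e0 eP; rewrite expr0 mul1r in gx.
  have [J cJ [c [sc c0 cx']]] := cell_cover h0 hgen gx cx.
  (* The half-open cell that receives the displaced point contains [x] itself. *)
  have : half_open J (A J) x.
    apply/(half x false e J sx e0 eP cJ.1) => j.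
    by rewrite expr0 mul1r -cx' coo_comb ?sc //; exact: cJ.1.
  case=> d [sd dx] dP; exists d => // i.
  have [iJ|iJ] := boolP (i \in J); last by have /supp_subP -> := sd.
  by have := dP i iJ; case: ifP => // _ /ltW.
- move=> x; case: (pselect (spanned x)) => [sx|nx]; last first.
    rewrite big1 => [|J JT]; last by rewrite nspan.
    by case: asboolP => // -[c _ cx]; case: nx; exists c.
  have [e e0 eP] := pickE x.
  have eP0 := eP e e0 (lexx e).
  case: asboolP => [[c c0 cx]|ncx].
    (* Here [x] has positive coefficients, and an outward displacement that is also small compared
       with them stays in the cone. *)
    have [e1 e10 /(_ _ _ _ _) e1P] := small I (fun i => c i) (fun i => h i).
    pose e2 := Num.min e e1; have e20 : 0 < e2 by rewrite lt_min e0.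
    have e2e : e2 <= e by rewrite ge_min lexx.
    have e2e1 : e2 <= e1 by rewrite ge_min lexx orbT.
    rewrite (count x true e2) ?expr1 ?mulN1r //; last exact: eP.
    rewrite (introT (asboolP _)) //; exists (- e2 *: h + c); last by rewrite linearP /= cx.
    move=> i; have := e1P e2 e20 e2e1 i; rewrite gt_eqF // !gtr0_norm // => /(_ isT) /ltW le.
    by rewrite !ffunE addrC [_ *: _]mulNr subr_ge0.
  rewrite (count x true e) ?expr1 ?mulN1r //; case: asboolP => // -[c c0 cx]; case: ncx.
  exists (e *: h + c); last by rewrite linearP /= cx scaleNr addNKr.
  by move=> i; rewrite !ffunE ltr_pwDl // mulr_gt0.
Qed.

End Configuration.

Lemma linear_lfun (K : fieldType) (U V : vectType K) (f : U -> V) :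
  linear f -> exists g : 'Hom(U, V), forall x, g x = f x.
Proof.
move=> lin; pose L := GRing.isLinear.Build _ _ _ _ f lin.
pose f' : {linear U -> V} := HB.pack f L.
by exists (linfun f') => x; rewrite lfunE.
Qed.

(** * Farkas' lemma and faces of cones *)

Section Farkas.
Variables (R : realFieldType) (V : vectType R).

Fixpoint conic (ws : seq V) (v : V) : Prop :=
  if ws is w :: ws' then exists2 a : R, 0 <= a & conic ws' (v - a *: w) else v = 0.

Lemma conic_shear (a : V -> R) (w : V) ws v : (forall u, u \in ws -> 0 <= a u) ->
  conic [seq u + a u *: w | u <- ws] v -> exists2 b : R, 0 <= b & conic ws (v - b *: w).
Proof.
elim: ws v => [|u ws IH] v a0 /=.
  by move=> ->; exists 0; rewrite ?scale0r ?subr0.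
case=> t t0 /IH[x xws|b b0 H]; first by rewrite a0 // inE xws orbT.
exists (b + t * a u); first by rewrite addr_ge0 // mulr_ge0 // a0 // mem_head.
exists t => //; congr (conic _ _): H.
by rewrite scalerDr scalerDl scalerA !opprD !addrA [LHS](ACl (1*4*3*2)).
Qed.

Lemma functional_neg (v : V) : v != 0 -> exists l : 'Hom(V, R^o), l v < 0.
Proof.
move=> v0; pose b := vbasis {:V}.
have [i bi] : exists i, coord b i v != 0.
  apply: contrapT => H; case/eqP: v0.
  rewrite (coord_vbasis (memvf v)) big1 // => i _.
  suff -> : coord b i v = 0 by rewrite scale0r.
  by apply/eqP/negPn/negP => ne; apply: H; exists i.
pose l0 : 'Hom(V, R^o) := linfun (coord b i : V -> R^o).
have l0E : l0 v = coord b i v by rewrite lfunE.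
have [lt|gt|eq] := ltgtP (coord b i v) 0.
- by exists l0; rewrite l0E.
- by exists (- l0); rewrite opp_lfunE l0E oppr_lt0.
- by rewrite eq eqxx in bi.
Qed.

(* Induction on the generators: a functional negative on the last generator is
   corrected by a multiple so as to vanish there. *)
Lemma farkas (ws : seq V) v : ~ conic ws v ->
  exists l : 'Hom(V, R^o), (forall w, w \in ws -> 0 <= l w) /\ l v < 0.
Proof.
have [n] := ubnP (size ws); elim: n ws v => // n IH [|w ws] v /= sz ncv.
  by have /eqP/functional_neg[l lv] := ncv; exists l.
rewrite ltnS in sz.
have [l [lws lv]] : exists l : 'Hom(V, R^o), (forall w, w \in ws -> 0 <= l w) /\ l v < 0.
  by apply: IH => // cv; apply: ncv; exists 0; rewrite ?scale0r ?subr0.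
have [lw|lw] := lerP 0 (l w).
  by exists l; split=> // u; rewrite inE => /predU1P[->|/lws].
(* With this choice [u + a u *: w] is the projection of [u] along [w] to the kernel of [l]. *)
pose a u := - (l u / l w).
have a0 u : u \in ws -> 0 <= a u.
  by move=> /lws lu; rewrite oppr_ge0 mulr_ge0_le0 // invr_le0 ltW.
have [||m [mws mv]] := IH [seq u + a u *: w | u <- ws] (v + a v *: w).
- by rewrite size_map.
- move=> /(conic_shear a0)[b b0]; rewrite -addrA -scaleNr -scalerDl.
  move=> H; apply: ncv; exists (b + l v / l w).
    by rewrite addr_ge0 // mulr_le0 ?ltW // invr_lt0.
  by congr (conic _ (_ + _)): H; rewrite -scaleNr; congr (_ *: _); rewrite /a; ring.
have lE u : (m - (m w / l w) *: l) u = m (u + a u *: w).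
  rewrite [RHS]linearD [in RHS]linearZ /= add_lfunE opp_lfunE scale_lfunE.
  rewrite /a scaleNr; congr (_ - _).
  have aux (x y z : R) : x / y * z = z / y * x by rewrite mulrAC [z / y * x]mulrAC [z * x]mulrC.
  exact: aux.
exists (m - (m w / l w) *: l); split=> [u|]; rewrite lE //.
rewrite inE => /predU1P[->|uws]; last by apply/mws/map_f.
by rewrite /a divff ?lt_eqF // scaleN1r subrr linear0.
Qed.

End Farkas.

Section ConeFaces.
Import mathcomp.boot.fintype mathcomp.boot.finset.
Variables (R : realFieldType) (V : vectType R) (I : finType) (q : I -> V).
Implicit Types (c : {ffun I -> R^o}) (F G J : {set I}).

Lemma lfun_comb (l : 'Hom(V, R^o)) c : l (comb q c) = \sum_i (c i : R) * (l (q i) : R).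
Proof. by rewrite linear_sum; apply: eq_bigr => i _; rewrite linearZ. Qed.

Lemma conic_comb s v : conic [seq q i | i <- s] v ->
  exists2 c : {ffun I -> R^o}, forall i, 0 <= c i & comb q c = v.
Proof.
elim: s v => [|j s IH] v /=.
  by move=> ->; exists 0; rewrite ?linear0 // => i; rewrite ffunE.
case=> a a0 /IH[c c0 cv].
pose d : {ffun I -> R^o} := [ffun i => (i == j)%:R].
exists (a *: d + c) => [i|].
  by rewrite !ffunE addr_ge0 // mulr_ge0 // ler0n.
rewrite linearP /= cv addrC -[RHS](subrK (a *: q j)); congr (_ + _ *: _).
rewrite /comb (bigD1 j) //= ffunE eqxx scale1r big1 ?addr0 // => i /negbTE ij.
by rewrite ffunE ij scale0r.
Qed.

(* A face of the cone generated by [q] is encoded by the set of indices of the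
   generators that it contains. *)
Definition cface F := exists l : 'Hom(V, R^o),
  (forall i, 0 <= l (q i)) /\ forall i, (i \in F) = (l (q i) == 0).

Lemma cface_supp F c c' : cface F -> (forall i, 0 <= c i) -> supp c' \subset F ->
  comb q c = comb q c' -> supp c \subset F.
Proof.
move=> [l [l0 lF]] c0 /supp_subP sc' cc'.
have : l (comb q c) = 0.
  rewrite cc' lfun_comb big1 // => i _; have [|/sc' ->] := boolP (i \in F).
    by rewrite lF => /eqP ->; rewrite mulr0.
  by rewrite mul0r.
rewrite lfun_comb => /eqP; rewrite psumr_eq0 => [/allP H|i _]; last exact: mulr_ge0.
apply/subsetP => i; rewrite inE => ci; rewrite lF.
by have := H i; rewrite mem_index_enum mulf_eq0 (negbTE ci) => /(_ isT).
Qed.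

Definition qspan F := <<[seq q i | i <- enum F]>>%VS.
Definition rk F := \dim (qspan F).

Lemma mem_qspan F i : i \in F -> q i \in qspan F.
Proof. by move=> iF; rewrite memv_span // map_f // mem_enum. Qed.

Lemma qspan_sub F (U : {vspace V}) : (forall i, i \in F -> q i \in U) -> (qspan F <= U)%VS.
Proof. by move=> H; apply/span_subvP => u /mapP[i ]; rewrite mem_enum => iF ->; apply: H. Qed.

Lemma qspanS F G : F \subset G -> (qspan F <= qspan G)%VS.
Proof. by move=> /subsetP FG; apply: qspan_sub => i iF; apply/mem_qspan/FG. Qed.

Lemma rk_lt F G : cface F -> F \proper G -> (rk F < rk G)%N.
Proof.
move=> [l [l0 lF]] /properP[FG [i iG]]; rewrite lF => li.
rewrite /rk ltn_neqAle dimvS ?qspanS // andbT; apply: contra li => /eqP dFG.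
have /eqP E : qspan F == qspan G by rewrite eqEdim qspanS // dFG /=.
have : q i \in lker l.
  apply: subvP (mem_qspan iG); rewrite -E; apply: qspan_sub => j.
  by rewrite lF memv_ker.
by rewrite memv_ker.
Qed.

Lemma card_basis J : affbasis q J -> #|J| = \dim <<codom q>>.
Proof.
move=> [iJ sJ]; pose X := [tuple q (enum_val i) | i < #|J|].
have spX : <<codom q>>%VS = <<X>>%VS.
  apply/eqP; rewrite eqEsubv; apply/andP; split; apply/span_subvP => u.
    case/codomP => i ->; have [c sc <-] := sJ i.
    have /supp_subP s0 := sc; apply: memv_suml => j _.
    have [jJ|/s0 ->] := boolP (j \in J); last by rewrite scale0r mem0v.
    rewrite memvZ // memv_span //; apply/tnthP; exists (enum_rank_in jJ j).
    by rewrite tnth_mktuple enum_rankK_in.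
  by case/tnthP => i ->; rewrite tnth_mktuple memv_span // codom_f.
have frX : free X.
  apply/freeP => k k0 i0.
  pose c : {ffun I -> R^o} := [ffun j => if boolP (j \in J) is AltTrue jJ then k (enum_rank_in jJ j) else 0].
  have cE i : c (enum_val i) = k i.
    rewrite ffunE; case: {-}_ / boolP => [jJ|]; last by rewrite enum_valP.
    by rewrite enum_valK_in.
  have sc : supp c \subset J.
    by apply/supp_subP => j jJ; rewrite ffunE; case: {-}_ / boolP => // jJ'; rewrite jJ' in jJ.
  have c0 : comb q c = 0.
    rewrite /comb (bigID (mem J)) /= [X in _ + X]big1 ?addr0 => [|j /(supp_subP _ _ sc) ->]; last first.
      by rewrite scale0r.
    rewrite big_enum_val -[RHS]k0; apply: eq_bigr => i _.
    by rewrite cE -tnth_nth tnth_mktuple.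
  by rewrite -cE (iJ c sc c0) ffunE.
by rewrite spX; move: frX; rewrite /free size_tuple => /eqP ->.
Qed.

(** The differences lie in the kernel of [eta] and [q i0] does not, so the span is the direct sum of
    the line of [q i0] and the space of directions. *)
Lemma rk_diff (eta : 'Hom(V, R^o)) F i0 : (forall i, i \in F -> eta (q i) = 1) -> i0 \in F ->
  rk F = (\dim <<[seq q i - q i0 | i <- enum F]>>).+1.
Proof.
move=> eta1 iF; set D := <<_>>%VS.
have DK : (D <= lker eta)%VS.
  apply/span_subvP => u /mapP[i ]; rewrite mem_enum => iF' ->.
  by rewrite memv_ker linearB /= !eta1 // subrr.
have E : qspan F = (<[q i0]> + D)%VS.
  apply/eqP; rewrite eqEsubv; apply/andP; split.
    apply: qspan_sub => i iF'; rewrite -[q i](subrK (q i0)) addrC memv_add ?memv_line //.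
    by rewrite memv_span //; apply: (map_f (fun i => q i - q i0)); rewrite mem_enum.
  rewrite subv_add; apply/andP; split; first by rewrite -memvE mem_qspan.
  apply/span_subvP => u /mapP[i ]; rewrite mem_enum => iF' ->.
  by rewrite memvB // mem_qspan.
have q0 : q i0 != 0.
  by apply/eqP => q0; have := eta1 i0 iF; rewrite q0 linear0 => /eqP; rewrite eq_sym oner_eq0.
rewrite /rk E dimv_disjoint_sum ?dim_vline ?q0 //.
apply/eqP; rewrite -subv0; apply/subvP => u; rewrite memv_cap => /andP[/vlineP[k ->]].
move=> /(subvP DK); rewrite memv_ker linearZ /= eta1 // memv0 -[k *: 1]/(k * 1) mulr1.
by move=> /eqP ->; rewrite scale0r.
Qed.

Variable eta : 'Hom(V, R^o).
Hypothesis eta1 : forall i, eta (q i) = 1.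

Lemma eta_comb c : eta (comb q c) = \sum_i (c i : R).
Proof. by rewrite lfun_comb; apply: eq_bigr => i _; rewrite eta1 mulr1. Qed.

(** [F] collects the generators that occur in some nonnegative representation of the point.
    Averaging such representations gives one with support exactly [F], and separating each remaining
    generator by Farkas' lemma shows that [F] is a face. *)
Lemma minimal_face c0 : (forall i, 0 <= c0 i) ->
  exists2 F, cface F & exists c : {ffun I -> R^o}, [/\ forall i, 0 <= c i, supp c = F & comb q c = comb q c0].
Proof.
move=> c00; set z := comb q c0.
pose isrep c := (forall i, 0 <= c i) /\ comb q c = z.
pose F := [set j | `[< exists2 c : {ffun I -> R^o}, isrep c & 0 < c j >]].
have [c [c0' cz] cF] : exists2 c : {ffun I -> R^o}, isrep c & forall j, j \in F -> 0 < c j.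
  have /choice[r rP] (j : I) : exists c : {ffun I -> R^o}, isrep c /\ (j \in F -> 0 < c j).
    have [|nj] := boolP (j \in F); last by exists c0.
    by rewrite inE => /asboolP[c rc cj]; exists c.
  pose n := #|F|.+1%:R : R; have n0 : 0 < n by rewrite ltr0n.
  exists (n^-1 *: (\sum_(j in F) r j + c0)).
    split=> [i|].
      rewrite !ffunE; apply: mulr_ge0; first by rewrite invr_ge0 ltW.
      rewrite addr_ge0 // sum_ffunE sumr_ge0 // => j _.
      by have [[]] := rP j.
    rewrite linearZ linearD linear_sum /=.
    under eq_bigr => j _ do rewrite (rP j).1.2.
    rewrite sumr_const -/z -[z *+ _ + z]mulrSr -scaler_nat scalerA mulVf ?scale1r //.
    by rewrite gt_eqF.
  move=> j jF; rewrite !ffunE mulr_gt0 ?invr_gt0 // sum_ffunE (bigD1 j) //=.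
  rewrite -addrA ltr_pwDl //; first by have [_ ->] := rP j.
  by rewrite addr_ge0 // sumr_ge0 // => l _; have [[]] := rP l.
have sc : supp c = F.
  apply/setP => j; rewrite inE; apply/idP/idP => [cj|/cF]; last by move=> /gt_eqF ->.
  by rewrite inE; apply/asboolP; exists c => //; rewrite lt_neqAle eq_sym cj c0'.
exists F; last by exists c.
have sep j : j \notin F -> exists l : 'Hom(V, R^o),
    [/\ forall i, 0 <= l (q i), l z = 0 & 0 < l (q j)].
  (* Otherwise some [a *: z] would be [q j] plus a nonnegative combination of generators; comparing
     heights gives [a > 0], and [j] would occur in a representation of [z]. *)
  move=> jF; have : ~ conic (- z :: [seq q i | i <- enum I]) (- q j).
    case=> a a0 /conic_comb[d d0 dE]; apply: (negP jF).
    have az : a *: z = q j + comb q d by rewrite dE scalerN opprK addNKr.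
    have := congr1 eta az; rewrite linearD linearZ /= eta1 eta_comb => E1.
    have ap : 0 < a.
      rewrite lt_neqAle a0 andbT; apply/eqP => a00; move: E1; rewrite -a00 scale0r.
      apply/eqP; rewrite lt_eqF // ltr_pwDl // sumr_ge0 // => i _; exact: d0.
    rewrite inE; apply/asboolP.
    pose e : {ffun I -> R^o} := [ffun i => (i == j)%:R].
    have ej : comb q e = q j.
      rewrite /comb (bigD1 j) //= ffunE eqxx scale1r big1 ?addr0 // => i /negbTE ij.
      by rewrite ffunE ij scale0r.
    exists (a^-1 *: (e + d)); last first.
      by rewrite !ffunE eqxx mulr_gt0 ?invr_gt0 // ltr_pwDl.
    split=> [i|]; first by rewrite !ffunE mulr_ge0 ?invr_ge0 // addr_ge0 // ler0n.
    by rewrite linearZ linearD /= ej -az scalerA mulVf ?scale1r // gt_eqF.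
  case/farkas => l [lp ln]; exists l.
  have lq i : 0 <= l (q i) by apply: lp; rewrite inE map_f ?orbT // mem_enum.
  split=> //; last by move: ln; rewrite linearN /= oppr_lt0.
  apply/eqP; rewrite eq_le; apply/andP; split.
    by have := lp (- z) (mem_head _ _); rewrite linearN /= oppr_ge0.
  by rewrite /z lfun_comb sumr_ge0 // => i _; apply: mulr_ge0 (lq i) => //; exact: c00.
have /choice[l lP] (j : I) : exists l : 'Hom(V, R^o), [/\ forall i, 0 <= l (q i), l z = 0 & (j \notin F -> 0 < l (q j))].
  have [jF|/sep[l [l1 l2 l3]]] := boolP (j \in F); last by exists l.
  by exists 0; split=> // *; rewrite zero_lfunE.
exists (\sum_j l j).
have lq i : 0 <= (\sum_j l j) (q i).
  by rewrite sum_lfunE; apply: sumr_ge0 => j _; have [] := lP j.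
split=> // i; have [iF|iF] := boolP (i \in F); last first.
  rewrite sum_lfunE (bigD1 i) //= gt_eqF // ltr_pwDl //; first by have [_ _ ->] := lP i.
  by apply: sumr_ge0 => j _; have [] := lP j.
have : (\sum_j l j) z = 0 by rewrite sum_lfunE big1 // => j _; have [] := lP j.
rewrite -cz lfun_comb => /eqP; rewrite psumr_eq0 => [/allP H|k _]; last exact: mulr_ge0.
have := H i; rewrite mem_index_enum mulf_eq0 (gt_eqF (cF _ iF)) /= => /(_ isT) ->.
by [].
Qed.

End ConeFaces.

(** * Ehrhart reciprocity with polynomial weights *)

Section LatticeSums.
Import mathcomp.boot.fintype mathcomp.boot.finset.
Variables (R : realType) (n : nat).
Notation M := 'rV[int]_n.
Notation C := R[i].

(** Polynomial functions on the lattice, presented so that each closure property, in particular the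
    passage to coordinates in a simplicial cone, is an induction. *)
Inductive polyfun : (M -> C) -> Prop :=
| polyfun_const c : polyfun (fun=> c)
| polyfun_add f g : polyfun f -> polyfun g -> polyfun (fun m => f m + g m)
| polyfun_coord k f : polyfun f -> polyfun (fun m : M => (m 0 k)%:~R * f m).

Lemma polyfun_mul f g : polyfun f -> polyfun g -> polyfun (fun m => f m * g m).
Proof.
move=> pf pg; elim: pf => [c|f1 f2 _ h1 _ h2|k f1 _ h1].
- elim: pg => [d|g1 g2 _ h1 _ h2|k g1 _ h1]; first exact: polyfun_const.
    rewrite (_ : (fun _ => _) = (fun m => c * g1 m + c * g2 m)); first exact: polyfun_add.
    by apply/funext => m; rewrite mulrDr.
  rewrite (_ : (fun _ => _) = (fun m : M => (m 0 k)%:~R * (c * g1 m))); first exact: polyfun_coord.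
  by apply/funext => m; rewrite mulrCA.
- rewrite (_ : (fun _ => _) = (fun m => f1 m * g m + f2 m * g m)); first exact: polyfun_add.
  by apply/funext => m; rewrite mulrDl.
- rewrite (_ : (fun _ => _) = (fun m : M => (m 0 k)%:~R * (f1 m * g m))); first exact: polyfun_coord.
  by apply/funext => m; rewrite mulrA.
Qed.

Lemma polyfun_opp f : polyfun f -> polyfun (fun m => f (- m)).
Proof.
elim=> [c|f1 f2 _ h1 _ h2|k f1 _ h1]; first exact: polyfun_const.
  exact: (polyfun_add h1 h2).
rewrite (_ : (fun _ => _) = (fun m : M => (-1) * ((m 0 k)%:~R * f1 (- m)))).
  by apply: polyfun_mul; [exact: polyfun_const | exact: polyfun_coord].
by apply/funext => m; rewrite mxE rmorphN /= mulN1r mulNr.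
Qed.

Lemma polyfun_sum (T : Type) (s : seq T) (f : T -> M -> C) :
  (forall t, polyfun (f t)) -> polyfun (fun m => \sum_(t <- s) f t m).
Proof.
move=> pf; elim: s => [|t s IH].
  rewrite (_ : (fun _ => _) = fun=> 0); first exact: polyfun_const.
  by apply/funext => m; rewrite big_nil.
rewrite (_ : (fun _ => _) = (fun m => f t m + \sum_(t <- s) f t m)); first exact: polyfun_add.
by apply/funext => m; rewrite big_cons.
Qed.

Lemma polyfun_prod (T : Type) (s : seq T) (f : T -> M -> C) :
  (forall t, polyfun (f t)) -> polyfun (fun m => \prod_(t <- s) f t m).
Proof.
move=> pf; elim: s => [|t s IH].
  rewrite (_ : (fun _ => _) = fun=> 1); first exact: polyfun_const.
  by apply/funext => m; rewrite big_nil.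
rewrite (_ : (fun _ => _) = (fun m => f t m * \prod_(t <- s) f t m)); first exact: polyfun_mul.
by apply/funext => m; rewrite big_cons.
Qed.

Lemma polyfun_binspan (J : finType) (v : J -> M) (b : M) f : polyfun f ->
  exists2 psi : (J -> C) -> C, binspan psi &
    forall z : J -> int, psi (fun j => (z j)%:~R) = f (b + \sum_j v j *~ z j).
Proof.
elim=> [c|f1 f2 _ [p1 s1 h1] _ [p2 s2 h2]|k f1 _ [p1 s1 h1]].
- by exists (fun=> c) => //; apply: binspan_const.
- by exists (fun x => p1 x + p2 x) => [|z]; [exact: binspanD | rewrite h1 h2].
exists (fun x => (b 0 k)%:~R * p1 x + \sum_(j <- enum J) ((v j 0 k)%:~R * (x j * p1 x))).
  apply: binspanD; first exact: binspanZ.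
  by apply: binspan_sum => j; apply/binspanZ/binspan_coord.
move=> z; rewrite -h1 mxE rmorphD /= mulrDl big_enum /=; congr (_ + _).
rewrite summxE rmorph_sum mulr_suml; apply: eq_bigr => j _ /=.
rewrite mulrA; congr (_ * _).
have -> : (v j *~ z j) 0 k = v j 0 k * z j.
  by rewrite -scaler_int mxE intz mulrC.
by rewrite rmorphM.
Qed.

Definition lsum (S : M -> Prop) (f : M -> C) : C := \sum_(m \in [set m | S m]%classic) f m.

Lemma lsum_seq (S : M -> Prop) (f : M -> C) (L : seq M) : uniq L ->
  (forall m, m \in L <-> S m) -> lsum S f = \sum_(m <- L) f m.
Proof.
move=> uL LS; rewrite /lsum [RHS]fsbig_seq //; apply: eq_fsbigl.
by apply/predeqP => m; rewrite /= LS.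
Qed.

Lemma lsum_cond (S : M -> Prop) (f : M -> C) (L : seq M) : uniq L ->
  (forall m, S m -> m \in L) -> lsum S f = \sum_(m <- L) `[< S m >]%:R * f m.
Proof.
move=> uL LS; rewrite (@lsum_seq _ _ [seq m <- L | `[< S m >]]) ?filter_uniq //.
  rewrite big_filter big_mkcond; apply: eq_bigr => m _.
  by case: asboolP; rewrite ?mul1r ?mul0r.
move=> m; rewrite mem_filter; split=> [/andP[/asboolP]//|Sm].
by rewrite LS // andbT; apply/asboolP.
Qed.

Lemma lsum_partition (K : finType) (P : pred K) (T : K -> M -> Prop) (S : M -> Prop)
    (f : M -> C) (r : seq M) : uniq r -> (forall m, S m -> m \in r) ->
  (forall m, (\sum_(k | P k) `[< T k m >] = `[< S m >] :> nat)%N) ->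
  lsum S f = \sum_(k | P k) lsum (T k) f.
Proof.
move=> ur Sr SE; rewrite (lsum_cond _ ur) //.
under [RHS]eq_bigr => k Pk.
  rewrite (lsum_cond _ ur); last first.
    move=> m Tm; apply: Sr; apply/asboolP; have : (0 < `[< S m >])%N.
      by rewrite -SE (bigD1 k) //= (asboolT Tm).
    by rewrite lt0b.
over.
rewrite exchange_big; apply: eq_bigr => m _ /=.
by rewrite -mulr_suml -natr_sum SE.
Qed.

(** [lsum] ranges over arbitrary sets of lattice points; a bounding box supplies the list on which
    it is computed. *)
Lemma box_seq (B : nat) : exists2 r : seq M, uniq r &
  forall m : M, (forall k, `|m 0 k| <= B%:Z) -> m \in r.
Proof.
pose g (f : {ffun 'I_n -> 'I_(B + B).+1}) : M := \row_k ((f k : nat)%:Z - B%:Z).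
exists (undup (codom g)); first exact: undup_uniq.
move=> m mB; rewrite mem_undup; apply/codomP.
exists [ffun k => inord (absz (m 0 k + B%:Z))]; apply/rowP => k; rewrite mxE ffunE.
have := mB k; move: (m 0 k) => z; rewrite ler_norml => /andP[z1 z2].
have zE : (absz (z + B%:Z))%:Z = z + B%:Z by rewrite gez0_abs //; lia.
by rewrite inordK ?zE ?addrK //; lia.
Qed.

End LatticeSums.

(** * Fundamental parallelepipeds of half-open simplicial cones *)

Lemma half_open_unit_inj (R : realFieldType) (b : bool) (a a' : R) (k k' : nat) :
  (if b then 0 < a <= 1 else 0 <= a < 1) ->
  (if b then 0 < a' <= 1 else 0 <= a' < 1) ->
  a + k%:R = a' + k'%:R -> k = k'.
Proof.
move=> h1 h2 e; have le1 u u' : (u < u')%N -> u%:R + 1 <= u'%:R :> R.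
  by move=> uu; rewrite natr1 ler_nat.
case: (ltnP k k') => [/le1 kk|].
  by exfalso; move: h1 h2; case: b => /andP[? ?] /andP[? ?]; lra.
rewrite leq_eqVlt => /predU1P[//|/le1 kk].
by exfalso; move: h1 h2; case: b => /andP[? ?] /andP[? ?]; lra.
Qed.

Lemma half_open_unit_exists (R : archiRealFieldType) (b : bool) (a : R) :
  (if b then 0 < a else 0 <= a) ->
  exists k : nat, if b then 0 < a - k%:R <= 1 else 0 <= a - k%:R < 1.
Proof.
have H : 0 <= a -> exists k : nat, k%:R <= a < k%:R + 1.
  by move=> a0; exists (Num.truncn a); rewrite natr1 Num.Theory.truncn_itv.
case: b => [a0|/H[k /andP[? ?]]]; last by exists k; lra.
have [k /andP[k1 k2]] := H (ltW a0).
have [ak|ak] := eqVneq a k%:R; last first.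
  have : k%:R < a by rewrite lt_neqAle eq_sym ak.
  by move=> ?; exists k; lra.
case: k => [|k] in k1 k2 ak *; first by rewrite ak ltxx in a0.
by exists k; rewrite ak -natr1; lra.
Qed.

Section Homogenization.
Import mathcomp.boot.fintype mathcomp.boot.finset.
Variables (R : realType) (n : nat) (I : finType) (v : I -> 'rV[int]_n).
Notation M := 'rV[int]_n.
Notation C := R[i].
Notation V := ('rV[R]_n * R^o)%type.
Implicit Types (c : {ffun I -> R^o}) (J A : {set I}).

Definition hpoint (l : nat) (m : M) : V := (lattice_point R m, l%:R).
Definition hgen (i : I) : V := hpoint 1 (v i).
Definition height : 'Hom(V, R^o) := linfun (snd : V -> R^o).

Lemma heightE (z : V) : height z = z.2.
Proof. by rewrite lfunE. Qed.

Lemma height_gen i : height (hgen i) = 1.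
Proof. by rewrite heightE. Qed.

Lemma comb_hgen c : comb hgen c = (\sum_i c i *: lattice_point R (v i), \sum_i (c i : R)).
Proof.
rewrite [LHS]surjective_pairing; congr (_, _).
  by rewrite /comb (raddf_sum (fst : V -> _)); apply: eq_bigr.
rewrite /comb (raddf_sum (snd : V -> _)); apply: eq_bigr => i _ /=.
by rewrite /hgen /hpoint /= -[_ *: _]/(c i * 1) mulr1.
Qed.

Lemma cone_bound l m k : cone hgen (hpoint l m) ->
  `|m 0 k| <= (l * \sum_i \sum_k absz (v i 0%R k))%N%:Z.
Proof.
case=> c c0; rewrite comb_hgen => -[cm cl].
have ci i : (c i : R) <= l%:R.
  by rewrite -cl (bigD1 i) //= lerDl sumr_ge0 // => j _; exact: c0.
have := congr1 (fun z : 'rV[R]_n => z 0 k) cm; rewrite summxE mxE => E.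
suff : `|(m 0 k)%:~R : R| <= (l * \sum_i \sum_k absz (v i 0%R k))%:R.
  by rewrite -intr_norm pmulrn ler_int.
rewrite -E natrM natr_sum mulr_sumr; apply: le_trans (ler_norm_sum _ _ _) _.
apply: ler_sum => i _; rewrite !mxE normrM; apply: ler_pM => //.
  by rewrite ger0_norm //; exact: c0.
rewrite natr_sum (bigD1 k) //= -intr_norm -abszE.
by rewrite -pmulrn lerDl sumr_ge0.
Qed.

Lemma half_open_cone J A z : half_open hgen J A z -> cone hgen z.
Proof.
case=> c [/supp_subP sc cz] cP; exists c => // i.
have [iJ|/sc -> //] := boolP (i \in J).
by have := cP i iJ; case: ifP => // _ /ltW.
Qed.

Lemma rcone_cone z : rcone hgen z -> cone hgen z.
Proof. by case=> c c0 cz; exists c => // i; apply: ltW. Qed.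

(** The lattice points of the half-open fundamental parallelepiped, paired with their heights. *)
Definition box J A (bh : M * nat) := exists2 c : {ffun I -> R^o},
  supp c \subset J /\ comb hgen c = hpoint bh.2 bh.1 &
  forall j, j \in J -> if j \in A then 0 < c j <= 1 else 0 <= c j < 1.

Lemma box_half_open J A bh : box J A bh -> half_open hgen J A (hpoint bh.2 bh.1).
Proof.
case=> c sc cP; exists c => // j jJ; have := cP j jJ.
by case: ifP => _ /andP[].
Qed.

Lemma box_height J A bh : box J A bh -> (bh.2 <= #|J|)%N.
Proof.
case=> c [/supp_subP sc]; rewrite comb_hgen => -[_ E] cP.
rewrite -(ler_nat R) -E (bigID (mem J)) /= [X in _ + X]big1 ?addr0.
  rewrite -sumr_const; apply: ler_sum => j jJ; have := cP j jJ.
  by case: ifP => _ /andP[_ // /ltW].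
by move=> i /sc.
Qed.

Lemma boxes_exist J A : exists2 bx : seq (M * nat), uniq bx & forall bh, bh \in bx <-> box J A bh.
Proof.
have [r ur rP] := box_seq n (#|I| * \sum_i \sum_k absz (v i 0%R k)).
exists [seq bh <- [seq (b, h) | b <- r, h <- iota 0 #|I|.+1] | `[< box J A bh >]].
  by rewrite filter_uniq // allpairs_uniq ?iota_uniq // => -[? ?] [].
case=> b h; rewrite mem_filter; split=> [/andP[/asboolP]//|bbh].
rewrite (introT (asboolP _) bbh) andTb; apply/allpairsPdep; exists b, h; split=> //.
  apply: rP => k; apply: le_trans (cone_bound k (half_open_cone (box_half_open bbh))) _ => /=.
  rewrite lez_nat leq_mul2r (leq_trans (box_height bbh)) ?max_card ?orbT //.
by rewrite mem_iota add0n ltnS (leq_trans (box_height bbh)) ?max_card.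
Qed.

Definition shift_coef J (z : {i | i \in J} -> int) : {ffun I -> R^o} :=
  [ffun i => if insub i is Some j then (z j)%:~R else 0].

Lemma shift_coefE J z (j : {i | i \in J}) : shift_coef z (val j) = (z j)%:~R.
Proof. by rewrite ffunE valK. Qed.

Lemma supp_shift_coef J (z : {i | i \in J} -> int) : supp (shift_coef z) \subset J.
Proof. by apply/supp_subP => i iJ; rewrite ffunE insubN. Qed.

Lemma comb_shift_coef J (z : {i | i \in J} -> int) :
  comb hgen (shift_coef z) =
    (lattice_point R (\sum_j v (val j) *~ z j), (\sum_j z j)%:~R).
Proof.
have /supp_subP s0 := supp_shift_coef z.
rewrite comb_hgen; congr (_, _).
  rewrite (bigID (mem J)) /= [X in _ + X]big1 ?addr0 => [|i /s0 ->]; last by rewrite scale0r.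
  rewrite big_sub /lattice_point (raddf_sum (map_mx intr)); apply: eq_bigr => j _.
  by rewrite shift_coefE raddfMz scaler_int.
rewrite (bigID (mem J)) /= [X in _ + X]big1 ?addr0 => [|i /s0 -> //].
by rewrite big_sub rmorph_sum; apply: eq_bigr => j _; rewrite shift_coefE.
Qed.

Lemma hpointD l l' m m' : hpoint l m + hpoint l' m' = hpoint (l + l') (m + m').
Proof. by rewrite /hpoint natrD /lattice_point map_mxD. Qed.

(** Splitting off integral parts of the coefficients, with remainders in [(0, 1]] for [j] in [A] and
    in [[0, 1)] otherwise, writes each lattice point of the half-open cone uniquely as a box point
    plus a combination of the generators with natural coefficients [z]. *)
Lemma half_open_sum J A (bx : seq (M * nat)) l (f : M -> C) :
  affbasis hgen J -> uniq bx -> (forall bh, bh \in bx <-> box J A bh) ->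
  lsum (fun m => half_open hgen J A (hpoint l m)) f =
  \sum_(bh <- bx) \sum_(z : {ffun {i | i \in J} -> 'I_l.+1} | (\sum_j z j + bh.2 == l)%N)
     f (bh.1 + \sum_j v (val j) *~ (z j : nat)%:Z).
Proof.
move=> bJ ubx bxP; pose N := {ffun {i | i \in J} -> 'I_l.+1}.
pose pt (t : (M * nat) * N) := t.1.1 + \sum_j v (val j) *~ (t.2 j : nat)%:Z.
pose cd (t : (M * nat) * N) := (\sum_j t.2 j + t.1.2 == l)%N.
pose ts := [seq (bh, z) | bh <- bx, z <- enum N].
pose L := [seq pt t | t <- [seq t <- ts | cd t]].
have sumz (z : N) : ((\sum_j (z j : nat)%:Z)%:~R : R^o) = (\sum_j z j)%N%:R.
  by rewrite pmulrn (big_morph Posz PoszD (erefl _)).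
have rep (t : (M * nat) * N) : t \in [seq t <- ts | cd t] ->
   exists c : {ffun I -> R^o}, [/\ comb hgen c = hpoint t.1.2 t.1.1, supp c \subset J,
     (forall j, j \in J -> if j \in A then 0 < c j <= 1 else 0 <= c j < 1),
     supp (c + shift_coef (fun j => (t.2 j : nat)%:Z)) \subset J
     & comb hgen (c + shift_coef (fun j => (t.2 j : nat)%:Z)) = hpoint l (pt t)].
  rewrite mem_filter => /andP[/eqP tl /allpairsPdep[bh [z [/bxP[c [sc cE] cP] _ tE]]]].
  rewrite {}tE /= in tl *; exists c; split=> //.
    by rewrite -[c]scale1r supp_lin // supp_shift_coef.
  rewrite linearD /= cE comb_shift_coef sumz.
  transitivity (hpoint (bh.2 + \sum_j z j)%N (pt (bh, z))); last by rewrite addnC tl.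
  by rewrite /pt /= -hpointD.
have uL : uniq L.
  rewrite map_inj_in_uniq; first by rewrite filter_uniq // allpairs_uniq ?enum_uniq // => -[? ?] [].
  move=> [[b h] z] [[b' h'] z'] /[dup] tin /rep[c [cE sc cP scz czE]].
  move=> /[dup] tin' /rep[c' [cE' sc' cP' scz' czE']] ptE; rewrite -ptE -czE in czE'.
  have /ffunP E := indep_inj bJ.1 scz' scz czE'.
  have zz j : z' j = z j.
    apply/val_inj => /=; have := E (val j); rewrite !ffunE !valK /=.
    have jJ : val j \in J by exact: valP.
    have := cP _ jJ; have := cP' _ jJ; rewrite /=.
    by move=> h1 h2 e; apply: (half_open_unit_inj h1 h2 e).
  have zE : z = z' by apply/ffunP => j; rewrite zz.
  move: tin tin'; rewrite !mem_filter /cd /= zE => /andP[/eqP h1 _] /andP[/eqP h2 _].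
  have hh : h = h' by apply: (@addnI (\sum_j z' j)%N); rewrite h1.
  move: ptE; rewrite /pt /= zE hh => /addIr -> //.
have LP m : m \in L <-> half_open hgen J A (hpoint l m).
  split=> [/mapP[t /rep[c [cE sc cP scz czE]] ->]|].
    exists (c + shift_coef (fun j => (t.2 j : nat)%:Z)) => // j jJ.
    have := cP j jJ; rewrite !ffunE insubT /=.
    by case: ifP => _ /andP[c0 _]; rewrite ?ltr_wpDr ?addr_ge0 // ler0z.
  case=> c [sc cE] cP.
  have /choice[z zP] (j : {i | i \in J}) : exists k : nat,
      (if val j \in A then 0 < c (val j) - k%:R <= 1 else 0 <= c (val j) - k%:R < 1).
    exact: (half_open_unit_exists (a := c (val j)) (cP _ (valP j))).
  have cl : \sum_i (c i : R) = l%:R by move: cE; rewrite comb_hgen => -[].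
  have zc j : (z j)%:R <= (c (val j) : R).
    by rewrite -subr_ge0; have := zP j; case: ifP => _ /andP[z1 _] //; apply: ltW z1.
  have sz : (\sum_j z j <= l)%N.
    have cJ : l%:R = \sum_(j : {i | i \in J}) (c (val j) : R).
      rewrite -cl (bigID (mem J)) /=.
      rewrite [X in _ + X]big1; last by move=> i; move/supp_subP: sc; apply.
      by rewrite addr0 big_sub.
    by rewrite -(ler_nat R) cJ natr_sum; apply: ler_sum => j _; exact: zc.
  have zl j : (z j < l.+1)%N by rewrite ltnS (leq_trans _ sz) // (bigD1 j) //= leq_addr.
  pose zz : N := [ffun j => Ordinal (zl j)].
  pose b := m - \sum_j v (val j) *~ (zz j : nat)%:Z; pose h := (l - \sum_j z j)%N.
  have szz : (\sum_j zz j = \sum_j z j)%N by apply: eq_bigr => j _; rewrite ffunE.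
  apply/mapP; exists ((b, h), zz); last by rewrite /pt /= subrK.
  rewrite mem_filter /cd /= szz subnKC // eqxx /=.
  apply/allpairsPdep; exists (b, h), zz; split=> //=; last by rewrite mem_enum.
  apply/bxP; exists (c - shift_coef (fun j => (zz j : nat)%:Z)).
    split; first by rewrite addrC -scaleN1r supp_lin // supp_shift_coef.
    rewrite linearB /= cE comb_shift_coef; apply/eqP; rewrite subr_eq; apply/eqP.
    rewrite sumz szz.
    by rewrite -/(hpoint (\sum_j z j)%N _) hpointD subrK subnK.
  move=> j jJ; rewrite !ffunE insubT /=.
  by have := zP (Sub j jJ); rewrite ffunE.
rewrite (lsum_seq _ uL LP) big_map big_filter big_mkcond big_allpairs_dep /=.
by apply: eq_bigr => bh _; rewrite [RHS]big_mkcond big_enum.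
Qed.

End Homogenization.

(** * Reciprocity for half-open simplicial cones and for arbitrary cones *)

Lemma half_open_unit_opp (R : realFieldType) (b : bool) (a : R) :
  (if b then 0 < a <= 1 else 0 <= a < 1) ->
  if ~~ b then 0 < 1 - a <= 1 else 0 <= 1 - a < 1.
Proof.
by case: b => /andP[? ?] /=; apply/andP; split; lra.
Qed.

Lemma subnKA l h c : (h <= c)%N -> (c - h <= l)%N -> (l + h = l - (c - h) + c)%N.
Proof. lia. Qed.

Lemma eqn_subr_add u h l : (h <= l)%N -> (u == l - h)%N = (u + h == l)%N.
Proof. by move=> hl; apply/eqP/eqP; lia. Qed.

Section Reciprocity.
Import mathcomp.boot.fintype mathcomp.boot.finset.
Variables (R : realType) (n : nat) (I : finType) (v : I -> 'rV[int]_n).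
Notation M := 'rV[int]_n.
Notation C := R[i].
Notation V := ('rV[R]_n * R^o)%type.
Notation hgen := (hgen R v).
Notation hpoint := (hpoint R).
Notation box := (box R v).
Implicit Types (J A : {set I}).

(* This symmetry of the box is what makes reciprocity hold for half-open
   simplicial cones. *)
Lemma box_opp J A bh : A \subset J -> box J A bh ->
  box J (J :\: A) (\sum_(j in J) v j - bh.1, (#|J| - bh.2)%N).
Proof.
move=> AJ bbh; have := box_height bbh; case: bbh => c [sc cE] cP hJ.
pose u : {ffun I -> R^o} := [ffun i => (i \in J)%:R].
have su : supp u \subset J.
  by apply/supp_subP => i /negbTE iJ; rewrite ffunE iJ.
have uE : comb hgen u = hpoint #|J| (\sum_(j in J) v j).
  rewrite comb_hgen /hpoint; congr (_, _).
    rewrite /lattice_point (raddf_sum (map_mx intr)) [RHS]big_mkcond; apply: eq_bigr => i _.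
    by rewrite ffunE; case: ifP; rewrite ?scale1r ?scale0r.
  rewrite -sumr_const [RHS]big_mkcond; apply: eq_bigr => i _.
  by rewrite ffunE; case: ifP.
exists (u - c); first split=> /=.
- by rewrite addrC -scaleN1r supp_lin.
- rewrite linearB /= uE cE; apply/eqP; rewrite subr_eq; apply/eqP.
  by rewrite hpointD subrK subnK.
move=> j jJ; have := cP j jJ; rewrite !ffunE in_setD jJ andbT.
exact: half_open_unit_opp.
Qed.

(** A box point of height [h] contributes its simplex polynomial at [l - h]. At [- l] the argument
    is [- (l + h) = - ((l - (#|J| - h)) + #|J|)], which reciprocity for simplices turns into the
    contribution of the opposite box point, of height [#|J| - h]. *)
Lemma half_open_reciprocity J A (f : M -> C) : affbasis hgen J -> A \subset J ->
  (0 < #|J|)%N -> polyfun f ->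
  exists p : {poly C}, forall l, (0 < l)%N ->
    p.[l%:R] = lsum (fun m => half_open hgen J A (hpoint l m)) f /\
    (-1) ^+ #|J|.-1 * p.[- l%:R] =
      lsum (fun m => half_open hgen J (J :\: A) (hpoint l m)) (fun m => f (- m)).
Proof.
move=> bJ AJ J0 pf; have cJ : #|{: {i | i \in J}}| = #|J| by rewrite card_sig.
have [bx ubx bxP] := boxes_exist R v J A.
pose op (bh : M * nat) := (\sum_(j in J) v j - bh.1, (#|J| - bh.2)%N).
have opK bh : (bh.2 <= #|J|)%N -> op (op bh) = bh.
  by case: bh => b h /= hJ; rewrite /op /= subKn // opprB addrC subrK.
have ubx' : uniq (map op bx).
  rewrite map_inj_in_uniq // => bh bh' /bxP/box_height h1 /bxP/box_height h2 E.
  by rewrite -(opK bh) // E opK.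
have bxP' bh : bh \in map op bx <-> box J (J :\: A) bh.
  split=> [/mapP[bh' /bxP bbh' ->]|bbh]; first exact: box_opp.
  apply/mapP; exists (op bh); last by rewrite opK // (box_height bbh).
  apply/bxP; have := box_opp (subsetDl J A) bbh.
  by rewrite setDDr setDv set0U (setIidPr AJ).
have /choice[P PP] (bh : M * nat) : exists p : {poly C}, [/\
    forall k K, (k <= K)%N ->
      \sum_(z : {ffun {i | i \in J} -> 'I_K.+1} | (\sum_j z j == k)%N)
         f (bh.1 + \sum_j v (val j) *~ (z j : nat)%:Z) = p.[k%:R],
    forall k, (0 < k < #|J|)%N -> p.[- k%:R] = 0
  & forall k K, (k <= K)%N -> (-1) ^+ #|J|.-1 *
      \sum_(z : {ffun {i | i \in J} -> 'I_K.+1} | (\sum_j z j == k)%N)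
        f (bh.1 + \sum_j v (val j) *~ (-1 - (z j : nat)%:Z)) = p.[- (k + #|J|)%:R]].
  have [psi bpsi psiE] := polyfun_binspan (fun j : {i | i \in J} => v (val j)) bh.1 pf.
  have [|p [p1 p2 p3]] := simplex_reciprocity _ bpsi; first by rewrite cJ.
  rewrite cJ in p2 p3; exists p; split=> // k K kK.
    rewrite -(p1 k K kK); apply: eq_bigr => z _; rewrite -psiE //.
  rewrite -(p3 k K kK); congr (_ * _); apply: eq_bigr => z _; rewrite -psiE.
  by congr (psi _); apply/funext => j; rewrite rmorphB rmorphN1.
exists (\sum_(bh <- bx) (P bh \Po ('X - bh.2%:R%:P))) => l l0.
have pE x : (\sum_(bh <- bx) (P bh \Po ('X - bh.2%:R%:P))).[x]
    = \sum_(bh <- bx) (P bh).[x - bh.2%:R].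
  by rewrite horner_sum; apply: eq_bigr => bh _; rewrite horner_comp hornerXsubC.
split; rewrite pE.
  rewrite (half_open_sum l f bJ ubx bxP); apply: eq_big_seq => bh /bxP/box_height hJ.
  have [p1 p2 _] := PP bh; have [hl|lh] := leqP bh.2 l.
    rewrite -natrB // -(p1 _ _ (leq_subr _ _)); apply: eq_bigl => z.
    by rewrite eqn_subr_add.
  (* The sum is empty, and [l - bh.2] lies strictly between [- #|J|] and 0, where the simplex
     polynomial vanishes. *)
  rewrite [RHS]big_pred0 => [|z]; last by apply/eqP => E; move: lh; rewrite -E ltnNge leq_addl.
  rewrite -opprB -natrB ?(ltnW lh) // p2 // subn_gt0 lh (leq_trans _ hJ) //.
  by rewrite ltn_subrL l0 (leq_trans _ lh).
rewrite (half_open_sum l _ bJ ubx' bxP') big_map mulr_sumr.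
apply: eq_big_seq => bh /bxP/box_height hJ /=.
have [p1 p2 p3] := PP bh.
have [hl|lh] := leqP (#|J| - bh.2)%N l.
  have -> : - l%:R - bh.2%:R = - (l - (#|J| - bh.2) + #|J|)%:R :> C.
    by rewrite -opprD -natrD; congr (- _%:R); exact: subnKA.
  rewrite -(p3 _ _ (leq_subr _ _)) mulrA -expr2 sqrr_sign mul1r.
  apply: eq_big => z; first by rewrite eqn_subr_add.
  move=> _; congr f; rewrite opprD opprB -[RHS]addrA; congr (_ + _).
  have -> : \sum_(j in J) v j = \sum_(j : {i | i \in J}) v (val j) by exact: big_sub.
  rewrite -[RHS]opprD -big_split -sumrN; apply: eq_bigr => j _ /=.
  by rewrite -opprD mulrNz mulrzDr mulr1z.
rewrite [RHS]big_pred0 => [|z]; last by apply/eqP => E; move: lh; rewrite -E ltnNge leq_addl.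
have -> : - l%:R - bh.2%:R = - (l + bh.2)%:R :> C by rewrite -opprD -natrD.
by rewrite p2 ?mulr0 // addn_gt0 l0 /= addnC -ltn_subRL.
Qed.

Lemma lsum_decomposition (T : {set {set I}}) (B : {set I} -> {set I}) (S : V -> Prop) l (f : M -> C) :
  (forall z, S z -> cone hgen z) ->
  (forall z, (\sum_(J in T) `[< half_open hgen J (B J) z >] = `[< S z >] :> nat)%N) ->
  lsum (fun m => S (hpoint l m)) f =
  \sum_(J in T) lsum (fun m => half_open hgen J (B J) (hpoint l m)) f.
Proof.
move=> Scone SE; have [r ur rP] := box_seq n (l * \sum_i \sum_k absz (v i 0%R k)).
apply: (lsum_partition f ur) => [m /Scone cm|m]; last exact: SE.
by apply: rP => k; apply: cone_bound cm.
Qed.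

(** All cells are bases of the same space, hence of equal cardinality: the sign is common to all the
    pieces and comes out of the sum. *)
Theorem ehrhart_reciprocity (f : M -> C) : (0 < #|I|)%N -> polyfun f ->
  exists p : {poly C}, forall l, (0 < l)%N ->
    p.[l%:R] = lsum (fun m => rcone hgen (hpoint l m)) f /\
    (-1) ^+ (\dim <<codom hgen>>).-1 * p.[- l%:R] =
      lsum (fun m => cone hgen (hpoint l m)) (fun m => f (- m)).
Proof.
move=> I0 pf; have [T [A [TA cE rE]]] := half_open_decomposition hgen.
have cardT J : J \in T -> #|J| = \dim <<codom hgen>>.
  by move=> /TA[bJ _]; exact: card_basis.
have J0 : (0 < \dim <<codom hgen>>)%N.
  move/card_gt0P: I0 => [i _]; rewrite lt0n dimv_eq0; apply/eqP => E.
  have := memv_span (codom_f hgen i); rewrite E memv0 => /eqP[_] /eqP.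
  by rewrite oner_eq0.
have /choice[P PP] J : exists p : {poly C}, J \in T -> forall l, (0 < l)%N ->
    p.[l%:R] = lsum (fun m => half_open hgen J (J :\: A J) (hpoint l m)) f /\
    (-1) ^+ #|J|.-1 * p.[- l%:R] =
      lsum (fun m => half_open hgen J (A J) (hpoint l m)) (fun m => f (- m)).
  have [JT|_] := boolP (J \in T); last by exists 0.
  have [bJ AJ] := TA _ JT.
  have [|p pP] := half_open_reciprocity bJ (subsetDl J (A J)) _ pf; first by rewrite cardT.
  exists p => _ l l0; have [p1 p2] := pP l l0; split=> //.
  by rewrite p2 setDDr setDv set0U (setIidPr AJ).
exists (\sum_(J in T) P J) => l l0; rewrite !horner_sum; split.
  rewrite (@lsum_decomposition T (fun J => J :\: A J) (rcone hgen)) //.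
    by apply: eq_bigr => J JT; have [-> _] := PP J JT l l0.
  by move=> z; apply: rcone_cone.
rewrite (@lsum_decomposition T A (cone hgen)) // mulr_sumr.
by apply: eq_bigr => J JT; have [_ <-] := PP J JT l l0; rewrite cardT.
Qed.

End Reciprocity.

(** * The Euler relation *)

Section Subfamily.
Import mathcomp.boot.fintype mathcomp.boot.finset.
Variables (R : realFieldType) (V : vectType R) (I : finType) (q : I -> V).
Implicit Types (F G : {set I}).

(** Coefficients stay indexed by [I], with a condition on their support, so that all faces are
    compared over one type; [cone_on_sub] and [rcone_on_sub] pass to the family indexed by [F]. *)
Definition cone_on F z := exists c : {ffun I -> R^o},
  [/\ forall i, 0 <= c i, supp c \subset F & comb q c = z].
Definition rcone_on F z := exists c : {ffun I -> R^o},
  [/\ forall i, 0 <= c i, supp c = F & comb q c = z].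

Definition subfam F (j : {i | i \in F}) : V := q (val j).
Definition extend_coef F (c : {ffun {i | i \in F} -> R^o}) : {ffun I -> R^o} :=
  [ffun i => if insub i is Some j then c j else 0].

Lemma extend_coefE F c (j : {i | i \in F}) : extend_coef c (val j) = c j.
Proof. by rewrite ffunE valK. Qed.

Lemma supp_extend F (c : {ffun {i | i \in F} -> R^o}) : supp (extend_coef c) \subset F.
Proof. by apply/supp_subP => i iF; rewrite ffunE insubN. Qed.

Lemma comb_sub F (c : {ffun I -> R^o}) : supp c \subset F ->
  comb q c = comb (@subfam F) [ffun j => c (val j)].
Proof.
move=> /supp_subP sc; rewrite /comb (bigID (mem F)) /=.
rewrite [X in _ + X]big1 => [|i /sc ->]; last by rewrite scale0r.
rewrite addr0 (big_sub (mem F) (fun i => c i *: q i)); apply: eq_bigr => j _.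
by rewrite ffunE.
Qed.

Lemma cone_on_sub F z : cone_on F z <-> cone (@subfam F) z.
Proof.
split=> [[c [c0 sc cz]]|[c c0 cz]].
  exists [ffun j => c (val j)]; first by move=> j; rewrite ffunE.
  by rewrite -(comb_sub sc).
exists (extend_coef c); split; last 1 first.
- rewrite (comb_sub (supp_extend c)) -cz; congr (comb _ _); apply/ffunP => j.
  by rewrite ffunE extend_coefE.
- by move=> i; rewrite ffunE; case: insubP.
- exact: supp_extend.
Qed.

Lemma rcone_on_sub F z : rcone_on F z <-> rcone (@subfam F) z.
Proof.
split=> [[c [c0 sc cz]]|[c c0 cz]].
  have sc' : supp c \subset F by rewrite sc.
  exists [ffun j => c (val j)]; last by rewrite -(comb_sub sc').
  move=> j; rewrite ffunE lt_neqAle eq_sym c0 andbT.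
  by have /setP/(_ (val j)) := sc; rewrite inE (valP j).
exists (extend_coef c); split; last 1 first.
- rewrite (comb_sub (supp_extend c)) -cz; congr (comb _ _); apply/ffunP => j.
  by rewrite ffunE extend_coefE.
- by move=> i; rewrite ffunE; case: insubP => // j _ _; exact: ltW.
- apply/setP => i; rewrite inE ffunE; case: insubP => [j iF _|/negbTE ->].
    by rewrite iF gt_eqF.
  by rewrite eqxx.
Qed.

Lemma qspan_sub_codom F : qspan q F = <<codom (@subfam F)>>%VS.
Proof.
apply: eq_span => u; apply/mapP/codomP => [[i +]|[j ->]].
  by rewrite mem_enum => iF ->; exists (Sub i iF).
by exists (val j); rewrite // mem_enum (valP j).
Qed.

Lemma rcone_on_cone F z : rcone_on F z -> cone_on F z.
Proof. by case=> c [c0 sc cz]; exists c; rewrite sc. Qed.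

Lemma rcone_on_sub_face F G z : cface q F -> cone_on F z -> rcone_on G z -> G \subset F.
Proof.
move=> fF [c [c0 sc cz]] [d [d0 <- dz]].
by apply: (cface_supp fF d0 sc); rewrite dz.
Qed.

Lemma rcone_on_unique F G z : cface q F -> cface q G ->
  rcone_on F z -> rcone_on G z -> F = G.
Proof.
move=> fF fG rF rG; apply/eqP; rewrite eqEsubset.
by rewrite (rcone_on_sub_face fG (rcone_on_cone rG) rF)
  (rcone_on_sub_face fF (rcone_on_cone rF) rG).
Qed.

Lemma cone_on_face (eta : 'Hom(V, R^o)) F z : (forall i, eta (q i) = 1) ->
  cface q F -> cone_on F z -> exists2 G, cface q G & rcone_on G z /\ G \subset F.
Proof.
move=> eta1 fF cF; have [c [c0 sc cz]] := cF.
have [G fG [d [d0 sd dz]]] := minimal_face eta1 c0.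
exists G => //; have rG : rcone_on G z by exists d; rewrite dz.
by split=> //; apply: rcone_on_sub_face rG.
Qed.

Lemma cone_on_setT F z : cone_on F z -> cone q z.
Proof. by case=> c [c0 _ cz]; exists c. Qed.

End Subfamily.

Lemma natr_inj_num (A : numDomainType) : injective (fun i : nat => i%:R : A).
Proof. by move=> i j /eqP; rewrite eqr_nat => /eqP. Qed.

Section EhrhartFaces.
Import mathcomp.boot.fintype mathcomp.boot.finset.
Variables (R : realType) (n : nat) (I : finType) (v : I -> 'rV[int]_n).
Notation M := 'rV[int]_n.
Notation C := R[i].
Notation V := ('rV[R]_n * R^o)%type.
Notation q := (hgen R v).
Notation hpoint := (hpoint R).
Implicit Types (F G : {set I}) (f : M -> C).

Lemma rk_gt0 F : F != set0 -> (0 < rk q F)%N.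
Proof.
move=> /set0Pn[i iF]; rewrite lt0n dimv_eq0; apply/eqP => E.
have := mem_qspan q iF; rewrite E memv0 => /eqP[_] /eqP.
by rewrite oner_eq0.
Qed.

Lemma hpoint_neq0 l (m : M) : (0 < l)%N -> hpoint l m != 0.
Proof. by move=> l0; apply/eqP => -[_] /eqP; rewrite pnatr_eq0 => /eqP l00; rewrite l00 in l0. Qed.

Lemma rcone_on_neq0 F l (m : M) : (0 < l)%N -> rcone_on q F (hpoint l m) -> F != set0.
Proof.
move=> l0 [c [c0 sc cz]]; apply: contra_neq (hpoint_neq0 m l0) => F0.
rewrite -cz; apply: big1 => i _.
have /supp_subP -> : supp c \subset set0 by rewrite sc F0.
  exact: scale0r.
by rewrite inE.
Qed.

Lemma ehrhart_face F f : F != set0 -> polyfun f -> exists p : {poly C}, forall l, (0 < l)%N ->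
  p.[l%:R] = lsum (fun m => rcone_on q F (hpoint l m)) f /\
  (-1) ^+ (rk q F).-1 * p.[- l%:R] =
    lsum (fun m => cone_on q F (hpoint l m)) (fun m => f (- m)).
Proof.
move=> F0 pf; have c0 : (0 < #|{: {i | i \in F}}|)%N by rewrite card_sig card_gt0.
have [p pP] := ehrhart_reciprocity (fun j : {i | i \in F} => v (val j)) c0 pf.
exists p => l l0; have [p1 p2] := pP l l0; split.
  by rewrite p1; apply: eq_fsbigl; apply/predeqP => m; apply: iff_sym; apply: rcone_on_sub.
rewrite /rk qspan_sub_codom p2; apply: eq_fsbigl; apply/predeqP => m.
by apply: iff_sym; apply: cone_on_sub.
Qed.

Lemma lsum_faces F f l : cface q F -> (0 < l)%N ->
  lsum (fun m => cone_on q F (hpoint l m)) f =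
  \sum_(G : {set I} | `[< cface q G >] && ((G != set0) && (G \subset F)))
     lsum (fun m => rcone_on q G (hpoint l m)) f.
Proof.
move=> fF l0; have [r ur rP] := box_seq n (l * \sum_i \sum_k absz (v i 0%R k)).
apply: (lsum_partition f ur) => [m /cone_on_setT cm|m].
  by apply: rP => k; apply: cone_bound cm.
case: asboolP => [cm|ncm].
  have [G fG [rG GF]] := cone_on_face (height_gen R v) fF cm.
  have G0 := rcone_on_neq0 l0 rG.
  rewrite (bigD1 G) /=; last by rewrite asboolT // G0 GF.
  rewrite asboolT // big1 // => H /andP[/andP[/asboolP fH _] HG].
  by case: asboolP => // rH; rewrite (rcone_on_unique fH fG rH rG) eqxx in HG.
rewrite big1 // => G /and3P[_ _ GF]; case: asboolP => // -[c [c0 sc cz]].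
by case: ncm; exists c; split=> //; rewrite sc.
Qed.

(** Choosing the polynomials once for all weights and faces makes reciprocity an identity of
    polynomials that can be applied to its own right-hand side. *)
Lemma ehrhart_faces_exist : exists e : (M -> C) -> {set I} -> {poly C},
  (forall f F l, polyfun f -> F != set0 -> (0 < l)%N ->
     (e f F).[l%:R] = lsum (fun m => rcone_on q F (hpoint l m)) f) /\
  (forall f F, polyfun f -> cface q F -> F != set0 ->
     e f F \Po (- 'X) = (-1) ^+ (rk q F).-1 *:
       \sum_(G : {set I} | `[< cface q G >] && ((G != set0) && (G \subset F)))
         e (fun m => f (- m)) G).
Proof.
have /choice[e eP] f : exists e : {set I} -> {poly C}, forall F, polyfun f -> F != set0 ->
    forall l, (0 < l)%N -> (e F).[l%:R] = lsum (fun m => rcone_on q F (hpoint l m)) f /\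
    (-1) ^+ (rk q F).-1 * (e F).[- l%:R] =
      lsum (fun m => cone_on q F (hpoint l m)) (fun m => f (- m)).
  case: (pselect (polyfun f)) => [pf|npf]; last by exists (fun=> 0).
  have /choice[e eP] F : exists p : {poly C}, F != set0 -> forall l, (0 < l)%N ->
    p.[l%:R] = lsum (fun m => rcone_on q F (hpoint l m)) f /\
    (-1) ^+ (rk q F).-1 * p.[- l%:R] =
      lsum (fun m => cone_on q F (hpoint l m)) (fun m => f (- m)).
    have [F0|/ehrhart_face/(_ pf)[p pP]] := eqVneq F set0; last by exists p.
    by exists 0 => /eqP; rewrite F0.
  by exists e => F _; apply: eP.
exists e; split=> [f F l pf F0 l0|f F pf fF F0].
  by have [] := eP f F pf F0 l l0.
apply: poly_eq_natr => [|l l0]; first exact: natr_inj_num.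
have [_ E] := eP f F pf F0 l l0.
rewrite horner_comp hornerN hornerX hornerZ horner_sum.
rewrite -[LHS](signrMK (rk q F).-1) E; congr (_ * _).
rewrite lsum_faces //; apply: eq_bigr => G /and3P[_ G0 _].
by have [-> _] := eP _ G (polyfun_opp pf) G0 l l0.
Qed.

(** The weight is the product of the squared distances to the other points of the list. *)
Lemma isolating_polyfun (r : seq M) (m0 : M) : exists2 f : M -> C, polyfun f &
  f m0 != 0 /\ forall m, m \in r -> m != m0 -> f m = 0.
Proof.
pose g (m' m : M) : C := \sum_(k <- enum 'I_n) ((m 0 k)%:~R - (m' 0 k)%:~R) ^+ 2.
have gE m' m : g m' m = (\sum_k (m 0 k - m' 0 k) ^+ 2)%:~R.
  rewrite /g big_enum rmorph_sum; apply: eq_bigr => k _ /=.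
  by rewrite rmorphXn /= rmorphB.
exists (fun m => \prod_(m' <- [seq m' <- r | m' != m0]) g m' m).
  apply: polyfun_prod => m'; apply: polyfun_sum => k.
  have pk : polyfun (fun m : M => (m 0 k)%:~R - (m' 0 k)%:~R : C).
    rewrite (_ : (fun _ => _) = fun m : M => (m 0 k)%:~R * 1 + (- (m' 0 k)%:~R) : C).
      by apply: polyfun_add; [apply/polyfun_coord/polyfun_const | apply: polyfun_const].
    by apply/funext => m; rewrite mulr1.
  by apply: (polyfun_mul pk pk).
split.
  rewrite prodf_seq_neq0; apply/allP => m'; rewrite mem_filter => /andP[m'0 _] /=.
  rewrite gE intr_eq0 psumr_eq0 => [|k _]; last exact: sqr_ge0.
  apply: contraNN m'0 => /allP H; apply/eqP/rowP => k.
  have := H k; rewrite mem_index_enum => /(_ isT) /=.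
  by rewrite sqrf_eq0 subr_eq0 => /eqP.
move=> m mr mm0; apply/eqP; rewrite prodf_seq_eq0; apply/hasP; exists m.
  by rewrite mem_filter mm0.
by rewrite andTb gE big1 ?mulr0z // => k _; rewrite subrr expr0n.
Qed.

(* Applying reciprocity twice expresses the lattice sum over the interior of
   [H] through those over the interiors of its faces, with the alternating sums
   below as coefficients; a weight isolating one lattice point separates them. *)
Theorem euler_relation G H : cface q G -> cface q H -> G != set0 ->
  G \proper H ->
  \sum_(F : {set I} | `[< cface q F >] && ((G \subset F) && (F \subset H)))
     (-1) ^+ rk q F = 0 :> int.
Proof.
move=> fG fH G0 GH; have [e [e1 e2]] := ehrhart_faces_exist.
have H0 : H != set0 by case/properP: GH => /subsetP GH _; case/set0Pn: G0 => i /GH iH; apply/set0Pn; exists i.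
(* The sum of the generators of [G] is a lattice point in the relative interior of the dilate of [G]
   by their number. *)
pose l := #|G|; pose m0 := \sum_(i in G) v i.
have l0 : (0 < l)%N by rewrite card_gt0.
have [r ur rP] := box_seq n (l * \sum_i \sum_k absz (v i 0%R k)).
have [f pf [fm0 fr]] := isolating_polyfun r m0.
have rG : rcone_on q G (hpoint l m0).
  exists [ffun i => (i \in G)%:R]; split.
  - by move=> i; rewrite ffunE ler0n.
  - by apply/setP => i; rewrite inE ffunE pnatr_eq0 eqb0 negbK.
  rewrite comb_hgen /hpoint; congr (_, _).
    rewrite /lattice_point (raddf_sum (map_mx intr)) [RHS]big_mkcond; apply: eq_bigr => i _.
    by rewrite ffunE; case: ifP; rewrite ?scale1r ?scale0r.
  rewrite -sumr_const [RHS]big_mkcond; apply: eq_bigr => i _.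
  by rewrite ffunE; case: ifP.
have ef F : cface q F -> F != set0 -> (e f F).[l%:R] = if F == G then f m0 else 0.
  move=> fF F0; rewrite e1 //; case: eqVneq => [->|FG].
    rewrite (lsum_cond _ ur) => [|m /rcone_on_cone/cone_on_setT cm]; last first.
      by apply: rP => k; apply: cone_bound cm.
    rewrite (bigD1_seq m0) //=; last first.
      by apply: rP => k; apply: cone_bound (cone_on_setT (rcone_on_cone rG)).
    rewrite (asboolT rG) mul1r big_seq_cond big1 ?addr0 // => m /andP[mr mm0].
    by rewrite fr ?mulr0.
  rewrite (lsum_cond _ ur) => [|m /rcone_on_cone/cone_on_setT cm]; last first.
    by apply: rP => k; apply: cone_bound cm.
  rewrite big_seq big1 // => m mr; have [->|mm0] := eqVneq m m0; last by rewrite fr ?mulr0.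
  rewrite asboolF ?mul0r // => rF; case/eqP: FG; exact: (rcone_on_unique fF fG rF rG).
have pf' := polyfun_opp pf.
have ff : (fun m => f (- - m)) = f by apply/funext => m; rewrite opprK.
(* The two sign changes in the argument of the weight cancel, so both sides involve [f] itself. *)
have E : e f H = (-1) ^+ (rk q H).-1 *:
    \sum_(F : {set I} | `[< cface q F >] && ((F != set0) && (F \subset H)))
      (-1) ^+ (rk q F).-1 *:
       \sum_(K : {set I} | `[< cface q K >] && ((K != set0) && (K \subset F))) e f K.
  have -> : e f H = (e f H \Po (- 'X)) \Po (- 'X).
    by rewrite -comp_polyA linearN /= comp_polyX opprK comp_polyXr.
  rewrite e2 // linearZ linear_sum /=; congr (_ *: _).
  by apply: eq_bigr => F /and3P[/asboolP fF F0 _]; rewrite e2 // ff.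
have := congr1 (fun p : {poly C} => p.[l%:R]) E.
rewrite ef //; have -> : (H == G) = false by apply/negbTE; rewrite eq_sym proper_neq.
rewrite hornerZ horner_sum => /esym/eqP; rewrite mulf_eq0 signr_eq0 /= => /eqP E'.
apply/eqP; rewrite -(eqr_int C) rmorph_sum /=; apply/eqP.
transitivity (- (f m0)^-1 * 0 : C); last by rewrite mulr0.
rewrite -[X in _ = _ * X]E' mulr_sumr.
rewrite [LHS]big_mkcond [RHS]big_mkcond; apply: eq_bigr => F _.
case: asboolP => //= fF; have [F0|F0] := eqVneq F set0.
  by rewrite F0 subset0 (negbTE G0).
have [FH|FH] := boolP (F \subset H); rewrite ?andbF // !andbT /=.
rewrite hornerZ horner_sum.
(* At height [l], the interior of [G] is the only one that contains the isolated point. *)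
have -> : \sum_(K : {set I} | `[< cface q K >] && ((K != set0) && (K \subset F))) (e f K).[l%:R]
    = if G \subset F then f m0 else 0.
  case: ifP => GF.
    rewrite (bigD1 G) ?asboolT ?G0 //= ef // eqxx big1 ?addr0 //.
    by move=> K /andP[/and3P[/asboolP fK K0 _] /negbTE KG]; rewrite ef // KG.
  rewrite big1 // => K /and3P[/asboolP fK K0 KF]; rewrite ef //.
  by case: eqP => // KG; rewrite KG GF in KF.
case: ifP => _; last by rewrite !mulr0.
rewrite mulNr [_ * f m0]mulrC mulKf // -[in LHS](prednK (rk_gt0 F0)) exprS mulN1r.
by rewrite rmorphN rmorphXn rmorphN1.
Qed.

End EhrhartFaces.

(** * Faces of a convex hull *)

Section Hull.
Import mathcomp.boot.fintype mathcomp.boot.finset.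
Variables (R : realType) (E : vectType R) (I : finType) (p : I -> E).
Implicit Types (c : {ffun I -> R^o}) (F J K : {set I}) (u : 'Hom(E, R^o)).

Definition homogenize (i : I) : (E * R^o)%type := (p i, 1).

Lemma comb_homog c : comb homogenize c = (comb p c, \sum_i (c i : R)).
Proof.
rewrite [LHS]surjective_pairing; congr (_, _).
  by rewrite /comb (raddf_sum (fst : (E * R^o)%type -> _)); apply: eq_bigr.
rewrite /comb (raddf_sum (snd : (E * R^o)%type -> _)); apply: eq_bigr => i _ /=.
by rewrite -[_ *: _]/(c i * 1) mulr1.
Qed.

Definition ht : 'Hom((E * R^o)%type, R^o) := linfun (snd : (E * R^o)%type -> R^o).

Lemma ht_homog i : ht (homogenize i) = 1.
Proof. by rewrite lfunE. Qed.

Definition hull F : set E := [set z | cone_on homogenize F (z, 1)]%classic.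

Lemma hullP F z : hull F z <-> exists c,
  [/\ forall i, 0 <= c i, supp c \subset F, \sum_i (c i : R) = 1 & comb p c = z].
Proof.
split=> -[c]; first by case=> c0 sc; rewrite comb_homog => -[cz c1]; exists c.
by case=> c0 sc c1 cz; exists c; split=> //; rewrite comb_homog cz c1.
Qed.

Lemma hull_gen F i : i \in F -> hull F (p i).
Proof.
move=> iF; apply/hullP; exists [ffun j => (j == i)%:R]; split.
- by move=> j; rewrite ffunE ler0n.
- by apply/supp_subP => j jF; rewrite ffunE; case: eqP => // ji; rewrite ji iF in jF.
- by rewrite (bigD1 i) //= ffunE eqxx big1 ?addr0 // => j /negbTE ji; rewrite ffunE ji.
rewrite /comb (bigD1 i) //= ffunE eqxx scale1r big1 ?addr0 // => j /negbTE ji.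
by rewrite ffunE ji scale0r.
Qed.

Lemma hull_eq0 F : hull F = classical_sets.set0 <-> F = set0.
Proof.
split=> [H|->].
  apply/setP => i; rewrite inE; apply/negP => /hull_gen; rewrite H; exact.
apply/predeqP => z; split=> // /hullP[c [_ /supp_subP sc c1 _]].
move/eqP: c1; rewrite big1 => [|i _]; last by rewrite sc ?inE.
by rewrite eq_sym oner_eq0.
Qed.

Lemma lin_le_hull u (b : R) J z : (forall i, i \in J -> u (p i) <= b) -> hull J z -> u z <= b.
Proof.
move=> ub /hullP[c [c0 sc c1 <-]]; rewrite lfun_comb -[b]mul1r -c1 mulr_suml.
apply: ler_sum => i _; have [/ub le|iJ] := boolP (i \in J); first by apply: (@ler_wpM2l R (c i) (c0 i)); exact: le.
by move/supp_subP: sc => -> //; rewrite !mul0r.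
Qed.

Lemma face_hull_set u (b : R) J : (forall i, i \in J -> u (p i) <= b) ->
  [set z | hull J z /\ u z = b]%classic = hull [set i in J | u (p i) == b].
Proof.
move=> ub; apply/predeqP => z; split=> [[]|].
  case/hullP=> c [c0 sc c1 cz] uz; apply/hullP; exists c; split=> //.
  have : \sum_i (c i : R) * (b - u (p i)) = 0.
    under eq_bigr do rewrite mulrBr.
    by rewrite sumrB -mulr_suml c1 mul1r -lfun_comb cz uz subrr.
  move/eqP; rewrite psumr_eq0 => [/allP H|i _]; last first.
    have [/ub le|iJ] := boolP (i \in J); first by rewrite mulr_ge0 ?c0 ?subr_ge0.
    by move/supp_subP: sc => -> //; rewrite mul0r.
  apply/subsetP => i; rewrite !inE => ci.
  have -> : i \in J by apply: (subsetP sc); rewrite inE.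
  have := H i; rewrite mem_index_enum => /(_ isT) /=.
  by rewrite mulf_eq0 (negbTE ci) /= subr_eq0 eq_sym.
move=> /hullP[c [c0 sc c1 cz]]; split.
  apply/hullP; exists c; split=> //; apply: subset_trans sc _.
  by apply/subsetP => i; rewrite inE => /andP[].
rewrite -cz lfun_comb -[b]mul1r -c1 mulr_suml; apply: eq_bigr => i _.
have [|/(supp_subP _ _ sc) ->] := boolP (i \in [set i in J | u (p i) == b]); last by rewrite !mul0r.
by rewrite inE => /andP[_ /eqP ->].
Qed.

Lemma face_hullP J S : face (hull J) S <-> exists u (b : R),
  (forall i, i \in J -> u (p i) <= b) /\ S = hull [set i in J | u (p i) == b].
Proof.
split=> -[u [b [ub ->]]]; exists u, b.
  have ub' i : i \in J -> u (p i) <= b by move=> /hull_gen/ub.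
  by split=> //; apply: face_hull_set.
by split=> [x|]; [exact: lin_le_hull | rewrite face_hull_set].
Qed.

Lemma pair0_lfun : exists g : 'Hom(E, (E * R^o)%type), forall x, g x = (x, 0).
Proof.
apply: linear_lfun => a x y.
by rewrite -[in LHS](addr0 (0 : R^o)) -[X in (_, X + _)](scaler0 _ a).
Qed.

Lemma cfaceP F : cface homogenize F <-> exists u (b : R),
  (forall i, u (p i) <= b) /\ F = [set i | u (p i) == b].
Proof.
split=> [[l [l0 lF]]|[u [b [ub ->]]]].
  have [g gE] := pair0_lfun.
  have lE i : l (homogenize i) = l (g (p i)) + l (0, 1).
    by rewrite -linearD gE; congr (l _); congr (_, _); rewrite ?addr0 ?add0r.
  exists (- (l \o g)%VF), (l (0, 1)).
  have uE i : (- (l \o g)%VF) (p i) = - l (g (p i)).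
    by rewrite opp_lfunE comp_lfunE.
  split=> [i|]; first by rewrite uE -subr_ge0 opprK addrC -lE l0.
  by apply/setP => i; rewrite lF inE uE lE eqr_oppLR eq_sym -addr_eq0 addrC eq_sym.
pose l := b *: ht - (u \o linfun (fst : (E * R^o)%type -> E))%VF.
have lE i : l (homogenize i) = b - u (p i).
  rewrite add_lfunE opp_lfunE scale_lfunE ht_homog comp_lfunE lfunE /=.
  by rewrite -[b *: 1]/(b * 1) mulr1.
exists l; split=> i; rewrite lE ?subr_ge0 ?ub //.
by rewrite inE subr_eq0 eq_sym.
Qed.

Lemma face_hullT S : face (hull setT) S <-> exists2 K, cface homogenize K & S = hull K.
Proof.
split=> [/face_hullP[u [b [ub ->]]]|[K /cfaceP[u [b [ub ->]]] ->]].
  exists [set i in [set: I] | u (p i) == b] => //; apply/cfaceP; exists u, b.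
  by split=> [i|]; [exact: ub | apply/setP => i; rewrite !inE].
apply/face_hullP; exists u, b; split=> [i _|]; first exact: ub.
by congr hull; apply/setP => i; rewrite !inE.
Qed.

(** Redundant generators may give different index sets the same hull, but the index set of a face
    consists of all the generators on it. *)
Lemma hull_inj K K' : cface homogenize K -> cface homogenize K' -> hull K = hull K' -> K = K'.
Proof.
have sub F F' : cface homogenize F' -> hull F = hull F' -> F \subset F'.
  move=> cF' FF; apply/subsetP => i iF.
  have /cfaceP[u [b [ub FE]]] := cF'; rewrite FE inE.
  have := hull_gen iF; rewrite FF => /hullP[c [c0 sc c1 <-]].
  rewrite lfun_comb -[X in _ == X]mul1r -c1 mulr_suml; apply/eqP/eq_bigr => j _.
  have [|/(supp_subP _ _ sc) ->] := boolP (j \in F'); last by rewrite !mul0r.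
  by rewrite FE inE => /eqP ->.
move=> cK cK' KK; apply/eqP; rewrite eqEsubset.
by rewrite (sub K K') // (sub K' K).
Qed.

(** Off [K], a large multiple of the functional that cuts out [K] outweighs the functional that cuts
    out the smaller face. *)
Lemma face_hull_trans K S : cface homogenize K -> face (hull K) S -> face (hull setT) S.
Proof.
move=> /cfaceP[u [b [ub KE]]] /face_hullP[w [d [wd ->]]].
(* For [i] in [K] the summand is a division by zero, hence 0. *)
pose N : R := 1 + \sum_i `|(w (p i) - d) / (b - u (p i))|.
have N0 : 0 < N by rewrite ltr_pwDl // sumr_ge0.
have fE i : (N *: u + w) (p i) = N * u (p i) + w (p i).
  by rewrite add_lfunE scale_lfunE.
have key i : i \notin K -> N * u (p i) + w (p i) < N * b + d.
  rewrite KE inE => ne.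
  have ui : 0 < b - u (p i) by rewrite subr_gt0 lt_neqAle ne ub.
  rewrite -subr_gt0.
  have -> : N * b + d - (N * u (p i) + w (p i)) = N * (b - u (p i)) - (w (p i) - d) by ring.
  rewrite subr_gt0 -ltr_pdivrMr //; apply: le_lt_trans (ler_norm _) _.
  rewrite /N (bigD1 i) //= addrCA ltrDl ltr_pwDl // sumr_ge0 //.
apply/face_hullP; exists (N *: u + w), (N * b + d); split=> [i _|].
  rewrite fE; have [iK|/key/ltW//] := boolP (i \in K).
  apply: lerD; first by apply: (@ler_wpM2l R N (ltW N0)); exact: ub.
  exact: wd.
congr hull; apply/setP => i; rewrite !inE fE /=.
have [iK|iK] := boolP (i \in K); last by rewrite [RHS]lt_eqF ?key.
by move: iK; rewrite KE inE => /eqP ->; rewrite (inj_eq (addrI _)).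
Qed.

Lemma span_hull_diff K i0 : i0 \in K ->
  span_set [set x - y | x in hull K & y in hull K]%classic
   = <<[seq p i - p i0 | i <- enum K]>>%VS.
Proof.
move=> iK; apply: is_span_unique (span_setP _) _; split=> [x|W SW]; last first.
  apply/span_subvP => x /mapP[j]; rewrite mem_enum => jK ->.
  by apply: SW; exists (p j); [exact: hull_gen | exists (p i0) => //; exact: hull_gen].
case=> y /hullP[c [_ /supp_subP sc c1 cy]] [z /hullP[d [_ /supp_subP sd d1 dz]] <-].
have -> : y - z = \sum_i (c i - d i) *: (p i - p i0).
  under eq_bigr do rewrite scalerBr.
  rewrite sumrB -scaler_suml sumrB c1 d1 subrr scale0r subr0 -cy -dz -sumrB.
  by apply: eq_bigr => i _; rewrite scalerBl.
apply: memv_suml => i _; have [iK'|iK'] := boolP (i \in K).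
  by rewrite memvZ // memv_span //; apply: (map_f (fun i => p i - p i0)); rewrite mem_enum.
by rewrite sc // sd // subrr scale0r mem0v.
Qed.

Lemma rk_homog K i0 : i0 \in K ->
  rk homogenize K = (\dim <<[seq p i - p i0 | i <- enum K]>>).+1.
Proof.
move=> iK; rewrite (rk_diff (fun i _ => ht_homog i) iK); congr _.+1.
have [g gE] := pair0_lfun.
have -> : [seq homogenize i - homogenize i0 | i <- enum K]
    = [seq g x | x <- [seq p i - p i0 | i <- enum K]].
  rewrite -map_comp; apply: eq_map => j; rewrite /= gE.
  by congr (_, _); rewrite /= subrr.
rewrite -limg_span limg_dim_eq //; apply/eqP; rewrite -subv0; apply/subvP => x.
by rewrite memv_cap memv_ker gE => /andP[_ /eqP[->]]; rewrite mem0v.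
Qed.

Lemma affdim_hull K : affdim (hull K) = (rk homogenize K)%:Z - 1.
Proof.
rewrite /affdim; case: asboolP => [/hull_eq0 ->|/hull_eq0/eqP/set0Pn[i0 iK]].
  by rewrite /rk /qspan enum_set0 span_nil dimv0.
by rewrite (span_hull_diff iK) (rk_homog iK) -addn1 PoszD addrK.
Qed.

End Hull.

(** * Relative interiors in barycentric coordinates *)

Section HullCoordinates.
Import mathcomp.boot.fintype mathcomp.boot.finset.
Variables (R : realType) (n : nat) (I : finType) (x : I -> 'rV[R]_n).
Implicit Types (c : {ffun I -> R^o}) (F J K : {set I}).

Lemma conv_hull_family : conv_hull (range x) = hull x setT.
Proof.
apply/predeqP => z; split=> [[k [y [c [yS c0 c1 ->]]]]|/hullP[c [c0 _ c1 <-]]].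
  have /choice[g gP] (j : 'I_k) : exists i, x i = y j by have [i _ <-] := yS j; exists i.
  apply/hullP; exists [ffun i => \sum_(j | g j == i) c j]; split.
  - by move=> i; rewrite ffunE sumr_ge0.
  - by apply/subsetP => i; rewrite inE.
  - rewrite -c1 (partition_big g xpredT) //=; apply: eq_bigr => i _.
    by rewrite ffunE.
  rewrite (partition_big g xpredT) //=; apply: eq_bigr => i _.
  rewrite ffunE scaler_suml; apply: eq_bigr => j /eqP <-.
  by rewrite gP.
exists #|I|, (fun j => x (enum_val j)), (fun j => c (enum_val j)); split.
- by move=> j; exists (enum_val j).
- by move=> j; exact: c0.
- by rewrite -c1 (reindex (@enum_val I I)) //; exists enum_rank => j _; rewrite ?enum_valK ?enum_rankK.
by rewrite /comb (reindex (@enum_val I I)) //; exists enum_rank => j _; rewrite ?enum_valK ?enum_rankK.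
Qed.

Lemma span_rep K i0 (s : seq I) y : i0 \in K -> {subset s <= K} ->
  y \in <<[seq x i - x i0 | i <- s]>>%VS ->
  exists a : {ffun I -> R^o}, [/\ supp a \subset K, \sum_i (a i : R) = 0 & comb x a = y].
Proof.
move=> iK; elim: s y => [|j s IH] y sK /=.
  rewrite span_nil memv0 => /eqP ->; exists 0; split; rewrite ?linear0 //.
    by apply/supp_subP => i _; rewrite ffunE.
  by rewrite big1 // => i _; rewrite ffunE.
have sK' : {subset s <= K} by move=> l ls; apply: sK; rewrite inE ls orbT.
rewrite span_cons => /memv_addP[_ /vlineP[k ->] [y' /(IH _ sK')[a [sa a0 ay]] ->]].
pose d (l : I) : {ffun I -> R^o} := [ffun i => (i == l)%:R].
have dE l : comb x (d l) = x l.
  rewrite /comb (bigD1 l) //= ffunE eqxx scale1r big1 ?addr0 // => i /negbTE il.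
  by rewrite ffunE il scale0r.
have dS l : \sum_i (d l i : R) = 1.
  by rewrite (bigD1 l) //= ffunE eqxx big1 ?addr0 // => i /negbTE il; rewrite ffunE il.
have dK l : l \in K -> supp (d l) \subset K.
  move=> lK; apply/supp_subP => i iK'; rewrite ffunE; case: eqP => // il.
  by rewrite il lK in iK'.
have jK : j \in K by apply: sK; rewrite mem_head.
exists (k *: (d j - d i0) + a); split.
- by rewrite supp_lin // addrC -scaleN1r supp_lin ?dK.
- rewrite (eq_bigr (fun i => k * ((d j i : R) - d i0 i) + a i)) => [|i _]; last by rewrite !ffunE.
  by rewrite big_split /= a0 addr0 -mulr_sumr sumrB !dS subrr mulr0.
by rewrite linearP /= ay linearB /= !dE.
Qed.

Lemma aff_hull_diff K i0 y z : i0 \in K -> hull x K z -> aff_hull (hull x K) y ->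
  y - z \in <<[seq x i - x i0 | i <- enum K]>>%VS.
Proof.
move=> iK hz [k [w [c [hw c1 ->]]]].
have -> : \sum_i c i *: w i - z = \sum_i c i *: (w i - z).
  by under [RHS]eq_bigr do rewrite scalerBr; rewrite sumrB -scaler_suml c1 scale1r.
apply: memv_suml => i _; rewrite memvZ // -(span_hull_diff _ iK).
by have [H _] := span_setP [set x - y | x in hull x K & y in hull x K]%classic; apply: H; exists (w i) => //; exists z.
Qed.

(** A point of the relative interior can be pushed away from the barycentre of the generators and
    remain in the hull; mixing the barycentre back in makes all coefficients positive. Conversely,
    positive coefficients absorb the change caused by a small move in the affine hull. *)
Lemma relint_hull K z : K != set0 -> relint (hull x K) z <-> rcone_on (homogenize x) K (z, 1).
Proof.
move=> /set0Pn[i0 iK]; split=> [[hz [e e0 eP]]|[c [c0 sc cz]]].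
  pose N : R := #|K|%:R; have N0 : 0 < N by rewrite ltr0n; apply/card_gt0P; exists i0.
  pose mu : {ffun I -> R^o} := [ffun i => if i \in K then N^-1 else 0].
  have hw : hull x K (comb x mu).
    apply/hullP; exists mu; split=> //.
    - by move=> i; rewrite ffunE; case: ifP => // _; rewrite invr_ge0 ltW.
    - by apply/supp_subP => i /negbTE iK'; rewrite ffunE iK'.
    under eq_bigr do rewrite ffunE.
    by rewrite -big_mkcond sumr_const -mulr_natr mulVf // gt_eqF.
  set w := comb x mu in hw.
  (* With [t = e / S], all coordinates of [t *: (z - w)] are less than [e] in absolute value. *)
  pose S : R := 1 + \sum_m `|z 0 m - w 0 m|.
  have S0 : 0 < S by rewrite ltr_pwDl // sumr_ge0.
  pose t := e / S; have t0 : 0 < t by rewrite divr_gt0.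
  have /hullP[c [c0 sc c1 cz]] : hull x K (z + t *: (z - w)).
    apply: eP => [|m].
      exists 2%N, (fun j => if j == 0 then z else w), (fun j => if j == 0 then 1 + t else - t); split.
      - by move=> j; case: ifP.
      - by rewrite big_ord_recl big_ord1 /= addrK.
      rewrite big_ord_recl big_ord1 /= scalerBr scalerDl scale1r scaleNr.
      by rewrite addrA.
    rewrite !mxE addrAC subrr add0r normrM gtr0_norm // mulrC /t mulrA ltr_pdivrMr //.
    rewrite mulrC ltr_pM2l // /S (bigD1 m) //= addrCA ltrDl ltr_pwDl // sumr_ge0 //.
  have t1 : 0 < 1 + t by rewrite ltr_pwDl // ltW.
  exists ((1 + t)^-1 *: (t *: mu + c)); split.
  - move=> i; rewrite !ffunE mulr_ge0 ?invr_ge0 ?(ltW t1) // addr_ge0 //.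
    by rewrite mulr_ge0 ?(ltW t0) //; case: ifP => // _; rewrite invr_ge0 ltW.
  - apply/setP => i; rewrite inE !ffunE; case: ifP => iK'.
      rewrite gt_eqF // mulr_gt0 ?invr_gt0 // ltr_pwDl //.
      by rewrite mulr_gt0 // invr_gt0.
    by move/supp_subP: sc => ->; rewrite ?iK' // scaler0 addr0 scaler0 eqxx.
  have musum : \sum_i (mu i : R) = 1.
    under eq_bigr do rewrite ffunE.
    by rewrite -big_mkcond sumr_const -mulr_natr mulVf // gt_eqF.
  rewrite linearZ linearP /= !comb_homog c1 musum cz -/w.
  congr (_, _).
    rewrite /= scalerBr addrCA [t *: w + _]addrC subrK.
    by rewrite -[X in _ *: (X + _)]scale1r -scalerDl scalerA mulVf ?scale1r // gt_eqF.
  by rewrite /= -[_ *: _]/((1 + t)^-1 * (t * 1 + 1)) mulr1 [t + 1]addrC mulVf // gt_eqF.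
have hz : hull x K z by exists c; rewrite sc.
split=> //.
pose D := <<[seq x i - x i0 | i <- enum K]>>%VS; pose b := vbasis D.
have /choice[a aP] (k : 'I_(\dim D)) : exists a : {ffun I -> R^o},
    [/\ supp a \subset K, \sum_i (a i : R) = 0 & comb x a = b`_k].
  apply: (@span_rep K i0 (enum K) _ iK) => [i|]; first by rewrite mem_enum.
  by apply: vbasis_mem; rewrite mem_nth ?size_tuple.
(* [B k] bounds the coordinate functional in terms of the sup norm, so [Q i] controls the change of
   the [i]-th coefficient. *)
pose B (k : 'I_(\dim D)) : R := \sum_m `|coord b k (delta_mx 0 m)|.
have Bk e k (y : 'rV[R]_n) : 0 < e -> (forall m, `|y 0 m| < e) -> `|coord b k y| <= e * B k.
  move=> e0 ye; rewrite [y]row_sum_delta linear_sum /B mulr_sumr.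
  apply: le_trans (ler_norm_sum _ _ _) _; apply: ler_sum => m _.
  by rewrite linearZ normrM ler_wpM2r // ltW.
pose Q i : R := \sum_k B k * `|a k i|.
have Q0 i : 0 <= Q i.
  by apply: sumr_ge0 => k _; rewrite mulr_ge0 // sumr_ge0.
pose S : R := 1 + \sum_(i in K) Q i / c i.
have cp i : i \in K -> 0 < c i.
  by move=> iK'; rewrite lt_neqAle c0 eq_sym andbT; have /setP/(_ i) := sc; rewrite inE iK'.
have S0 : 0 < S.
  by rewrite ltr_pwDl // sumr_ge0 // => i iK'; rewrite divr_ge0 // ltW // cp.
exists S^-1; first by rewrite invr_gt0.
move=> y ay yz; have yD := aff_hull_diff iK hz ay.
pose g : {ffun I -> R^o} := \sum_k coord b k (y - z) *: a k.
have sg : supp g \subset K.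
  apply: (big_ind (fun u : {ffun I -> R^o} => supp u \subset K)) => [|u v su sv|k _].
  - by apply/supp_subP => i _; rewrite ffunE.
  - by rewrite -[u]scale1r supp_lin.
  rewrite -[_ *: _]addr0 supp_lin //; first by have [] := aP k.
  by apply/supp_subP => i _; rewrite ffunE.
have g0 : \sum_i (g i : R) = 0.
  rewrite (eq_bigr (fun i => \sum_k coord b k (y - z) * (a k i : R))) => [|i _].
    rewrite exchange_big big1 //= => k _; rewrite -mulr_sumr.
    by have [_ -> _] := aP k; rewrite mulr0.
  by rewrite sum_ffunE; apply: eq_bigr => k _; rewrite ffunE.
have gE : comb x g = y - z.
  rewrite linear_sum [RHS](coord_vbasis yD); apply: eq_bigr => k _.
  by rewrite linearZ /=; have [_ _ ->] := aP k.
exists (c + g); split.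
- move=> i; rewrite ffunE; have [iK'|iK'] := boolP (i \in K); last first.
    by rewrite (supp_subP _ _ sg) // addr0; exact: c0.
  rewrite -[g i]opprK subr_ge0; apply: le_trans (ler_norm (- g i : R)) _; rewrite normrN.
  have : `|(g i : R)| <= S^-1 * Q i.
    rewrite sum_ffunE /Q mulr_sumr; apply: le_trans (ler_norm_sum _ _ _) _.
    apply: ler_sum => k _; rewrite ffunE normrM mulrA ler_wpM2r //.
    apply: Bk; first by rewrite invr_gt0.
    by move=> m; have := yz m; rewrite !mxE.
  move/le_trans; apply; rewrite mulrC ler_pdivrMr // -ler_pdivrMl ?cp // mulrC.
  by rewrite /S (bigD1 i) //= addrCA lerDl ltW // ltr_pwDl // sumr_ge0 // => l /andP[lK _]; rewrite divr_ge0 // ltW // cp.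
- by rewrite -[c]scale1r supp_lin ?sc.
move: cz; rewrite linearD /= !comb_homog gE g0 => -[cz c1].
by congr (_, _); rewrite /= ?cz ?c1 ?addr0 // addrC subrK.
Qed.

End HullCoordinates.

(** * Faces of the polar polytope *)

(** Turns the sums over sets of faces in the definitions into sums over index sets. *)
Lemma fsum_image (A : nmodType) (T : choiceType) (K : finType) (P : pred K) (h : K -> T)
    (S : T -> Prop) (F : T -> A) :
  {in P &, injective h} -> (forall t, S t <-> exists2 k, P k & t = h k) ->
  \sum_(t \in [set t | S t]%classic) F t = \sum_(k | P k) F (h k).
Proof.
move=> hinj SP; rewrite -big_enum -[RHS](big_map h xpredT F) [RHS]fsbig_seq.
  apply: eq_fsbigl; apply/predeqP => t; rewrite /= SP; split.
    by case=> k Pk ->; rewrite map_f // mem_enum.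
  by case/mapP => k; rewrite mem_enum => Pk ->; exists k.
rewrite map_inj_in_uniq ?enum_uniq // => k k'; rewrite !mem_enum; exact: hinj.
Qed.

Section Dual.
Import mathcomp.boot.fintype mathcomp.boot.finset.
Variables (R : realType) (E : vectType R) (I : finType) (p : I -> E).
Hypothesis p_interior : rcone_on (homogenize p) setT (0, 1).
Hypothesis p_span : <<codom p>>%VS = fullv.
Implicit Types (G K : {set I}) (v : 'Hom(E, R^o)).
Notation face_index K := (cface (homogenize p) K).

Definition dface K : set 'Hom(E, R^o) := polar_face (hull p setT) (hull p K).

Lemma dfaceE K v : dface K v <->
  (forall i, -1 <= v (p i)) /\ forall i, i \in K -> v (p i) = -1.
Proof.
split=> [[vS vK]|[vS vK]].
  have vS' w : hull p setT w -> -1 <= v w := vS w.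
  split=> i; first by apply/vS'/hull_gen; rewrite inE.
  by move=> iK; apply/vK/hull_gen.
have vcomb (c : {ffun I -> R^o}) : v (comb p c) = \sum_i (c i : R) * (v (p i) : R).
  exact: lfun_comb.
have sumN1 (c : {ffun I -> R^o}) : \sum_i (c i : R) = 1 -> -1 = \sum_i (c i : R) * -1.
  by move=> c1; rewrite -mulr_suml c1 mul1r.
split=> [w|w] /hullP[c [c0 sc /sumN1 c1 <-]]; rewrite vcomb [-1]c1.
  by apply: ler_sum => i _; apply: (@ler_wpM2l R (c i) (c0 i)); exact: vS.
apply: eq_bigr => i _; have [/vK ->//|/(supp_subP _ _ sc) ->] := boolP (i \in K).
by rewrite !mul0r.
Qed.

Lemma interior_coef : exists c : {ffun I -> R^o},
  [/\ forall i, 0 < c i, \sum_i (c i : R) = 1 & comb p c = 0].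
Proof.
have [c [c0 sc]] := p_interior; rewrite comb_homog => -[cz c1]; exists c; split=> // i.
by rewrite lt_neqAle eq_sym c0 andbT; have /setP/(_ i) := sc; rewrite !inE.
Qed.

Lemma dface_setT : dface setT = classical_sets.set0.
Proof.
apply/predeqP => v; split=> // /dfaceE[_ v1].
have [c [c0 c1 cz]] := interior_coef.
have := congr1 v cz; rewrite lfun_comb linear0.
rewrite (eq_bigr (fun i => (c i : R) * -1)) => [|i _]; last by rewrite v1 // inE.
by rewrite -mulr_suml c1 mul1r => /eqP; rewrite oppr_eq0 oner_eq0.
Qed.

(** As the origin is interior, a functional that cuts out a proper face has a positive maximum [b];
    scaling it by [- b^-1] gives a point in the relative interior of the dual face. *)
Lemma dface_strict K : face_index K -> K != setT ->
  exists2 v, dface K v & forall i, i \notin K -> -1 < v (p i).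
Proof.
move=> /cfaceP[u [b [ub KE]]] KT.
have [c [c0 c1 cz]] := interior_coef.
have E0 : \sum_i (c i : R) * (b - u (p i)) = b.
  under eq_bigr do rewrite mulrBr.
  by rewrite sumrB -mulr_suml c1 mul1r -lfun_comb cz linear0 subr0.
have b0 : 0 < b.
  have [i iK] : exists i, i \notin K.
    by apply/existsP; rewrite -negb_forall; apply: contra KT => /forallP H; apply/eqP/setP => i; rewrite H inE.
  rewrite -E0 (bigD1 i) //= ltr_pwDl //.
    by rewrite mulr_gt0 ?c0 // subr_gt0 lt_neqAle ub andbT; move: iK; rewrite KE inE.
  by rewrite sumr_ge0 // => j _; rewrite mulr_ge0 ?subr_ge0 ?ub //; apply/ltW/c0.
have vE i : ((- b^-1) *: u) (p i) = - (u (p i) / b) by rewrite scale_lfunE -[_ *: _]/(- b^-1 * u (p i)) mulNr mulrC.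
exists ((- b^-1) *: u).
  apply/dfaceE; split=> i; rewrite vE.
    by rewrite lerN2 ler_pdivrMr // mul1r ub.
  by rewrite KE inE => /eqP ->; rewrite divff ?gt_eqF.
move=> i; rewrite KE inE vE => ne.
by rewrite ltrN2 ltr_pdivrMr // mul1r lt_neqAle ne ub.
Qed.

Lemma dface_sub K K' : face_index K -> dface K = dface K' -> K' \subset K.
Proof.
move=> fK KK; have [->|KT] := eqVneq K setT; first exact: subsetT.
have [v vK vs] := dface_strict fK KT; move: vK; rewrite KK => /dfaceE[_ vK'].
apply/subsetP => i iK'; apply: contraT => /vs; by rewrite vK' // ltxx.
Qed.

Lemma dface_inj K K' : face_index K -> face_index K' -> dface K = dface K' -> K = K'.
Proof.
move=> fK fK' KK; apply/eqP; rewrite eqEsubset.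
by rewrite (dface_sub fK' (esym KK)) (dface_sub fK KK).
Qed.

Lemma small_step (a b : I -> R) (P : pred I) : (forall i, P i -> 0 < a i) ->
  exists2 e : R, 0 < e & forall i, P i -> e * `|b i| <= a i.
Proof.
move=> a0; have S0 : 0 <= \sum_(i | P i) `|b i| / a i.
  by apply: sumr_ge0 => i Pi; rewrite divr_ge0 // ltW // a0.
exists (1 + \sum_(i | P i) `|b i| / a i)^-1; first by rewrite invr_gt0 ltr_pwDl.
move=> i Pi; rewrite mulrC ler_pdivrMr ?ltr_pwDl // -ler_pdivrMl ?a0 // mulrC.
rewrite (bigD1 i) //= addrCA lerDl ltW // ltr_pwDl // sumr_ge0 // => j /andP[Pj _].
by rewrite divr_ge0 // ltW // a0.
Qed.

(** Biduality: faces of the polar are cut out by evaluations at vectors of [E]. *)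
Lemma eval_functional (f : 'Hom('Hom(E, R^o), R^o)) : exists z : E, forall v, f v = v z.
Proof.
pose b := vbasis {:E}; pose r i : 'Hom(E, R^o) := linfun (coord b i : E -> R^o).
exists (\sum_(i < \dim {:E}) f (r i) *: b`_i) => v.
have {1}-> : v = \sum_(i < \dim {:E}) v b`_i *: r i.
  apply/lfunP => x; rewrite {1}(coord_vbasis (memvf x)) sum_lfunE linear_sum.
  apply: eq_bigr => i _; rewrite linearZ scale_lfunE lfunE /=.
  by rewrite -[LHS]/(_ * _) -[RHS]/(_ * _) mulrC.
rewrite !linear_sum; apply: eq_bigr => i _; rewrite !linearZ /=.
by rewrite -[LHS]/(_ * _) -[RHS]/(_ * _) mulrC.
Qed.

(* A face of [dface G] contains, by averaging, a functional [v0] which is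
   [> -1] at every generator where some member of the face is; any functional
   equal to [-1] wherever [v0] is lies in the face, since [v0] can be moved
   slightly away from it inside [dface G]. *)
Lemma face_dface G T : face_index G -> G != set0 ->
  face (dface G) T <-> exists2 K, face_index K & G \subset K /\ T = dface K.
Proof.
move=> fG G0; split=> [[f [b [fb ->]]]|[K fK [GK ->]]]; last first.
  (* On [dface G] the functional sending [v] to [- v z] is at most [#|K|], with equality exactly
     when [v] is -1 at every generator of [K]. *)
  pose z := \sum_(i in K) p i.
  have [phi phiE] : exists phi : 'Hom('Hom(E, R^o), R^o), forall v, phi v = - v z.
    apply: (@linear_lfun _ 'Hom(E, R^o) R^o (fun v => - v z)) => a v w.
    by rewrite add_lfunE scale_lfunE opprD scalerN.
  have zE v : v z = \sum_(i in K) (v (p i) : R) by rewrite linear_sum.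
  have phi0 v : #|K|%:R - phi v = \sum_(i in K) (v (p i) + 1) :> R.
    by rewrite phiE opprK zE big_split /= sumr_const addrC.
  exists phi, #|K|%:R; split=> [v /dfaceE[v1 _]|].
    rewrite -subr_ge0 phi0 sumr_ge0 // => i _.
    by rewrite -[1 : R]opprK subr_ge0.
  apply/predeqP => v; split=> [/dfaceE[v1 vK]|[/dfaceE[v1 vG] phiv]].
    split; first by apply/dfaceE; split=> // i /(subsetP GK)/vK.
    apply/eqP; rewrite eq_sym -subr_eq0 phi0 big1 // => i iK.
    by rewrite vK // addNr.
  apply/dfaceE; split=> // i iK.
  have /eqP := phi0 v; rewrite phiv subrr eq_sym psumr_eq0 => [/allP H|j _]; last first.
    by rewrite -[1 : R]opprK subr_ge0.
  have := H i; rewrite mem_index_enum iK /= => /(_ isT).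
  by rewrite addr_eq0 => /eqP.
set Tf := [set v | _]%classic.
case: (pselect (Tf = classical_sets.set0)) => [->|Tne].
  exists setT; last by rewrite subsetT dface_setT.
  by exists 0; split=> i; rewrite zero_lfunE // inE eqxx.
have [v1 v1T] : exists v, Tf v by apply: contrapT => H; apply: Tne; apply/predeqP => v; split=> // vT; apply: H; exists v.
have [z fz] := eval_functional f.
pose K := [set i | `[< forall v, Tf v -> v (p i) = -1 >]].
have GK : G \subset K.
  by apply/subsetP => i iG; rewrite inE; apply/asboolP => v [/dfaceE[_ H] _]; apply: H.
have [v0 v0T v0K] : exists2 v0, Tf v0 & forall i, i \notin K -> -1 < v0 (p i).
  have /choice[r rP] (i : I) : exists v, Tf v /\ (i \notin K -> -1 < v (p i)).
    have [iK|] := boolP (i \in K); first by exists v1.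
    rewrite inE => /asboolPn/existsNP[v /not_implyP[Tv vi]]; exists v; split=> // _.
    by have [/dfaceE[/(_ i) h _] _] := Tv; rewrite lt_neqAle eq_sym h andbT; apply/eqP.
  pose N : R := #|I|.+1%:R; have N0 : 0 < N by rewrite ltr0n.
  pose s := \sum_i r i + v1.
  have sE x : s x = \sum_i r i x + v1 x by rewrite add_lfunE sum_lfunE.
  have avg (t : R) (a : I -> R) (a1 : R) : N^-1 * (\sum_i a i + a1) - t = N^-1 * (\sum_i (a i - t) + (a1 - t)).
    rewrite sumrB sumr_const addrACA -opprD -mulrSr -mulr_natr mulrBr; congr (_ - _).
    by rewrite mulrCA mulVf ?mulr1 // gt_eqF.
  have sEv x : (N^-1 *: s) x = N^-1 * (\sum_i (r i x : R) + v1 x) by rewrite scale_lfunE sE.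
  have Nge i : 0 <= (v1 (p i) : R) - -1 by rewrite subr_ge0; have [/dfaceE[H _] _] := v1T.
  have Rge j i : 0 <= (r j (p i) : R) - -1 by rewrite subr_ge0; have [[/dfaceE[H _] _] _] := rP j.
  exists (N^-1 *: s).
    split.
      apply/dfaceE; split=> i.
        by rewrite -subr_ge0 sEv avg mulr_ge0 ?invr_ge0 ?(ltW N0) // addr_ge0 // sumr_ge0.
      move=> iG; apply/eqP; rewrite -subr_eq0 sEv avg; apply/eqP.
      rewrite big1 ?add0r => [|j _].
        by have [/dfaceE[_ H] _] := v1T; rewrite (H i iG) subrr mulr0.
      by have [[/dfaceE[_ H] _] _] := rP j; rewrite (H i iG) subrr.
    apply/eqP; rewrite -subr_eq0 fz sEv avg; apply/eqP.
    rewrite big1 ?add0r => [|j _].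
      by have [_] := v1T; rewrite fz => ->; rewrite subrr mulr0.
    by have [[_]] := rP j; rewrite fz => ->; rewrite subrr.
  move=> i iK; rewrite -subr_gt0 sEv avg mulr_gt0 ?invr_gt0 // ltr_wpDr //.
  rewrite (bigD1 i) //= ltr_pwDl ?sumr_ge0 // subr_gt0.
  by have [_ ->] := rP i.
have [/dfaceE[v0S v0G] v0b] := v0T.
exists K.
  apply/cfaceP; exists (- v0), 1; split=> [i|]; first by rewrite opp_lfunE lerNl.
  apply/setP => i; rewrite [RHS]inE opp_lfunE eqr_oppLR; apply/idP/eqP.
    by rewrite inE => /asboolP; apply.
  by move=> vi; apply: contraT => /v0K; rewrite vi ltxx.
split=> //; apply/predeqP => v; split=> [Tv|/dfaceE[vS vK]].
  apply/dfaceE; split=> [i|i]; first by have [/dfaceE[H _] _] := Tv.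
  by rewrite inE => /asboolP; apply.
have vG : dface G v by apply/dfaceE; split=> // i /(subsetP GK)/vK.
split=> //; apply/eqP; rewrite eq_le fb //=.
have aK i : i \notin K -> 0 < (v0 (p i) : R) + 1.
  by move=> /v0K; rewrite -subr_gt0 opprK.
have [e e0 eP] := small_step (fun i => (v0 (p i) : R) - v (p i)) aK.
have wE x : (v0 + e *: (v0 - v)) x = v0 x + e * (v0 x - v x).
  by rewrite add_lfunE scale_lfunE add_lfunE opp_lfunE.
have : f (v0 + e *: (v0 - v)) <= b.
  apply: fb; apply/dfaceE; split=> i; rewrite wE.
    have [iK|iK] := boolP (i \in K).
      have -> : v0 (p i) = -1 by move: iK; rewrite inE => /asboolP; apply.
      by rewrite vK // subrr mulr0 addr0.
    have := eP i iK; rewrite -{1}(gtr0_norm e0) -normrM ler_norml => /andP[h _].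
    have h' : 0 <= (v0 (p i) : R) + 1 + e * (v0 (p i) - v (p i)).
      by rewrite -[X in _ + X]opprK subr_ge0 lerNl.
    by rewrite -subr_ge0 opprK addrAC.
  move=> iG; rewrite v0G // (vK i) ?(subsetP GK) // subrr mulr0 addr0 //.
rewrite fz wE -!fz v0b gerDl pmulr_rle0 // subr_le0 //.
Qed.

Lemma rk_setT : rk (homogenize p) setT = (dim E).+1.
Proof.
have [c [c0 c1 cz]] := interior_coef.
have [i0 _] : exists i0 : I, i0 \in setT.
  apply/set0Pn/eqP => I0; move: c1; rewrite big1 => [/eqP|i _].
    by rewrite eq_sym oner_eq0.
  by have := in_setT i; rewrite I0 inE.
rewrite (rk_homog p (in_setT i0)); congr _.+1; rewrite -dimvf; congr (\dim _).
set U := <<_>>%VS; apply/eqP; rewrite eqEsubv subvf /= -p_span.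
have dU i : p i - p i0 \in U.
  by rewrite memv_span //; apply: (map_f (fun i => p i - p i0)); rewrite mem_enum inE.
have p0 : p i0 \in U.
  rewrite -memvN; have -> : - p i0 = \sum_i c i *: (p i - p i0).
    under eq_bigr do rewrite scalerBr.
    by rewrite sumrB -scaler_suml c1 scale1r -[\sum_i _]/(comb p c) cz sub0r.
  by apply: memv_suml => i _; rewrite memvZ.
by apply/span_subvP => _ /codomP[i ->]; rewrite -(subrK (p i0) (p i)) memvD.
Qed.

Lemma rk_le K : (rk (homogenize p) K <= (dim E).+1)%N.
Proof. by rewrite -rk_setT dimvS // qspanS // subsetT. Qed.

(** Rank-nullity for the restriction of functionals to the span of the [p i]; composing with
    [vsproj] extends every functional, so restriction is onto. *)
Lemma dim_annihilator K (N : {vspace 'Hom(E, R^o)}) :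
  (forall v, v \in N <-> forall i, i \in K -> v (p i) = 0) ->
  (\dim N + rk p K = dim E)%N.
Proof.
move=> NP; pose U := qspan p K.
have [res resE] : exists res : 'Hom('Hom(E, R^o), 'Hom(subvs_of U, R^o)),
    forall v, res v = (v \o linfun vsval)%VF.
  apply: linear_lfun => a v w; apply/lfunP => x.
  by rewrite comp_lfunE !add_lfunE !scale_lfunE !comp_lfunE.
have resEx v x : res v x = v (vsval x) by rewrite resE comp_lfunE lfunE.
have := limg_ker_dim res fullv; rewrite capfv dimvf.
have -> : lker res = N.
  apply/vspaceP => v; rewrite memv_ker; apply/eqP/idP => [v0|/NP vN].
    apply/NP => i iK; have pU : p i \in U by apply: mem_qspan.
    have := congr1 (fun g : 'Hom(subvs_of U, R^o) => g (vsproj U (p i))) v0.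
    by rewrite resEx vsprojK // zero_lfunE.
  apply/lfunP => x; rewrite resEx zero_lfunE.
  have : vsval x \in lker v.
    apply: subvP (subvsP x); apply: qspan_sub => i iK.
    by rewrite memv_ker vN.
  by rewrite memv_ker => /eqP.
have -> : limg res = fullv.
  apply/eqP; rewrite eqEsubv subvf /=; apply/subvP => w _.
  apply/memv_imgP; exists (w \o linfun (vsproj U))%VF; first exact: memvf.
  by apply/lfunP => x; rewrite resEx comp_lfunE [linfun _ _]lfunE /= vsvalK.
by rewrite dimvf => dE; rewrite -[dim E]muln1 -[rk p K]muln1.
Qed.

(** From a point of [dface K] that is strict off [K], one can move a little in every direction
    vanishing on the [p i] with [i] in [K], so the direction space is their annihilator. On a proper
    face [- v0] is constantly 1, hence homogenizing does not change the rank. *)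
Lemma affdim_dface K : face_index K -> K != set0 ->
  affdim (dface K) = (dim E)%:Z - (rk (homogenize p) K)%:Z.
Proof.
move=> fK /set0Pn[i0 iK]; have [->|KT] := eqVneq K setT.
  by rewrite dface_setT /affdim asboolT // rk_setT -addn1 PoszD opprD addrA subrr add0r.
have [v0 v0K v0s] := dface_strict fK KT; have [v0S v0e] := (dfaceE K v0).1 v0K.
rewrite /affdim asboolF => [|E0]; last by rewrite E0 in v0K.
have rkE : rk p K = rk (homogenize p) K.
  rewrite (rk_homog p iK) (@rk_diff _ _ _ p (- v0) K i0) // => i iK'.
  by rewrite opp_lfunE v0e // opprK.
set D := [set v - w | v in _ & w in _]%classic.
have DP := span_setP D.
have NP v : v \in span_set D <-> forall i, i \in K -> v (p i) = 0.
  split=> [vD i iK'|v0'].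
    have [g gE] : exists g : 'Hom('Hom(E, R^o), R^o), forall w, g w = w (p i).
      apply: (@linear_lfun _ 'Hom(E, R^o) R^o (fun w => w (p i))) => a w w'.
      by rewrite add_lfunE scale_lfunE.
    have : (span_set D <= lker g)%VS.
      apply: DP.2 => _ [w /dfaceE[_ wK] [w' /dfaceE[_ wK'] <-]].
      by rewrite memv_ker gE add_lfunE opp_lfunE wK // wK' // subrr.
    by move/subvP => /(_ v vD); rewrite memv_ker gE => /eqP.
  have aK i : i \notin K -> 0 < (v0 (p i) : R) + 1.
    by move=> /v0s; rewrite -subr_gt0 opprK.
  have [e e0 eP] := small_step (fun i => v (p i) : R) aK.
  have : e *: v \in span_set D.
    apply: DP.1; exists (v0 + e *: v); last by exists v0; rewrite // addrC addKr.
    apply/dfaceE; split=> i; rewrite add_lfunE scale_lfunE.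
      have [iK'|iK'] := boolP (i \in K); first by rewrite v0' // scaler0 addr0.
      have := eP i iK'; rewrite -{1}(gtr0_norm e0) -normrM ler_norml => /andP[h _].
      have h' : 0 <= (v0 (p i) : R) + 1 + e * v (p i).
        by rewrite -[X in _ + X]opprK subr_ge0 lerNl.
      by rewrite -subr_ge0 opprK addrAC.
    by move=> iK'; rewrite v0' // scaler0 addr0 v0e.
  move=> /(memvZ e^-1); rewrite scalerA mulVf ?scale1r //.
  by rewrite gt_eqF.
by rewrite -(dim_annihilator NP) rkE PoszD addrK.
Qed.

End Dual.

(** * Stanley's polynomials of the dual faces *)

Section StanleyDual.
Import mathcomp.boot.fintype mathcomp.boot.finset.
Variables (R : realType) (E : vectType R) (I : finType) (p : I -> E).
Hypothesis p_interior : rcone_on (homogenize p) setT (0, 1).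
Hypothesis p_span : <<codom p>>%VS = fullv.
Implicit Types (F G K : {set I}).
Notation face_index K := (cface (homogenize p) K).
Notation dface := (dface p).

Definition crk K : nat := (dim E).+1 - rk (homogenize p) K.

Lemma face_indexT : face_index setT.
Proof. by exists 0; split=> i; rewrite zero_lfunE // inE eqxx. Qed.

Lemma crk_lt G K : face_index G -> G \subset K -> K != G -> (crk K < crk G)%N.
Proof.
move=> fG GK KG; have := rk_le p_interior p_span K.
have : (rk (homogenize p) G < rk (homogenize p) K)%N by rewrite rk_lt // properEneq eq_sym KG.
by rewrite /crk; lia.
Qed.

Lemma crk_eq0 G : face_index G -> crk G = 0%N -> G = setT.
Proof.
move=> fG c0; apply/eqP; apply: contraT => GT.
by have := crk_lt fG (subsetT G); rewrite eq_sym c0 => /(_ GT).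
Qed.

Lemma affdim_crk K : face_index K -> K != set0 -> affdim (dface K) = (crk K)%:Z - 1.
Proof.
move=> fK K0; rewrite affdim_dface // /crk -subzn ?rk_le // -addn1 PoszD.
by rewrite addrAC addrK.
Qed.

Lemma dface_eq0 K : face_index K -> dface K = classical_sets.set0 <-> K = setT.
Proof.
move=> fK; split=> [K0|->]; last exact: dface_setT.
apply: (dface_inj p_interior fK face_indexT).
by rewrite K0 dface_setT.
Qed.

Lemma sum_dface G (A : nmodType) (f : set 'Hom(E, R^o) -> A) :
  face_index G -> G != set0 ->
  \sum_(T \in [set T | face (dface G) T /\ T <> dface G]%classic) f T =
  \sum_(K : {set I} | [&& `[< face_index K >], G \subset K & K != G]) f (dface K).
Proof.
move=> fG G0; apply: fsum_image => [K K' /and3P[/asboolP fK _ _] /and3P[/asboolP fK' _ _]|T].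
  exact: dface_inj.
split=> [[/(face_dface p_interior T fG G0)[K fK [GK ->]] TG]|[K /and3P[/asboolP fK GK KG] ->]].
  exists K => //; rewrite asboolT // GK /=; apply/eqP => KG; apply: TG.
  by rewrite KG.
split; first by apply/(face_dface p_interior _ fG G0); exists K.
by move=> /(dface_inj p_interior fK fG) /eqP; rewrite (negbTE KG).
Qed.

(** Within the recursion all proper faces share one fuel; this replaces it by the fuel that each
    face has in [stanley_g]. *)
Lemma stanley_g_rec_dface n K : face_index K -> K != set0 -> (crk K <= n)%N ->
  stanley_g_rec n (dface K) = stanley_g_rec (crk K) (dface K).
Proof.
have [b cb] := ubnP (crk K); elim: b n K cb => // b IH [|n] K cb fK K0 cK.
  by move: cK; rewrite leqn0 => /eqP ->.
case cE: (crk K) => [|c] /=.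
  by rewrite asboolT //; apply/dface_eq0 => //; apply: crk_eq0.
rewrite asboolF => [|/(dface_eq0 fK) KT]; last first.
  by move: cE; rewrite KT /crk rk_setT // subnn.
have -> // : \sum_(F \in [set F | face (dface K) F /\ F <> dface K]%classic)
      stanley_g_rec n F * ('X - 1) ^ (affdim (dface K) - affdim F - 1)
  = \sum_(F \in [set F | face (dface K) F /\ F <> dface K]%classic)
      stanley_g_rec c F * ('X - 1) ^ (affdim (dface K) - affdim F - 1).
rewrite !sum_dface //; apply: eq_bigr => F /and3P[/asboolP fF KF FK].
have F0 : F != set0 by apply: contraNneq K0 => F0; rewrite -subset0 -F0.
have := crk_lt fK KF FK; rewrite cE in cb cK * => cF.
by congr (_ * _); rewrite !IH //; lia.
Qed.

Lemma stanley_g_dface K : face_index K -> K != set0 ->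
  stanley_g (dface K) = stanley_g_rec (crk K) (dface K).
Proof. by move=> fK K0; rewrite /stanley_g affdim_crk // subrK. Qed.

Lemma stanley_g_dfaceT : stanley_g (dface setT) = 1.
Proof.
by rewrite /stanley_g dface_setT // /affdim asboolT.
Qed.

Lemma stanley_g_dfaceS K d : face_index K -> K != set0 -> crk K = d.+1 ->
  let h := \sum_(F : {set I} | [&& `[< face_index F >], K \subset F & F != K])
             stanley_g (dface F) * ('X - 1) ^+ (crk K - crk F - 1) in
  stanley_g (dface K) = \poly_(i < d./2.+1) (if i is j.+1 then h`_i - h`_j else h`_0).
Proof.
move=> fK K0 cE h; rewrite stanley_g_dface // cE /=.
rewrite asboolF => [|/(dface_eq0 fK) KT]; last first.
  by move: cE; rewrite KT /crk rk_setT // subnn.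
have -> : \sum_(F \in [set F | face (dface K) F /\ F <> dface K]%classic)
      stanley_g_rec d F * ('X - 1) ^ (affdim (dface K) - affdim F - 1) = h.
  rewrite sum_dface //; apply: eq_bigr => F /and3P[/asboolP fF KF FK].
  have F0 : F != set0 by apply: contraNneq K0 => F0; rewrite -subset0 -F0.
  have cF := crk_lt fK KF FK.
  rewrite stanley_g_dface // stanley_g_rec_dface //; last by rewrite cE in cF.
  congr (_ * _); rewrite exprnP; congr (_ ^ _).
  by rewrite !affdim_crk //; move: cF; lia.
have aE : affdim (dface K) = d%:Z by rewrite affdim_crk // cE; lia.
by rewrite aE.
Qed.

Hypothesis euler : forall G H, face_index G -> face_index H -> G != set0 -> G \proper H ->
  \sum_(F : {set I} | `[< face_index F >] && ((G \subset F) && (F \subset H)))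
     (-1) ^+ rk (homogenize p) F = 0 :> int.

(** The faces of [dface G] are the [dface F] with [G \subset F], so intervals in its face lattice
    that avoid the top correspond, reversed, to intervals of faces of the polytope itself, where
    [euler] applies. *)
Lemma stanley_g_dface_palindromic G : face_index G -> G != set0 ->
  \sum_(F : {set I} | `[< face_index F >] && (G \subset F))
     stanley_g (dface F) * ('X - 1) ^+ (crk G - crk F)
  = polyrev (crk G) (stanley_g (dface G)).
Proof.
move=> fG G0; pose P (F : {set I}) := `[< face_index F >] && (F != set0).
have PG : P G by rewrite /P asboolT.
have sumP (A : nmodType) (Q : pred {set I}) (f : {set I} -> A) :
    (forall F, Q F -> `[< face_index F >] -> F != set0) ->
    \sum_(F : {set I} | `[< face_index F >] && Q F) f F = \sum_(F : {F | P F} | Q (val F)) f (val F).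
  move=> Q0; rewrite -(big_sub_cond P Q f); apply: eq_bigl => F.
  rewrite /P unfold_in /=.
  by case fF: `[< _ >]; case QF: (Q F); rewrite ?andbF //= (Q0 F).
have sub0 (K F : {set I}) : K != set0 -> K \subset F -> F != set0.
  by move=> K0 KF; apply: contraNneq K0 => F0; rewrite -subset0 -F0.
have := @stanley_palindromic {F | P F} (fun K F : {F | P F} => val K \subset val F)
  (fun F : {F | P F} => crk (val F)) (fun F : {F | P F} => stanley_g (dface (val F))).
move=> /(_ _ _ _ _ _ _ _ (Sub G PG)) => H; rewrite -[RHS]H; first by rewrite sumP // => F GF _; exact: sub0 GF.
- by move=> F; exact: subxx.
- by move=> F K L; exact: subset_trans.
- by move=> F K FK KF; apply/val_inj/eqP; rewrite eqEsubset FK KF.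
- move=> F K FK ne; have /andP[/asboolP fF _] := valP F.
  by apply: crk_lt => //; rewrite eq_sym.
- move=> K L KL ne; have /andP[/asboolP fK K0] := valP K; have /andP[/asboolP fL L0] := valP L.
  have := euler fK fL K0; rewrite properEneq KL andbT => /(_ ne).
  rewrite (sumP _ (fun F => (val K \subset F) && (F \subset val L))) => [|F /andP[KF _] _]; last exact: sub0 KF.
  (* [crk] and [rk] add up to a constant, so the two alternating sums differ by a global sign. *)
  move=> E0; transitivity ((-1) ^+ (dim E).+1 *
    \sum_(F : {F | P F} | (val K \subset val F) && (val F \subset val L))
      (-1) ^+ rk (homogenize p) (val F) : int); last by rewrite E0 mulr0.
  rewrite mulr_sumr.
  apply: eq_bigr => F _; have := rk_le p_interior p_span (val F) => le.
  by rewrite -[in RHS](subnK le) exprD -mulrA -exprMn mulrNN mulr1 expr1n mulr1.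
- move=> F c0; have /andP[/asboolP fF _] := valP F.
  by rewrite (crk_eq0 fF c0) stanley_g_dfaceT.
move=> F d cd; have /andP[/asboolP fF F0] := valP F.
rewrite (stanley_g_dfaceS fF F0 cd) (sumP _ (fun K => (val F \subset K) && (K != val F))) //.
by move=> K /andP[FK _] _; exact: sub0 FK.
Qed.

End StanleyDual.

(** * Passing to the span of the translated dilate *)

Section Dilation.
Import mathcomp.boot.fintype mathcomp.boot.finset.
Variables (R : realType) (n : nat) (I : finType) (x : I -> 'rV[R]_n).
Implicit Types (K : {set I}).

Lemma comb_affine (a : R) (t : 'rV[R]_n) (c : {ffun I -> R^o}) :
  comb (fun i => a *: x i + t) c = a *: comb x c + (\sum_i (c i : R)) *: t.
Proof.
rewrite /comb scaler_sumr scaler_suml -big_split; apply: eq_bigr => i _ /=.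
by rewrite scalerDr !scalerA mulrC.
Qed.

Lemma hull_affine (a : R) (t : 'rV[R]_n) K :
  hull (fun i => a *: x i + t) K = [set a *: z + t | z in hull x K]%classic.
Proof.
apply/predeqP => z; split=> [/hullP[c [c0 sc c1]]|[_ /hullP[c [c0 sc c1 <-]] <-]].
  rewrite comb_affine c1 scale1r => <-; exists (comb x c) => //.
  by apply/hullP; exists c.
by apply/hullP; exists c; split=> //; rewrite comb_affine c1 scale1r.
Qed.

Lemma relint_dilate (l : nat) K z : (0 < l)%N -> K != set0 ->
  relint (dilate l%:R (hull x K)) z <-> rcone_on (homogenize x) K (z, l%:R).
Proof.
move=> l0 K0; have lR : 0 < l%:R :> R by rewrite ltr0n.
have -> : dilate l%:R (hull x K) = hull (fun i => l%:R *: x i + 0) K.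
  rewrite hull_affine /dilate; apply/predeqP => w.
  by split=> -[u hu <-]; exists u; rewrite ?addr0.
rewrite relint_hull //; split=> -[c [c0 sc]]; rewrite comb_homog.
  rewrite comb_affine scaler0 addr0 => -[cz c1]; exists (l%:R *: c); split.
  - by move=> i; rewrite ffunE mulr_ge0 // ltW.
  - by rewrite -sc; apply/setP => i; rewrite !inE ffunE mulf_eq0 negb_or gt_eqF.
  by rewrite linearZ /= comb_homog c1; congr (_, _) => //=; exact: mulr1.
move=> [cz c1]; exists (l%:R^-1 *: c); split.
- by move=> i; rewrite ffunE mulr_ge0 // invr_ge0 ltW.
- by rewrite -sc; apply/setP => i; rewrite !inE ffunE mulf_eq0 negb_or invr_eq0 gt_eqF.
rewrite comb_homog comb_affine scaler0 addr0 linearZ /= scalerA divff ?gt_eqF // scale1r cz.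
congr (_, _); rewrite (eq_bigr (fun i => l%:R^-1 * (c i : R))) => [|i _]; last by rewrite ffunE.
by rewrite -mulr_sumr c1 mulVf // gt_eqF.
Qed.

Lemma hull_subfam K : hull x K = hull (fun i : {i | i \in K} => x (val i)) setT.
Proof.
apply/predeqP => z; rewrite /hull /= cone_on_sub; split=> [[c c0 cz]|].
  by exists c; split=> //; apply/subsetP => i; rewrite inE.
by move=> /cone_on_setT.
Qed.

End Dilation.

Section DualTransfer.
Import mathcomp.boot.fintype mathcomp.boot.finset.
Variables (R : realType) (n : nat) (I : finType) (x : I -> 'rV[R]_n).
Variables (k : nat) (m : 'rV[int]_n).
Hypothesis k0 : (0 < k)%N.
Let y i := k%:R *: x i + - lattice_point R m.
Let P' : set 'rV[R]_n := dilate_shift k m (hull x setT).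
Hypothesis P'0 : relint P' 0.
Notation E := (subvs_of (span_set P')).
Definition dual_gen (i : I) : E := vsproj (span_set P') (y i).
Let p := dual_gen.
Implicit Types (K : {set I}).

Lemma dilate_shift_hull K : dilate_shift k m (hull x K) = hull y K.
Proof. by rewrite hull_affine. Qed.

Lemma dual_gen_neq0 : [set: I] != set0.
Proof.
have [h0 _] := P'0; apply/eqP => I0.
by move: h0; rewrite /P' dilate_shift_hull I0 (_ : hull y set0 = classical_sets.set0) //; apply/hull_eq0.
Qed.

Lemma vsval_dual_gen i : vsval (p i) = y i.
Proof.
rewrite vsprojK //; have [H _] := span_setP P'; apply: H.
by rewrite /P' dilate_shift_hull; apply: hull_gen; rewrite inE.
Qed.

Lemma vsval_comb (c : {ffun I -> R^o}) : vsval (comb p c) = comb y c.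
Proof. by rewrite linear_sum; apply: eq_bigr => i _; rewrite linearZ /= vsval_dual_gen. Qed.

Lemma in_span_hull K : @in_span R n P' (hull y K) = hull p K.
Proof.
apply/predeqP => w; split=> /hullP[c [c0 sc c1 cw]]; apply/hullP; exists c; split=> //.
  by apply: val_inj; exact: etrans (vsval_comb c) cw.
by rewrite -vsval_comb cw.
Qed.

Lemma dual_gen_interior : rcone_on (homogenize p) setT (0, 1).
Proof.
have : relint (hull y setT) 0 by rewrite -dilate_shift_hull.
rewrite relint_hull ?dual_gen_neq0 //.
case=> c [c0 sc]; rewrite comb_homog => -[cz c1]; exists c; split=> //.
rewrite comb_homog c1; congr (_, _); apply: val_inj.
exact: etrans (vsval_comb c) cz.
Qed.

Lemma dual_gen_span : <<codom p>>%VS = fullv.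
Proof.
apply/eqP; rewrite eqEsubv subvf /=; apply/subvP => w _.
have sub : (span_set P' <= <<codom y>>)%VS.
  have [_ H] := span_setP P'; apply: H => z; rewrite /P' dilate_shift_hull.
  case/hullP => c [_ _ _ <-]; apply: memv_suml => i _.
  by rewrite memvZ // memv_span // codom_f.
have wy := subvP sub _ (subvsP w).
rewrite -[w]vsvalK; have := memv_img (linfun (vsproj (span_set P'))) wy.
rewrite lfunE limg_span; apply: subvP; apply/span_subvP => u /mapP[_ /codomP[j ->] ->].
by rewrite memv_span // lfunE /=; apply: (codom_f p).
Qed.

Lemma dual_face_dface K : dual_face k m (hull x setT) (hull x K) = dface p K.
Proof.
rewrite /dual_face /dface -/P' -!in_span_hull -!dilate_shift_hull //.
Qed.

(** Affine functionals can be carried in both directions between [x] and [p], with the same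
    maximizing indices. This is how the Euler relation, proved for lattice points, reaches the
    generators of [P'] inside its span. *)
Lemma cface_transfer K : cface (homogenize x) K <-> cface (homogenize p) K.
Proof.
have kR : 0 < k%:R :> R by rewrite ltr0n.
pose t := lattice_point R m.
split=> /cfaceP[u [b [ub ->]]]; apply/cfaceP.
  pose u' : 'Hom(E, R^o) := (u \o linfun vsval)%VF.
  have uE i : u' (p i) = k%:R * (u (x i) : R) - u t :> R.
    by rewrite comp_lfunE lfunE /= vsval_dual_gen linearB linearZ.
  exists u', (k%:R * b - u t); split=> [i|].
    by rewrite uE lerD2r ler_pM2l.
  apply/setP => i; rewrite !inE uE (inj_eq (addIr _)) (inj_eq (mulfI _)) //.
  by rewrite gt_eqF.
pose u' : 'Hom('rV[R]_n, R^o) := (u \o linfun (vsproj (span_set P')))%VF.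
have uE i : u (p i) = k%:R * (u' (x i) : R) - u' t :> R.
  have -> : u (p i) = u' (y i) by rewrite comp_lfunE lfunE.
  by rewrite linearB linearZ.
exists u', ((b + u' t) / k%:R); split=> [i|].
  by rewrite ler_pdivlMr // mulrC -lerBlDr -uE.
have kn0 : k%:R != 0 :> R by rewrite gt_eqF.
apply/setP => i; rewrite !inE uE -[RHS](inj_eq (mulfI kn0)).
by rewrite mulrCA divff // mulr1 subr_eq.
Qed.

Lemma rk_transfer K : rk (homogenize x) K = rk (homogenize p) K.
Proof.
have [->|/set0Pn[i0 iK]] := eqVneq K set0.
  by rewrite /rk /qspan !enum_set0 !span_nil !dimv0.
rewrite !(rk_homog _ iK); congr _.+1.
set s := [seq p i - p i0 | i <- enum K].
have kR : k%:R != 0 :> R by rewrite pnatr_eq0 -lt0n.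
have E0 : (fullv :&: lker (linfun (vsval : E -> 'rV[R]_n)) = 0)%VS.
  apply/eqP; rewrite -subv0; apply/subvP => w; rewrite memv_cap memv_ker lfunE /= memv0.
  by move=> /andP[_ /eqP w0]; apply/eqP/val_inj.
have E1 : \dim <<s>> = \dim (linfun (vsval : E -> 'rV[R]_n) @: <<s>>)%VS.
  rewrite limg_dim_eq //; apply/eqP; rewrite -subv0 -E0.
  by rewrite subv_cap subvf /= capvSr.
have sE i : vsval (p i - p i0) = k%:R *: (x i - x i0).
  rewrite linearB /= !vsval_dual_gen /y opprD addrACA subrr addr0.
  by rewrite scalerBr.
rewrite E1 limg_span; congr (\dim _); apply/eqP; rewrite eqEsubv.
apply/andP; split; apply/span_subvP => _ /mapP[j jK ->].
  rewrite -[x j - x i0](scalerK kR) memvZ // -sE memv_span //.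
  have := map_f (linfun (vsval : E -> 'rV[R]_n)) (map_f (fun i => p i - p i0) jK).
  by rewrite lfunE.
case/mapP: jK => i iK' ->; rewrite lfunE; rewrite -[X in X \in _]/(vsval (p i - p i0)) sE memvZ // memv_span //.
exact: (map_f (fun i => x i - x i0)).
Qed.

End DualTransfer.

(** * Laurent polynomials and weights *)

Section LaurentEval.
Variable K : fieldType.
Implicit Types (y : K) (D : laurentZ).

Lemma laurent_eval_seq D (s : seq int) y : uniq s -> {subset dom D <= s} ->
  laurent_eval D y = \sum_(i <- s) (coeff i D)%:~R * y ^ i.
Proof.
move=> us Ds; rewrite /laurent_eval [RHS](bigID (mem (dom D))) /=.
rewrite [X in _ = _ + X]big1 ?addr0 => [|i iD]; last by rewrite coeff_outdom // mul0r.
rewrite -[RHS]big_filter; apply: perm_big; apply: uniq_perm.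
- exact: uniq_dom.
- exact: filter_uniq.
- by move=> i; rewrite mem_filter; case iD: (i \in dom D) => //=; rewrite Ds.
Qed.

Lemma laurent_eval0 y : laurent_eval 0 y = 0.
Proof. by rewrite /laurent_eval dom0 big_nil. Qed.

Lemma laurent_eval_poly (p : {poly int}) y :
  laurent_eval (laurent_of_poly p) y = (map_poly intr p).[y].
Proof.
have cE k : coeff k (laurent_of_poly p) = \sum_(i < size p) p`_i * (i%:Z == k)%:R.
  rewrite /laurent_of_poly (raddf_sum (coeff k)); apply: eq_bigr => i _.
  exact: coeffU.
have cn (i : nat) : coeff i%:Z (laurent_of_poly p) = p`_i.
  rewrite cE; have [ip|ip] := ltnP i (size p); last first.
    rewrite nth_default // big1 // => j _.
    by rewrite eqz_nat (_ : (_ == _) = false) ?mulr0 // ltn_eqF // (leq_trans (ltn_ord j)).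
  rewrite (bigD1 (Ordinal ip)) //= eqxx mulr1 big1 ?addr0 // => j ji.
  by rewrite eqz_nat -[(j : nat) == i]/(j == Ordinal ip) (negbTE ji) mulr0.
rewrite (@laurent_eval_seq _ [seq i%:Z | i <- index_iota 0 (size p)]); last 1 first.
- move=> k; rewrite mem_dom; apply: contraR => kp; apply/eqP.
  rewrite cE big1 // => i _; case: eqP => [E|]; rewrite ?mulr0 //.
  by case/negP: kp; rewrite -E; apply: map_f; rewrite mem_index_iota /=.
- rewrite big_map (@horner_coef_wide _ (size p)); last exact: size_poly.
  rewrite big_mkord.
  apply: eq_bigr => i _; rewrite cn coef_map //.
- by rewrite map_inj_uniq ?iota_uniq // => i j [].
Qed.

Lemma horner_polyrev r (p : {poly int}) (t : K) : t != 0 -> (size p <= r.+1)%N ->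
  (map_poly intr (polyrev r p)).[t] = t ^+ r * (map_poly intr p).[t^-1].
Proof.
move=> t0 sp; rewrite (@horner_coef_wide _ r.+1); last first.
  by apply: leq_trans (size_poly _ _) _; apply: size_poly.
rewrite (@horner_coef_wide _ r.+1 (map_poly _ p)); last first.
  exact: leq_trans (size_poly _ _) sp.
rewrite mulr_sumr (reindex_inj rev_ord_inj) /=; apply: eq_bigr => i _.
have ir : (i <= r)%N by rewrite -ltnS.
rewrite !coef_map coef_polyrev subSS leq_subr subKn // exprVn mulrCA; congr (_ * _).
have -> : t ^+ r = t ^+ (r - i) * t ^+ i by rewrite -exprD subnK.
by rewrite mulfK // expf_neq0.
Qed.

End LaurentEval.

(** * Homogeneous weights and Laurent coefficients *)

Section Weights.
Variables (R : realType) (n : nat).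
Notation C := R[i].
Notation M := 'rV[int]_n.
Implicit Types phi : {mpoly C[n]}.

Definition mpoly_weight phi (m : M) : C := phi.@[fun i => (m ord0 i)%:~R].

Lemma polyfun_mpoly phi : polyfun (mpoly_weight phi).
Proof.
rewrite (_ : mpoly_weight phi = fun m : M => \sum_(a <- msupp phi) phi@_a * \prod_(i <- enum 'I_n) (\prod_(j < a i) (m 0 i)%:~R)).
  apply: polyfun_sum => a; apply: polyfun_mul; first exact: polyfun_const.
  apply: polyfun_prod => i.
  rewrite (_ : (fun _ => _) = fun m : M => \prod_(j <- enum 'I_(a i)) ((m 0 i)%:~R * 1)).
    by apply: polyfun_prod => j; apply/polyfun_coord/polyfun_const.
  by apply/funext => m; rewrite big_enum; apply: eq_bigr => j _; rewrite mulr1.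
apply/funext => m; rewrite /mpoly_weight mevalE; apply: eq_bigr => a _; congr (_ * _).
rewrite big_enum; apply: eq_bigr => i _.
by rewrite prodr_const card_ord.
Qed.

Lemma mpoly_weight_opp phi m : phi \is ishomog mdeg ->
  mpoly_weight phi (- m) = (-1) ^+ pdeg phi * mpoly_weight phi m.
Proof.
rewrite homog_msize => /dhomogP hp; rewrite /mpoly_weight !mevalE mulr_sumr.
rewrite !big_seq; apply: eq_bigr => a aphi; rewrite mulrCA; congr (_ * _).
have -> : pdeg phi = (\sum_(i < n) a i)%N by rewrite -mdegE; apply: esym; exact: hp.
rewrite -prodrXr -big_split; apply: eq_bigr => i _ /=.
by rewrite mxE rmorphN /= -exprMn mulN1r.
Qed.

Notation K := {fraction {poly C}}.
Notation y := (ratvar R).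

Lemma ratvar_neq0 : y != 0.
Proof. by rewrite tofrac_eq0 polyX_eq0. Qed.

Lemma ratvar1_neq0 : 1 + y != 0.
Proof.
rewrite -tofrac1 -tofracD tofrac_eq0 addrC -[1]opprK -polyCN.
by rewrite polyXsubC_eq0.
Qed.

Lemma is_laurentD (a b : K) : is_laurent a -> is_laurent b -> is_laurent (a + b).
Proof.
move=> [p [i ->]] [q [j ->]]; exists (p * 'X^j + q * 'X^i), (i + j)%N.
rewrite tofracD !tofracM !tofracXn -/y; have := ratvar_neq0 => y0.
by rewrite addf_div ?expf_neq0 // exprD.
Qed.

Lemma is_laurentM (a b : K) : is_laurent a -> is_laurent b -> is_laurent (a * b).
Proof.
move=> [p [i ->]] [q [j ->]]; exists (p * q), (i + j)%N.
by rewrite tofracM exprD mulf_div.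
Qed.

Lemma is_laurent_poly (p : {poly C}) : is_laurent (tofrac p : K).
Proof. by exists p, 0%N; rewrite expr0 divr1. Qed.

Lemma is_laurent_int (z : int) : is_laurent (z%:~R : K).
Proof. by rewrite -(rmorph_int (@tofrac {poly C})); exact: is_laurent_poly. Qed.

Lemma is_laurent_sum (I : Type) (s : seq I) (P : pred I) (f : I -> K) :
  (forall i, P i -> is_laurent (f i)) -> is_laurent (\sum_(i <- s | P i) f i).
Proof.
move=> H; apply: (big_ind (fun x => is_laurent x)) => //.
- by rewrite -[0](rmorph0 (@tofrac {poly C})); exact: is_laurent_poly.
- exact: is_laurentD.
Qed.

Lemma is_laurentX (a : K) (k : nat) : is_laurent a -> is_laurent (a ^+ k).
Proof.
move=> la; elim: k => [|k IH]; last by rewrite exprS; apply: is_laurentM.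
exact: (is_laurent_int 1).
Qed.

Lemma is_laurent_ratvar (k : int) : is_laurent (y ^ k).
Proof.
case: k => k; first by rewrite -exprnP; apply/is_laurentX/is_laurent_poly.
by exists 1, k.+1; rewrite tofrac1 div1r NegzE exprnN.
Qed.

Lemma is_laurent_eval D (Y : K) : (forall k : int, is_laurent (Y ^ k)) ->
  is_laurent (laurent_eval D Y).
Proof.
move=> HY; apply: is_laurent_sum => i _; apply: is_laurentM => //.
exact: is_laurent_int.
Qed.

End Weights.

(** * Duality for the weighted Ehrhart polynomials *)

Lemma fraction_poly_natr_inj (A : numFieldType) :
  injective (fun i : nat => i%:R : {fraction {poly A}}).
Proof.
move=> i j /eqP; rewrite -!(rmorph_nat (@tofrac {poly A})) tofrac_eq.
rewrite -!(rmorph_nat (@polyC A)) (inj_eq (@polyC_inj A)).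
by move/eqP/natr_inj_num.
Qed.

Lemma subn_compl a b d : (a <= d)%N -> (a - b = d - b - (d - a))%N.
Proof. lia. Qed.

Lemma sign_shuffle (A : comNzRingType) n (g u d e : A) :
  g * ((-1) ^+ n * u) * ((-1) ^+ n * d * e) = d * (e * (g * u)).
Proof.
transitivity (((-1) ^+ n) ^+ 2 * (d * (e * (g * u)))); first by ring.
by rewrite sqrr_sign mul1r.
Qed.

Lemma pow_shuffle (F : fieldType) (q z u g : F) : z != 0 ->
  u * (q * g) = q * z * (g * (z^-1 * u)).
Proof. by move=> z0; field. Qed.

Section Family.
Import mathcomp.boot.fintype mathcomp.boot.finset.
Variables (R : realType) (n : nat) (I : finType) (v : I -> 'rV[int]_n).
Notation M := 'rV[int]_n.
Notation C := R[i].
Notation K := {fraction {poly C}}.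
Let x i := lattice_point R (v i).
Let Q' := hull x setT.
Variables (k : nat) (m : M) (phi : {mpoly C[n]}).
Hypothesis k0 : (0 < k)%N.
Hypothesis P'0 : relint (dilate_shift k m Q') 0.
Hypothesis hphi : phi \is ishomog mdeg.
Implicit Types (F G : {set I}) (Y : K).
Let p := dual_gen x k m.
Let w := mpoly_weight phi.
Notation face_index F := (cface (homogenize x) F).
Notation gam F := (stanley_g (dface p F)).
Notation iota := (fun c : C => tofrac c%:P : K).

Lemma iota_is_rmorphism : exists f : {rmorphism C -> K}, forall c, f c = iota c.
Proof. by exists ((@tofrac {poly C}) \o (@polyC C))%FUN. Qed.

Lemma gam_palindromic G : face_index G -> G != set0 ->
  \sum_(F : {set I} | `[< face_index F >] && (G \subset F))
     gam F * ('X - 1) ^+ (rk (homogenize x) F - rk (homogenize x) G)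
  = polyrev ((rk (homogenize x) setT) - rk (homogenize x) G) (gam G).
Proof.
move=> /(cface_transfer x m k0) fG G0.
have pI := dual_gen_interior P'0; have pS := dual_gen_span x k m.
have tr F : `[< face_index F >] = `[< cface (homogenize p) F >].
  by apply/asboolP/asboolP => /(cface_transfer x m k0).
have rkE F : rk (homogenize x) F = rk (homogenize p) F by apply: (rk_transfer x m k0).
have eul : forall G H, cface (homogenize p) G -> cface (homogenize p) H -> G != set0 -> G \proper H ->
  \sum_(F : {set I} | `[< cface (homogenize p) F >] && ((G \subset F) && (F \subset H)))
     (-1) ^+ rk (homogenize p) F = 0 :> int.
  move=> G1 H1 /(cface_transfer x m k0) f1 /(cface_transfer x m k0) f2 G10 GH.
  rewrite -[RHS](@euler_relation R n I v G1 H1 f1 f2 G10 GH).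
  by apply: eq_big => [F|F _]; rewrite -?tr // -rkE.
have -> : (rk (homogenize x) setT - rk (homogenize x) G)%N = crk p G.
  by rewrite /crk -(rk_setT pI pS) !rkE.
rewrite -(stanley_g_dface_palindromic pI pS eul fG G0).
apply: eq_big => [F|F _]; first by rewrite tr.
rewrite !rkE; congr (_ * _ ^+ _); rewrite /crk.
exact: subn_compl (rk_le pI pS F).
Qed.

Lemma size_gam F : face_index F -> F != set0 ->
  (size (gam F) <= (rk (homogenize x) setT - rk (homogenize x) F).+1)%N.
Proof.
move=> /(cface_transfer x m k0) fF F0.
have pI := dual_gen_interior P'0; have pS := dual_gen_span x k m.
rewrite !(rk_transfer x m k0) (rk_setT pI pS) -/(crk p F).
case E: (crk p F) => [|d].
  by rewrite (crk_eq0 pI pS fF E) stanley_g_dfaceT // size_poly1.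
rewrite (stanley_g_dfaceS pI pS fF F0 E); apply: leq_trans (size_poly _ _) _.
by rewrite !ltnS; lia.
Qed.

Lemma weightE F Y : face_index F -> laurent_eval (g_weight k m Q' (hull x F)) Y
  = (map_poly intr (gam F)).[- Y].
Proof.
move=> fF; rewrite /g_weight asboolT; last by apply/face_hullT; exists F.
rewrite laurent_eval_poly dual_face_dface map_comp_poly horner_comp.
by rewrite rmorphN /= map_polyX hornerN hornerX.
Qed.

Lemma lattice_sumE F l : F != set0 -> (0 < l)%N ->
  lattice_sum phi (dilate l%:R (hull x F)) =
  lsum (fun a => rcone_on (hgen R v) F (hpoint R l a)) w.
Proof.
move=> F0 l0; apply: eq_fsbigl; apply/predeqP => a /=.
exact: relint_dilate.
Qed.

Lemma ehrhart_valueE (P : set 'rV[R]_n) l Y : (forall S, face Q' S -> face P S) -> (0 < l)%N ->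
  ehrhart_value P (g_weight k m Q') phi l Y =
  \sum_(F : {set I} | `[< face_index F >] && (F != set0))
    (map_poly intr (gam F)).[- Y] * (1 + Y) ^+ (rk (homogenize x) F).-1 *
      iota (lsum (fun a => rcone_on (hgen R v) F (hpoint R l a)) w).
Proof.
move=> sP l0; rewrite /ehrhart_value.
rewrite -(fsbig_widen [set S | face Q' S /\ (S !=set0)%classic]%classic); first last.
- move=> S [[_ S0] nS]; rewrite /= /g_weight asboolF ?laurent_eval0 ?mul0r // => fS.
  by apply: nS.
- by move=> S [/sP fS S0].
have nE F : (hull x F !=set0)%classic <-> F != set0.
  split=> [[z hz]|/set0Pn[i iF]]; last by exists (x i); apply: hull_gen.
  by apply/eqP => F0; have [_ /(_ F0) E] := hull_eq0 x F; rewrite E in hz.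
rewrite (@fsum_image _ _ _ (fun F : {set I} => `[< face_index F >] && (F != set0)) (hull x)).
- apply: eq_bigr => F /andP[/asboolP fF F0].
  rewrite weightE // lattice_sumE // affdim_hull; congr (_ * _ * _).
  have rk0 : (0 < rk (homogenize x) F)%N by apply: (@rk_gt0 R n I v).
  by rewrite exprnP; congr (_ ^ _); rewrite -{1}(prednK rk0) -addn1 PoszD addrK.
- by move=> F F' /andP[/asboolP fF _] /andP[/asboolP fF' _]; apply: hull_inj.
move=> S; split=> [[/face_hullT[F fF ->] /nE F0]|[F /andP[/asboolP fF F0] ->]].
  by exists F => //; rewrite asboolT.
by split; [apply/face_hullT; exists F | apply/nE].
Qed.

(** [E] is built for all [Y] at once because the duality compares [Y] with [Y^-1], and uniformly in
    [P], since the weight vanishes off the faces of [Q']. *)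
Lemma ehrhart_family : exists E : K -> {poly K},
  (forall (P : set 'rV[R]_n) Y, (forall S, face Q' S -> face P S) ->
     (forall z : int, is_laurent (Y ^ z)) -> is_laurent (1 + Y) ->
     is_ehrhart_poly P (g_weight k m Q') phi Y (E Y)) /\
  (forall (l : int) Y, Y != 0 -> 1 + Y != 0 ->
     (E Y).[(- l)%:~R] = (- Y) ^ affdim Q' * (-1) ^+ pdeg phi * (E Y^-1).[l%:~R]).
Proof.
have [io ioE] := iota_is_rmorphism.
have [e [e1 e2]] := ehrhart_faces_exist R v.
have pw : polyfun w by apply: polyfun_mpoly.
pose E Y : {poly K} := \sum_(F : {set I} | `[< face_index F >] && (F != set0))
  ((map_poly intr (gam F)).[- Y] * (1 + Y) ^+ (rk (homogenize x) F).-1) *: map_poly io (e w F).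
have EE Y z : (E Y).[z] = \sum_(F : {set I} | `[< face_index F >] && (F != set0))
   (map_poly intr (gam F)).[- Y] * (1 + Y) ^+ (rk (homogenize x) F).-1 * (map_poly io (e w F)).[z].
  by rewrite horner_sum; apply: eq_bigr => F _; rewrite hornerZ.
exists E; split=> [P Y sP LY LY1|l Y Y0 Y10].
  split=> [i|l l0].
    rewrite coef_sum; apply: is_laurent_sum => F /andP[/asboolP fF _].
    rewrite coefZ coef_map /= ioE; apply: is_laurentM; last exact: is_laurent_poly.
    apply: is_laurentM; last exact: is_laurentX.
    by rewrite -weightE //; exact: is_laurent_eval.
  rewrite ehrhart_valueE // EE; apply: eq_bigr => F /andP[/asboolP fF F0].
  by rewrite -(rmorph_nat io) horner_map /= ioE e1.
have wopp : (fun a : M => w (- a)) = fun a => (-1) ^+ pdeg phi * w a.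
  by apply/funext => a; apply: mpoly_weight_opp.
(* Reciprocity reflects the weight, which homogeneity converts into the sign [(-1) ^+ pdeg phi]. *)
have eopp F : F != set0 -> e (fun a => w (- a)) F = (-1) ^+ pdeg phi *: e w F.
  move=> F0; apply: poly_eq_natr => [|j j0]; first exact: natr_inj_num.
  rewrite hornerZ !e1 //; last exact: polyfun_opp.
  rewrite wopp /lsum; have [r ur rP] := box_seq n (j * \sum_i \sum_k absz (v i 0%R k)).
  have inr a : rcone_on (hgen R v) F (hpoint R j a) -> a \in r.
    by move=> /rcone_on_cone/cone_on_setT ca; apply: rP => ?; apply: cone_bound ca.
  rewrite -!/(lsum _ _) !(lsum_cond _ ur inr) mulr_sumr; apply: eq_bigr => a _.
  by rewrite mulrCA.
have recip F : face_index F -> F != set0 -> (map_poly io (e w F)).[(- l)%:~R] =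
    (-1) ^+ (rk (homogenize x) F).-1 * (-1) ^+ pdeg phi *
      \sum_(G : {set I} | `[< face_index G >] && ((G != set0) && (G \subset F)))
        (map_poly io (e w G)).[l%:~R].
  move=> fF F0; have := congr1 (fun q : {poly C} => (map_poly io q).[l%:~R]) (e2 w F pw fF F0).
  rewrite map_comp_poly horner_comp rmorphN /= map_polyX hornerN hornerX -rmorphN /= => ->.
  rewrite linearZ_LR /= hornerZ rmorphXn rmorphN1 -mulrA; congr (_ * _).
  rewrite rmorph_sum horner_sum mulr_sumr; apply: eq_bigr => G /and3P[_ G0 _].
  by rewrite /= eopp // map_polyZ hornerZ rmorphXn rmorphN1.
apply: (etrans (EE Y _)); apply: (etrans _ (congr1 ( *%R _) (esym (EE Y^-1 _)))).
have t0 : - Y != 0 by rewrite oppr_eq0; exact: Y0.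
pose t := - Y; rewrite -/t in t0.
have t1 : 1 + Y = - (t - 1) by rewrite opprB opprK.
pose D := (rk (homogenize x) setT).-1.
have [i0 _] : exists i0 : I, true.
  have /set0Pn[i _] := dual_gen_neq0 P'0; by exists i.
have T0 : [set: I] != set0 by apply/set0Pn; exists i0; rewrite inE.
have rkT : (0 < rk (homogenize x) setT)%N := @rk_gt0 R n I v setT T0.
have DE : affdim Q' = D%:Z.
  by rewrite affdim_hull -{1}(prednK rkT) -addn1 PoszD addrK.
(* Collects the coefficient of each [e w G]; the signs from reciprocity cancel those in the powers
   of [1 + Y = - (t - 1)]. *)
transitivity ((-1) ^+ pdeg phi * \sum_(G : {set I} | `[< face_index G >] && (G != set0))
   (map_poly io (e w G)).[l%:~R] * (\sum_(F : {set I} | `[< face_index F >] && (G \subset F))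
     (map_poly intr (gam F)).[t] * (t - 1) ^+ (rk (homogenize x) F).-1)).
  under eq_bigr => F /andP[/asboolP fF F0].
    rewrite recip // mulr_sumr mulr_sumr.
  over.
  rewrite mulr_sumr.
  under [RHS]eq_bigr do rewrite mulrA mulr_sumr.
  rewrite (exchange_big_dep (fun G : {set I} => `[< face_index G >] && (G != set0))) /=; last first.
    by move=> F G _ /and3P[-> -> _].
  apply: eq_bigr => G /andP[fG G0]; rewrite [LHS]big_mkcond [RHS]big_mkcond; apply: eq_bigr => F _.
  rewrite fG G0 /=; case: ifP => [/andP[/andP[fF F0] GF]|H]; last first.
    case: ifP => // /andP[fF GF]; move: H; rewrite fF GF /=.
    have -> // : F != set0 by apply: contraNneq G0 => F0; rewrite -subset0 -F0.
  rewrite fF GF /= t1 [(- (t - 1)) ^+ _]exprNn -[RHS]mulrA -/t.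
  exact: sign_shuffle.
rewrite DE -exprnP -/t mulrAC [RHS]mulrC; congr (_ * _).
rewrite mulr_sumr; apply: eq_bigr => G /andP[/asboolP fG G0].
have rkG : (0 < rk (homogenize x) G)%N := @rk_gt0 R n I v G G0.
have leG : (rk (homogenize x) G <= rk (homogenize x) setT)%N by rewrite dimvS // qspanS // subsetT.
rewrite [RHS]mulrA [RHS]mulrC; congr (_ * _).
(* Palindromicity evaluated at [t], after splitting off the power of [t - 1] that belongs to [G]. *)
transitivity ((t - 1) ^+ (rk (homogenize x) G).-1 *
   (map_poly intr (polyrev (rk (homogenize x) setT - rk (homogenize x) G) (gam G))).[t]).
  rewrite -gam_palindromic // rmorph_sum horner_sum mulr_sumr.
  apply: eq_bigr => F /andP[_ GF].
  rewrite rmorphM rmorphXn rmorphB /= map_polyX rmorph1 hornerM horner_exp hornerXsubC.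
  rewrite mulrCA -exprD; congr (_ * _ ^+ _).
  have : (rk (homogenize x) G <= rk (homogenize x) F)%N by rewrite dimvS // qspanS.
  lia.
rewrite horner_polyrev ?size_gam //.
have -> : - Y^-1 = t^-1 by rewrite -invrN.
have -> : 1 + Y^-1 = t^-1 * (t - 1).
  by rewrite mulrBr mulVf // mulr1 /t invrN opprK.
rewrite exprMn.
(* The first power comes from the reversal, the second from [1 + Y^-1 = t^-1 * (t - 1)]; together
   they make up the dimension of [Q']. *)
have -> : t ^+ D = t ^+ (rk (homogenize x) setT - rk (homogenize x) G) * t ^+ (rk (homogenize x) G).-1.
  by rewrite -exprD; congr (_ ^+ _); rewrite /D; lia.
rewrite exprVn.
exact: pow_shuffle (expf_neq0 _ t0).
Qed.

End Family.

Lemma ehrhart_polyE (R : realType) (n : nat) (P : set 'rV[R]_n) f phi y p :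
  is_ehrhart_poly P f phi y p -> ehrhart_poly P f phi y = p.
Proof.
move=> hp; rewrite /ehrhart_poly; case: xgetP => [q _ [_ hq]|/(_ p)//].
apply: poly_eq_natr => [|l l0]; first exact: fraction_poly_natr_inj.
by rewrite hq // hp.2.
Qed.

Lemma lattice_polytope_hull (R : realType) (n : nat) (P : set 'rV[R]_n) :
  lattice_polytope P -> exists (N : nat) (v : 'I_N -> 'rV[int]_n),
    P = hull (fun i => lattice_point R (v i)) finset.setT.
Proof.
move=> [V ->]; exists (size V), (tnth (in_tuple V)); rewrite -conv_hull_family.
congr conv_hull; apply/predeqP => z; split=> [[m /= /(tnthP (in_tuple V) m) [j ->] <-]|[i _ <-]].
  by exists j.
by exists (tnth (in_tuple V) i) => //=; apply: mem_tnth.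
Qed.

(** Since [1 + y = y * (1 + y^-1)], the prefactor of [Ephi] supplies [y ^+ d], which absorbs the
    sign [(-1) ^+ d] into [(- y) ^+ d]. *)
Lemma ephi_shuffle (F : fieldType) (y t : F) (a : int) (d : nat) : y != 0 ->
  (1 + y) ^+ d * ((- y) ^ a * (-1) ^+ d * t) = (- y) ^ (a + d%:Z) * ((1 + y^-1) ^+ d * t).
Proof.
move=> y0; rewrite expfzDr ?oppr_eq0 // -exprnP.
have -> : (1 + y) ^+ d = (-1) ^+ d * ((- y) ^+ d * (1 + y^-1) ^+ d).
  by rewrite -!exprMn mulN1r mulrDr mulr1 mulNr divff // opprD !opprK addrC.
have shuffle (s u v w : F) : s * s = 1 -> s * (u * v) * (w * s * t) = w * u * (v * t).
  by move=> ss; transitivity (s * s * (w * u * (v * t))); [ring | rewrite ss mul1r].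
by apply: shuffle; rewrite -expr2 sqrr_sign.
Qed.

Unset Implicit Arguments.

Theorem mainTheorem6 (R : realType) (n : nat)
    (P : set 'rV[R]_n) (hP : lattice_polytope P) (hPfull : affdim P = n%:Z)
    (phi : {mpoly R[i][n]}) (hphi : phi \is homog mdeg)
    (Q' : set 'rV[R]_n) (hQ' : face P Q') (hQ'0 : Q' !=set0)
    (k : nat) (hk : (0 < k)%N) (m : 'rV[int]_n)
    (hkm : relint (dilate_shift k m Q') 0) :
  let f := g_weight k m Q' in
  let y := ratvar R in
  (exists p, is_ehrhart_poly P f phi y p) /\
  forall l : int,
    Ephi P f phi (- l) y
      = (- y) ^ (affdim Q' + (pdeg phi)%:Z) * Ephi P f phi l y^-1 /\
    Etilde P f phi (- l) y
      = (- y) ^ (affdim Q') * (-1) ^+ (pdeg phi) * Etilde P f phi l y^-1.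
Proof.
move=> f y; have [N [v0 PE]] := lattice_polytope_hull hP.
have [K0 fK0 Q'E] : exists2 K, cface (homogenize (fun i => lattice_point R (v0 i))) K
    & Q' = hull (fun i => lattice_point R (v0 i)) K.
  by apply/face_hullT; rewrite -PE.
have Q'P S : face Q' S -> face P S by rewrite PE Q'E; apply: face_hull_trans.
(* Keeping only the generators on [Q'] presents it as the hull of a whole family, as
   [ehrhart_family] requires. *)
have Q'v : Q' = hull (fun i : {i | i \in K0} => lattice_point R (v0 (val i))) finset.setT.
  by rewrite Q'E hull_subfam.
have [E [Epoly Edual]] : exists E : {fraction {poly R[i]}} -> {poly {fraction {poly R[i]}}},
  (forall (P : set 'rV[R]_n) Y, (forall S, face Q' S -> face P S) ->
     (forall z : int, is_laurent (Y ^ z)) -> is_laurent (1 + Y) ->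
     is_ehrhart_poly P (g_weight k m Q') phi Y (E Y)) /\
  (forall (l : int) Y, Y != 0 -> 1 + Y != 0 ->
     (E Y).[(- l)%:~R] = (- Y) ^ affdim Q' * (-1) ^+ pdeg phi * (E Y^-1).[l%:~R]).
  by move: hkm; rewrite Q'v => hkm'; apply: ehrhart_family.
have y0 : y != 0 := ratvar_neq0 R; have y1 : 1 + y != 0 := ratvar1_neq0 R.
have Py : is_ehrhart_poly P f phi y (E y).
  apply: Epoly => // [z|]; first exact: is_laurent_ratvar.
  by apply: is_laurentD; [exact: (is_laurent_int R 1) | exact: (is_laurent_ratvar R 1)].
have PyV : is_ehrhart_poly P f phi y^-1 (E y^-1).
  apply: Epoly => // [z|].
    by rewrite exprz_inv; exact: is_laurent_ratvar.
  by apply: is_laurentD; [exact: (is_laurent_int R 1) | exact: (is_laurent_ratvar R (-1))].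
split; first by exists (E y).
have Etil l Y : is_ehrhart_poly P f phi Y (E Y) -> Etilde P f phi l Y = (E Y).[l%:~R].
  by rewrite /Etilde => /ehrhart_polyE ->.
move=> l; have Et : Etilde P f phi (- l) y
    = (- y) ^ affdim Q' * (-1) ^+ pdeg phi * Etilde P f phi l y^-1.
  apply: etrans (Etil _ _ Py) (etrans (Edual l y y0 y1) _).
  by congr (_ * _); apply: esym; apply: Etil.
split; last exact: Et.
have EphiE l' Y : Ephi P f phi l' Y = (1 + Y) ^+ pdeg phi * Etilde P f phi l' Y by [].
apply: (etrans (EphiE (- l) y)); apply: (etrans _ (congr1 ( *%R _) (esym (EphiE l y^-1)))).
rewrite Et.
apply: ephi_shuffle y0.
Qed.
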